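(* Let $G$ be a finite simple graph that is AT-irreducible, with $\delta(G) \ge 4$ and $\omega(G) \le \delta(G)$. Put $c := (\delta(G)-2)\alpha_{\delta(G)+1}$ if $\delta(G) \ge 6$, and $c := (\delta(G)-3)\alpha_{\delta(G)+1}$ if $\delta(G) \in \{4,5\}$. Then $2\|G\| \ge g_{\delta(G)+1}(|G|, c)$.
   Context: $|G|$ denotes the number of vertices and $\|G\|$ the number of edges of $G$; $\delta(G)$ is the minimum degree and $\omega(G)$ the clique number. For $k \ge 3$, $\alpha_k := \frac12 - \frac{1}{(k-1)(k-2)}$ and $g_k(n,c) := \left(k-1 + \frac{k-3}{(k-c)(k-1)+k-3}\right) n$. For a directed multigraph $D$, a subgraph $H$ is Eulerian if $d^-_H(v) = d^+_H(v)$ for every $v \in V(H)$; it is even/odd according to the parity of its number of edges. $EE(D)$ (resp. $EO(D)$) is the number of even (resp. odd) spanning Eulerian subgraphs of $D$. For $f: V(G) \to \mathbb{N}$, $G$ is $f$-AT if $G$ has an orientation $D$ with $f(v) \ge d^+_D(v) + 1$ for all $v$ and $EE(D) \ne EO(D)$. $G$ is AT-reducible to $H$ if $H$ is a nonempty induced subgraph of $G$ which is $f_H$-AT, where $f_H(v) := \delta(G) + d_H(v) - d_G(v)$ for $v \in V(H)$. $G$ is AT-irreducible if it is not AT-reducible to any nonempty induced subgraph. *)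

(* Defs.v *)
(* A finite simple graph is a symmetric irreflexive relation on a
   finType. *)
From HB Require Import structures.
From mathcomp Require Import all_boot all_order all_algebra.

Set Implicit Arguments.
Unset Strict Implicit.
Unset Printing Implicit Defensive.

Import Order.TTheory GRing.Theory Num.Theory.

Section Graphs.
Variables (T : finType) (e : rel T).

Definition degree (v : T) : nat := #|[set u | e v u]|.

(* Every degree is < #|T|, so the default value #|T| is inert unless T is
   empty, in which case the minimum degree is 0. *)
Definition min_degree : nat := \big[minn/#|T|]_(v : T) degree v.

Definition edge_set : {set {set T}} :=
  [set [set p.1; p.2] | p in [set p : T * T | e p.1 p.2]].

Definition num_edges : nat := #|edge_set|.

Definition clique (S : {set T}) : bool :=
  [forall x in S, forall y in S, (x != y) ==> e x y].

Definition clique_number : nat := \max_(S : {set T} | clique S) #|S|.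

Definition induced (S : {set T}) : rel {x : T | x \in S} :=
  fun u v => e (val u) (val v).

End Graphs.

Section Digraphs.
Variable T : finType.

(* A digraph on T is its set of arcs; (u, v) is an arc from u to v.  An
   orientation of a simple graph has no parallel arcs, so its spanning
   subgraphs are exactly the subsets of its arc set. *)
Implicit Types D H : {set T * T}.

Definition outdeg D (v : T) : nat := #|[set u | (v, u) \in D]|.
Definition indeg D (v : T) : nat := #|[set u | (u, v) \in D]|.

Definition eulerian H : bool := [forall v, indeg H v == outdeg H v].

Definition EE D : nat :=
  #|[set H : {set T * T} | [&& H \subset D, eulerian H & ~~ odd #|H|]]|.
Definition EO D : nat :=
  #|[set H : {set T * T} | [&& H \subset D, eulerian H & odd #|H|]]|.

Definition orientation (e : rel T) D : Prop :=
  forall u v, (e u v = ((u, v) \in D) || ((v, u) \in D))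
              /\ ~~ (((u, v) \in D) && ((v, u) \in D)).

Definition AT (e : rel T) (f : T -> nat) : Prop :=
  exists D, [/\ orientation e D,
                forall v, outdeg D v + 1 <= f v
              & EE D <> EO D].

End Digraphs.

Section Reducibility.
Variables (T : finType) (e : rel T).

(* The subtraction is truncated; this is harmless since AT requires f > 0, so
   that values <= 0 are ruled out either way. *)
Definition f_sub (S : {set T}) (v : {x : T | x \in S}) : nat :=
  (min_degree e + degree (induced e (S := S)) v) - degree e (val v).

Definition AT_reducible_to (S : {set T}) : Prop :=
  S != set0 /\ AT (induced e (S := S)) (@f_sub S).

Definition AT_irreducible : Prop := forall S : {set T}, ~ AT_reducible_to S.

End Reducibility.

Local Open Scope ring_scope.

Definition alpha (k : nat) : rat :=
  1 / 2 - 1 / ((k%:R - 1) * (k%:R - 2)).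

Definition g (k n : nat) (c : rat) : rat :=
  (k%:R - 1 + (k%:R - 3) / ((k%:R - c) * (k%:R - 1) + k%:R - 3)) * n%:R.

(* Main.v *)
Require Import Defs.
From HB Require Import structures.
From mathcomp Require Import all_boot all_order all_algebra.
From mathcomp Require Import zify ring lra.

(* Write d for the minimum degree.  By the Alon-Tarsi theorem, irreducibility
   says that certain coefficients of the graph polynomials of the induced
   subgraphs vanish.

   Coefficients next to the one of an acyclic orientation of a connected graph
   are computed along a search order (eps below): the root has value 1 and
   every other vertex minus the sum of the values of its earlier neighbours.
   Among the vertices of degree d, irreducibility forces the value 0 at every
   vertex with two earlier neighbours; hence every block of the subgraph
   induced by them is complete or a cycle.  Removing leaf blocks one by one
   bounds the number of its edges, with a surplus for every cluster, i.e. tree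
   of copies of K_d joined by single edges.

   The remaining loss comes from the edges between clusters and vertices of
   degree d + 1.  Each cluster Z contributes, for suitable exponents on Z, a
   linear form in the variables of these vertices; if there were too many such
   edges, a balanced orientation would choose for every cluster a form with one
   or two terms such that all exponents in the product of the forms are small;
   this product is nonzero and has a monomial that irreducibility forbids. *)

Set Implicit Arguments.
Unset Strict Implicit.
Unset Printing Implicit Defensive.

Import Order.TTheory GRing.Theory Num.Theory.
Local Open Scope ring_scope.

(** * Coefficients of the graph polynomial *)

(** The constants are calibrated on the densest pieces of the low part. [slope] gives every copy of
    K_d a [sigma] of 2, so that gluing on a further copy by one edge changes nothing. [alpha] is the
    value at which a leaf block K_(d-1) can be traded for a mark on its root without gain or loss.
    Edges that leave the low part from outside the clusters are charged [alpha] each, by [gap].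
    Edges leaving clusters cannot be charged that way and are bounded from their other ends: a
    vertex of degree d + 1 is granted three of them, and its remaining d + 1 - 3 edges are the
    factor d - 2 in [c]. Clusters are of two kinds. If some vertex of the cluster spends its only
    outgoing edge on another low vertex, this vertex serves as a harmless second end of the linear
    form, and one selected edge is enough. A cluster that is a whole component has no such vertex
    and needs two selected edges with different ends. This is more expensive, but such a component
    keeps its full surplus 2, which is at least 4 [alpha]. *)

Section Coefficients.
Variable T : finType.
Implicit Types (E M : seq (T * T)) (t : {ffun T -> int}) (X : {set T}).

Definition unitv (v : T) : {ffun T -> int} := [ffun u => (u == v)%:R].

(* The coefficient of the monomial with exponents [t] in the product of the
   factors [x_u - x_v] for [(u, v)] in [E]; exponents are integers so that
   subtraction is not truncated. *)
Fixpoint coefg E t : int :=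
  if E is p :: E' then coefg E' (t - unitv p.1) - coefg E' (t - unitv p.2)
  else (t == 0)%:R.

Definition weight X t : int := \sum_(v in X) t v.

Lemma weightD X t t' : weight X (t + t') = weight X t + weight X t'.
Proof. by rewrite /weight -big_split; apply: eq_bigr => v _; rewrite ffunE. Qed.

Lemma weightN X t : weight X (- t) = - weight X t.
Proof. by rewrite /weight -sumrN; apply: eq_bigr => v _; rewrite ffunE. Qed.

Lemma weightB X t t' : weight X (t - t') = weight X t - weight X t'.
Proof. by rewrite weightD weightN. Qed.

Lemma weight0 X : weight X 0 = 0.
Proof. by rewrite /weight big1 // => v _; rewrite ffunE. Qed.

Lemma weight_unitv X v : weight X (unitv v) = (v \in X)%:R.
Proof.
rewrite /weight; case: (boolP (v \in X)) => vX.
  rewrite (bigD1 v) //= ffunE eqxx big1 ?addr0 // => u /andP[_ /negPf uv].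
  by rewrite ffunE uv.
rewrite big1 // => u uX; rewrite ffunE; case: eqP => // uv.
by rewrite -uv uX in vX.
Qed.

Lemma weight_sum X (I : Type) (r : seq I) (F : I -> {ffun T -> int}) :
  weight X (\sum_(i <- r) F i) = \sum_(i <- r) weight X (F i).
Proof.
elim: r => [|i r IH]; first by rewrite !big_nil weight0.
by rewrite !big_cons weightD IH.
Qed.

Definition split_edges X E := forall p, p \in E -> (p.1 \in X) = (p.2 \in X).

Definition num_inside X E := count (fun p => p.1 \in X) E.

(** A factor with both ends in [X] contributes exactly one to the exponents on [X], a factor with
    both ends outside contributes nothing. *)
Lemma coefg_weight X E t : split_edges X E -> coefg E t != 0 ->
  weight X t = (num_inside X E)%:Z.
Proof.
elim: E t => [|p E IH] t HE /=.
  by case: (t =P 0) => [->|]; rewrite ?weight0 ?eqxx.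
have HE' : split_edges X E by move=> q qE; apply: HE; rewrite inE qE orbT.
have Hp := HE p (mem_head _ _).
case: (eqVneq (coefg E (t - unitv p.1)) 0) => [->|/IH -/(_ HE')].
  rewrite sub0r oppr_eq0 => /IH -/(_ HE'); rewrite weightB weight_unitv -Hp.
  by rewrite /num_inside; case: (p.1 \in X) => /=; lia.
by rewrite weightB weight_unitv /num_inside; case: (p.1 \in X) => /=; lia.
Qed.

Definition crossing X M := forall p, p \in M -> p.1 \in X /\ p.2 \notin X.

Lemma coefg_cross_le X M E t : crossing X M -> split_edges X E ->
  coefg (M ++ E) t != 0 -> weight X t <= (num_inside X E + size M)%:Z.
Proof.
move=> + HE; elim: M t => [|p M IH] t HM /=.
  by move=> /(coefg_weight HE) ->; rewrite addn0.
have HM' : crossing X M by move=> q qE; apply: HM; rewrite inE qE orbT.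
have [p1 p2] := HM p (mem_head _ _).
case: (eqVneq (coefg (M ++ E) (t - unitv p.1)) 0) => [->|/IH -/(_ HM')].
  rewrite sub0r oppr_eq0 => /IH -/(_ HM'); rewrite weightB weight_unitv.
  by rewrite (negPf p2); lia.
by rewrite weightB weight_unitv p1; lia.
Qed.

(** The weight on [X] is the largest possible, so every crossing factor must contribute its end in
    [X]. *)
Lemma coefg_cross_all X M E t : crossing X M -> split_edges X E ->
  weight X t = (num_inside X E + size M)%:Z ->
  coefg (M ++ E) t = coefg E (t - \sum_(p <- M) unitv p.1).
Proof.
move=> + HE; elim: M t => [|p M IH] t HM /= Ht; first by rewrite big_nil subr0.
have HM' : crossing X M by move=> q qE; apply: HM; rewrite inE qE orbT.
have [p1 p2] := HM p (mem_head _ _).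
rewrite IH //; last by rewrite weightB weight_unitv p1 Ht; lia.
rewrite big_cons opprD addrA.
case: (eqVneq (coefg (M ++ E) (t - unitv p.2)) 0) => [->|]; first by rewrite subr0.
move/(coefg_cross_le HM' HE); rewrite weightB weight_unitv (negPf p2) Ht.
by lia.
Qed.

(** One below the maximum: exactly one crossing factor, the [p] of the sum, contributes its end
    outside [X], and this costs a sign. *)
Lemma coefg_cross_but1 X M E t : crossing X M -> split_edges X E ->
  weight X t = (num_inside X E + size M)%:Z - 1 ->
  coefg (M ++ E) t =
  - \sum_(p <- M) coefg E (t - \sum_(q <- M) unitv q.1 + unitv p.1 - unitv p.2).
Proof.
move=> + HE; elim: M t => [|p M IH] t HM /= Ht.
  rewrite big_nil oppr0; apply/eqP/negPn/negP => /(coefg_weight HE).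
  by rewrite Ht addn0; lia.
have HM' : crossing X M by move=> q qE; apply: HM; rewrite inE qE orbT.
have [p1 p2] := HM p (mem_head _ _).
rewrite IH //; last by rewrite weightB weight_unitv p1 Ht; lia.
rewrite (coefg_cross_all HM' HE); last first.
  by rewrite weightB weight_unitv (negPf p2) Ht; lia.
rewrite !big_cons opprD addrC; congr (- _ + _).
  congr (coefg E _); set Q := \sum_(_ <- M) _; apply/ffunP => v.
  by rewrite !ffunE; ring.
congr (- _); apply: eq_bigr => q _; congr (coefg E _).
by rewrite opprD !addrA.
Qed.

Lemma coefg_disjoint X E E' t t' :
  (forall p, p \in E -> p.1 \in X /\ p.2 \in X) ->
  (forall p, p \in E' -> p.1 \notin X /\ p.2 \notin X) ->
  (forall v, v \notin X -> t v = 0) -> (forall v, v \in X -> t' v = 0) ->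
  coefg (E ++ E') (t + t') = coefg E t * coefg E' t'.
Proof.
move=> + HE' + Ht'; elim: E t => [|p E IH] t HE Ht /=.
  case: (t =P 0) => [->|/eqP t0]; first by rewrite add0r mul1r.
  rewrite mul0r; apply/eqP/negPn/negP => Hc; case/eqP: t0.
  apply/ffunP => v; rewrite ffunE; case: (boolP (v \in X)) => vX; last exact: Ht.
  have Hs : split_edges [set v] E'.
    move=> p /HE' [p1 p2]; rewrite !inE.
    by case: eqP p1 => [->|_]; rewrite ?vX //; case: eqP p2 => [->|]; rewrite ?vX.
  have := coefg_weight Hs Hc.
  rewrite /weight big_set1 ffunE (Ht' _ vX) addr0 => ->; rewrite /num_inside.
  apply/eqP; rewrite eqz_nat eqn0Ngt -has_count; apply/hasPn => p /HE' [p1 p2].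
  by rewrite inE; case: eqP p1 => [->|//]; rewrite vX.
have HE1 : forall q, q \in E -> q.1 \in X /\ q.2 \in X.
  by move=> q qE; apply: HE; rewrite inE qE orbT.
have [p1 p2] := HE p (mem_head _ _).
have aux u : u \in X -> forall v, v \notin X -> (t - unitv u) v = 0.
  move=> uX v vX; rewrite !ffunE Ht //; case: eqP => [vu|]; last by rewrite subr0.
  by rewrite vu uX in vX.
by rewrite ![_ + t' - _]addrAC !IH ?mulrBl //; apply: aux.
Qed.

Lemma coefg_support X E t :
  (forall p, p \in E -> p.1 \in X /\ p.2 \in X) -> coefg E t != 0 ->
  forall v, 0 <= t v <= (count (fun p => (p.1 == v) || (p.2 == v)) E)%:Z
            /\ (v \notin X -> t v = 0).
Proof.
elim: E t => [|p E IH] t HE /= + v.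
  by case: (t =P 0) => [->|]; rewrite ?eqxx // ffunE.
have HE1 : forall q, q \in E -> q.1 \in X /\ q.2 \in X.
  by move=> q qE; apply: HE; rewrite inE qE orbT.
have [p1 p2] := HE p (mem_head _ _).
have nu u : u \in X -> v \notin X -> (v == u) = false.
  by move=> uX vX; apply/negP => /eqP vu; rewrite vu uX in vX.
case: (eqVneq (coefg E (t - unitv p.1)) 0) => [->|/IH -/(_ HE1 v)].
  rewrite sub0r oppr_eq0 => /IH -/(_ HE1 v); rewrite !ffunE => -[b1 b2].
  split; last by move=> vX; move: (b2 vX); rewrite nu // subr0.
  by move: b1; rewrite (eq_sym v); case: (p.1 == v); case: (p.2 == v); rewrite /=; lia.
rewrite !ffunE => -[b1 b2] _.
split; last by move=> vX; move: (b2 vX); rewrite nu // subr0.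
by move: b1; rewrite (eq_sym v); case: (p.1 == v); case: (p.2 == v); rewrite /=; lia.
Qed.

(* Multiplying by a nonzero linear form keeps a polynomial nonzero: pushing
   the exponent of [y] up must stop, since it is bounded. *)
Lemma linear_form_neq0 (f : {ffun T -> int} -> int) (N : nat) (b : T -> int) y t :
  (forall t', f t' != 0 -> forall v, t' v <= N%:Z) ->
  b y != 0 -> f t != 0 -> exists t', \sum_u b u * f (t' - unitv u) != 0.
Proof.
move=> fN by0; move: {2}(`|N%:Z - t y|)%N (leqnn (`|N%:Z - t y|)%N) => n.
elim: n t => [|n IH] t nt ft.
  exists (t + unitv y).
  have ty := fN _ ft y.
  rewrite (bigD1 y) //= addrK big1 ?addr0 ?mulf_neq0 // => u uy.
  case: (eqVneq (f (t + unitv y - unitv u)) 0) => [->|/fN/(_ y)]; first by rewrite mulr0.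
  by rewrite !ffunE eqxx eq_sym (negPf uy) /=; lia.
case: (eqVneq (\sum_u b u * f (t + unitv y - unitv u)) 0) => [|H]; last by exists (t + unitv y).
rewrite (bigD1 y) //= addrK => /eqP H.
have : has (fun u => (u != y) && (f (t + unitv y - unitv u) != 0)) (enum T).
  apply: contraTT H => /hasPn Hn; rewrite big1 ?addr0 ?mulf_neq0 // => u uy.
  by have := Hn u; rewrite mem_enum uy /= negbK => /(_ isT) /eqP ->; rewrite mulr0.
case/hasP => u _ /andP[uy fu]; apply: (IH (t + unitv y - unitv u)) => //.
have := fN _ ft y; have := fN _ fu y.
by rewrite !ffunE eqxx eq_sym (negPf uy) /=; lia.
Qed.

End Coefficients.

(** * From nonvanishing coefficients to Alon-Tarsi orientations *)

Section AlonTarsi.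
Variable T : finType.
Implicit Types (E : seq (T * T)) (t : {ffun T -> int}).

Lemma big_subset_setU1 (I : finType) (V : zmodType) (p : I) (A : {set I})
    (F : {set I} -> V) : p \notin A ->
  \sum_(H : {set I} | H \subset p |: A) F H =
  \sum_(H : {set I} | H \subset A) F H
  + \sum_(H : {set I} | H \subset A) F (p |: H).
Proof.
move=> pA; rewrite (bigID (fun H : {set I} => p \notin H)) /=; congr (_ + _).
  apply: eq_bigl => H; apply/andP/idP => [[/subsetP HpA pH]|HA].
    apply/subsetP => q qH; have := HpA q qH; rewrite !inE => /orP[/eqP qp|//].
    by rewrite -qp qH in pH.
  split; first exact: subset_trans HA (subsetU1 _ _).
  by apply: contra pA; apply: (subsetP HA).
rewrite (reindex_onto (fun H => p |: H) (fun H => H :\ p)) /=; last first.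
  by move=> H /andP[_]; rewrite negbK => pH; rewrite setD1K.
apply: eq_bigl => H; rewrite negbK setU11 andbT.
apply/andP/idP => [[/subsetP HpA /eqP Hp]|HA].
  apply/subsetP => q qH; have := HpA q; rewrite !inE qH orbT => /(_ isT).
  by case/orP => // /eqP qp; move: qH; rewrite -Hp qp !inE eqxx.
split; first exact: setUS.
by rewrite setU1K //; apply: contra pA; apply: (subsetP HA).
Qed.

(** The expanded product: [H] collects the factors that contribute their second term. *)
Lemma coefg_subsets E t : uniq E ->
  coefg E t = \sum_(H : {set T * T} | H \subset [set p in E])
    (-1) ^+ #|H| *
    (t == \sum_(p <- E) unitv (if p \in H then p.2 else p.1))%:R.
Proof.
elim: E t => [|p E IH] t /=.
  move=> _; rewrite (big_pred1 set0) => [|H]; last first.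
    rewrite /= -subset0; congr (_ \subset _); apply/setP => q; by rewrite !inE.
  by rewrite cards0 big_nil mul1r.
case/andP => pE uE.
have -> : [set q in p :: E] = p |: [set q in E] by apply/setP => q; rewrite !inE.
rewrite big_subset_setU1 ?inE // !IH // -sumrN.
have pn (H : {set T * T}) : H \subset [set q in E] -> p \notin H.
  by move=> /subsetP HE; apply: contra pE => /HE; rewrite inE.
congr (_ + _); apply: eq_bigr => H HE; rewrite big_cons.
  by rewrite (negPf (pn H HE)) subr_eq addrC.
rewrite setU11 cardsU1 (pn H HE) add1n exprS mulN1r mulNr subr_eq addrC.
congr (- (_ * (_ == _ + _)%:R)); rewrite !big_seq; apply: eq_bigr => q qE.
rewrite !inE; case: (q =P p) => //= qp; by rewrite -qp qE in pE.
Qed.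

Definition flip (phi : T * T -> bool) (p : T * T) :=
  if phi p then (p.2, p.1) else p.

Lemma coefg_flip phi E : exists b : bool,
  forall t, coefg (map (flip phi) E) t = (-1) ^+ b * coefg E t.
Proof.
elim: E => [|p E [b IH]]; first by exists false => t; rewrite mul1r.
exists (b (+) phi p) => t /=; rewrite !IH /flip.
by case: (phi p); case: b {IH} => /=; ring.
Qed.

(** A term of the expansion picks one end of every edge; taking it as the tail turns exponents into
    outdegrees. *)
Lemma coefg_orient E t : uniq E -> coefg E t != 0 ->
  exists phi, \sum_(p <- E) unitv (flip phi p).1 = t.
Proof.
elim: E t => [|p E IH] t /=.
  move=> _ H; exists (fun=> false); rewrite big_nil.
  by case: (t =P 0) H => [->//|]; rewrite eqxx.
case/andP => pE uE H.
suff [b [phi Hphi]] : exists b : bool, exists phi,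
    \sum_(q <- E) unitv (flip phi q).1 = t - unitv (if b then p.2 else p.1).
  exists (fun q => if q == p then b else phi q).
  rewrite big_cons {1}/flip eqxx -(subrK (unitv (if b then p.2 else p.1)) t).
  rewrite -Hphi addrC; congr (_ + _); last by case: b {Hphi}.
  rewrite !big_seq; apply: eq_bigr => q qE; rewrite /flip.
  by case: eqP => // qp; rewrite -qp qE in pE.
case: (eqVneq (coefg E (t - unitv p.1)) 0) H => [->|+ _].
  by rewrite sub0r oppr_eq0 => /(IH _ uE) H; exists true.
by move/(IH _ uE) => H; exists false.
Qed.

Definition edge_list (r : rel T) E :=
  [/\ uniq E, forall u v, r u v = ((u, v) \in E) || ((v, u) \in E)
    & forall u v, ~~ (((u, v) \in E) && ((v, u) \in E))].

Lemma sum_unitv_fst (A : {set T * T}) v :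
  (\sum_(p in A) unitv p.1) v = (outdeg A v)%:Z.
Proof.
rewrite sum_ffunE /outdeg.
transitivity (\sum_(p in A | p.1 == v) 1 : int).
  rewrite [RHS]big_mkcondr /=. apply: eq_bigr => p _. rewrite ffunE eq_sym.
  by case: eqP.
rewrite (reindex_onto (fun u => (v, u)) snd) /=; last by move=> [a b] /andP[_ /eqP <-].
rewrite sumr_const pmulrn intz; congr (_%:Z); apply: eq_card => u.
by rewrite !inE unfold_in /= !eqxx ?andbT.
Qed.

Lemma sum_unitv_snd (A : {set T * T}) v :
  (\sum_(p in A) unitv p.2) v = (indeg A v)%:Z.
Proof.
rewrite sum_ffunE /indeg.
transitivity (\sum_(p in A | p.2 == v) 1 : int).
  rewrite [RHS]big_mkcondr /=. apply: eq_bigr => p _. rewrite ffunE eq_sym.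
  by case: eqP.
rewrite (reindex_onto (fun u => (u, v)) fst) /=; last by move=> [a b] /andP[_ /eqP <-].
rewrite sumr_const pmulrn intz; congr (_%:Z); apply: eq_card => u.
by rewrite !inE unfold_in /= !eqxx ?andbT.
Qed.

(** Some orientation [D] has the outdegrees [t]. Rewriting the product along [D] changes at most its
    sign, and its coefficient at [t] is then [EE D] minus [EO D]. *)
Lemma AT_of_coefg (r : rel T) (f : T -> nat) E t : edge_list r E ->
  coefg E t != 0 -> (forall v, t v + 1 <= (f v)%:Z) -> AT r f.
Proof.
move=> [uE rE aE] cE tf.
have [phi Hphi] := coefg_orient uE cE.
have [b Hb] := coefg_flip phi E.
set E0 := map (flip phi) E in Hb *.
have uE0 : uniq E0.
  rewrite map_inj_in_uniq // => -[a1 a2] [b1 b2] aE1 bE1; rewrite /flip /=.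
  have := aE a1 a2; rewrite aE1 /= => na.
  case: (phi _); case: (phi _) => -[] // H1 H2; subst; move: na => //=; rewrite ?bE1 //.
have c0 : coefg E0 t != 0 by rewrite Hb mulf_neq0 ?signr_eq0.
have mE0 u v : ((u, v) \in E0) =
    ((u, v) \in E) && ~~ phi (u, v) || ((v, u) \in E) && phi (v, u).
  apply/mapP/orP => [[[x y] xyE]|[/andP[H1 H2]|/andP[H1 H2]]]; rewrite /flip /=.
  - by case: ifPn => H [-> ->]; [right|left]; rewrite xyE H.
  - by exists (u, v); rewrite // (negPf H2).
  - by exists (v, u); rewrite // H2.
set D := [set p in E0].
have sumD (F : T * T -> {ffun T -> int}) : \sum_(p <- E0) F p = \sum_(p in D) F p.
  by rewrite big_uniq //=; apply: eq_bigl => p; rewrite inE.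
have tD : \sum_(p in D) unitv p.1 = t by rewrite -sumD big_map.
exists D; split.
- move=> u v; rewrite !inE !mE0 rE; have := aE u v.
  by case: ((u, v) \in E); case: ((v, u) \in E); case: (phi (u, v)); case: (phi (v, u)).
- by move=> v; have := tf v; rewrite -tD sum_unitv_fst; lia.
move=> HEE; case/eqP: c0; rewrite coefg_subsets //.
(* Reversing the arcs of [H] preserves all outdegrees exactly if in- and outdegrees agree in [H]. *)
rewrite (eq_bigr (fun H : {set T * T} => (-1) ^+ #|H| * (eulerian H)%:R)); last first.
  move=> H HD; congr (_ * (_ : bool)%:R).
  rewrite sumD -tD (bigID (fun p => p \in H)) [X in _ == X](bigID (fun p => p \in H)) /=.
  have eqH p : (p \in D) && (p \in H) = (p \in H).
    by rewrite andbC; case: (boolP (p \in H)) => // /(subsetP HD) ->.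
  rewrite (eq_bigl _ _ eqH) [X in _ == X + _](eq_bigl _ _ eqH).
  rewrite [X in _ == X + _](eq_bigr (fun p => unitv p.2)); last by move=> p ->.
  rewrite [X in _ == _ + X](eq_bigr (fun p => unitv p.1)); last first.
    by move=> p /andP[_ /negPf ->].
  rewrite (inj_eq (addIr _)); apply/eqP/forallP => [Heq v|Heu].
    by rewrite -eqz_nat -sum_unitv_fst -sum_unitv_snd Heq.
  by apply/ffunP => v; rewrite sum_unitv_fst sum_unitv_snd (eqP (Heu v)).
rewrite (bigID (fun H : {set T * T} => eulerian H)) /= [X in _ + X]big1 ?addr0; last first.
  by move=> H /andP[_ /negPf ->]; rewrite mulr0.
rewrite (bigID (fun H : {set T * T} => odd #|H|)) /=.
rewrite (eq_bigr (fun=> -1)); last first.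
  by move=> H /andP[/andP[_ ->] oH]; rewrite -signr_odd oH mulr1.
rewrite [X in _ + X](eq_bigr (fun=> 1)); last first.
  by move=> H /andP[/andP[_ ->] oH]; rewrite -signr_odd (negPf oH) mulr1.
rewrite !sumr_const mulNrn.
have -> : #|[pred H : {set T * T} | (H \subset D) && eulerian H && odd #|H|]| = EO D.
  by apply: eq_card => H; rewrite !inE andbA.
have -> : #|[pred H : {set T * T} | (H \subset D) && eulerian H && ~~ odd #|H|]| = EE D.
  by apply: eq_card => H; rewrite !inE andbA.
by rewrite HEE addNr.
Qed.

End AlonTarsi.

(** * Transfer to induced subgraphs *)

Section Induced.
Variables (T : finType) (e : rel T).
Hypotheses (e_sym : symmetric e) (e_irr : irreflexive e).
Implicit Types (S : {set T}) (v : T).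

Definition degin S v := #|[set u in S | e v u]|.

Lemma degree_induced S (v : {x : T | x \in S}) :
  degree (induced e (S := S)) v = degin S (val v).
Proof.
rewrite /degree /degin -(card_imset _ val_inj); apply: eq_card => u.
rewrite !inE; apply/imsetP/andP => [[w]|[uS eu]].
  by rewrite inE => ew ->; split => //; apply: valP.
by exists (Sub u uS); rewrite ?inE ?SubK.
Qed.

Lemma coefg_sub S (E : seq ({x | x \in S} * {x | x \in S})) (t : {ffun T -> int}) :
  (forall v, v \notin S -> t v = 0) ->
  coefg [seq (val p.1, val p.2) | p <- E] t = coefg E [ffun u => t (val u)].
Proof.
elim: E t => [|p E IH] t Ht /=.
  congr (_%:R); congr nat_of_bool; apply/eqP/eqP => [->|/ffunP H].
    by apply/ffunP => u; rewrite !ffunE.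
  apply/ffunP => u; rewrite ffunE; case: (boolP (u \in S)) => [uS|/Ht //].
  by have := H (Sub u uS); rewrite !ffunE SubK.
have aux (q : {x | x \in S}) : coefg [seq (val p.1, val p.2) | p <- E] (t - unitv (val q)) =
    coefg E ([ffun u => t (val u)] - unitv q).
  rewrite IH => [|v vS].
    by congr coefg; apply/ffunP => u; rewrite !ffunE (inj_eq val_inj).
  rewrite !ffunE Ht //; case: eqP => [vq|]; last by rewrite subr0.
  by move: vS; rewrite vq (valP q).
by rewrite !aux.
Qed.

Definition restr S : rel T := [rel u v | [&& u \in S, v \in S & e u v]].

(** The form in which irreducibility is used. The bound says [t v + 1 <= f_sub v], with the degree
    moved to the left to avoid the truncated subtraction. *)
Lemma irreducible_coefg S E (t : {ffun T -> int}) :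
  AT_irreducible e -> S != set0 -> edge_list (restr S) E -> coefg E t != 0 ->
  (forall v, v \in S ->
     t v + 1 + (degree e v)%:Z <= (min_degree e + degin S v)%:Z) -> False.
Proof.
move=> irr S0 [uE rE aE] cE tS; case: (irr S); split => //.
have ES p : p \in E -> p.1 \in S /\ p.2 \in S.
  by case: p => a b pE; have := rE a b; rewrite pE /restr /= => /and3P[].
have [E' defE] : exists E' : seq ({x | x \in S} * {x | x \in S}),
    E = [seq (val p.1, val p.2) | p <- E'].
  elim: (E) ES => [|p F IH] HS; first by exists [::].
  have [p1 p2] := HS p (mem_head _ _).
  have [|F' ->] := IH; first by move=> q qF; apply: HS; rewrite inE qF orbT.
  by exists ((Sub p.1 p1, Sub p.2 p2) :: F') => /=; case: p {HS} p1 p2.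
have vinj : injective (fun p : {x | x \in S} * {x | x \in S} => (val p.1, val p.2)).
  by move=> [a b] [c d] [/val_inj -> /val_inj ->].
have mE' (u v : {x | x \in S}) : ((u, v) \in E') = ((val u, val v) \in E).
  by rewrite defE -(mem_map vinj).
apply: (@AT_of_coefg _ _ _ E' [ffun u => t (val u)]).
- split; first by move: uE; rewrite defE map_inj_uniq.
    by move=> u v; rewrite !mE' -rE /restr /= (valP u) (valP v).
  by move=> u v; rewrite !mE'.
- rewrite -coefg_sub -?defE // => v vS.
  by have [_] := coefg_support ES cE v; apply.
move=> v; rewrite ffunE /f_sub degree_induced.
have [/andP[t0 _] _] := coefg_support ES cE (val v).
by have := tS _ (valP v); move: t0 => /=; lia.
Qed.

End Induced.

(** * Search orders *)

Section SearchOrders.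
Variables (T : finType) (e : rel T).
Hypotheses (e_sym : symmetric e) (e_irr : irreflexive e).
Implicit Types (S : {set T}) (v w : T) (s : seq T).

Fixpoint edges s : seq (T * T) :=
  if s is w :: s' then [seq (n, w) | n <- s' & e n w] ++ edges s' else [::].

(* The latest vertex comes first, the root last. *)
Fixpoint search s : bool :=
  if s is w :: s' then
    (s' == [::]) || [&& w \notin s', has (e^~ w) s' & search s']
  else false.

Fixpoint eps s v : int :=
  if s is w :: s' then
    if s' == [::] then (v == w)%:R
    else if v == w then - \sum_(n <- s' | e n w) eps s' n else eps s' v
  else 0.

(* The outdegrees when all edges point to the later vertex, lowered by 1 at the
   root. *)
Fixpoint outs s : {ffun T -> int} :=
  if s is w :: s' then
    if s' == [::] then - unitv w
    else outs s' + \sum_(n <- s' | e n w) unitv n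
  else 0.

Lemma search_uniq s : search s -> uniq s.
Proof.
elim: s => //= w s IH /orP[/eqP ->//|/and3P[-> _ /IH ->]] //.
Qed.

Lemma mem_edges s p : p \in edges s -> [/\ p.1 \in s, p.2 \in s & e p.1 p.2].
Proof.
elim: s => //= w s IH; rewrite mem_cat => /orP[/mapP[n]|/IH[p1 p2 ep]].
  by rewrite mem_filter => /andP[en ns] -> /=; rewrite !inE ns eqxx orbT en.
by rewrite !inE p1 p2 !orbT.
Qed.

Lemma outs_notin s v : v \notin s -> outs s v = 0.
Proof.
elim: s => [|w s IH]; rewrite ?ffunE //= inE negb_or => /andP[vw vs].
case: eqP => _; first by rewrite !ffunE (negPf vw) oppr0.
rewrite ffunE IH // sum_ffunE big_seq_cond big1 // => n /andP[ns _].
by rewrite ffunE; case: eqP => // vn; rewrite vn ns in vs.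
Qed.

Lemma weight_outs (X : {set T}) s : search s -> {subset s <= X} ->
  weight X (outs s) = (size (edges s))%:Z - 1.
Proof.
elim: s => //= w s IH; case: (s =P [::]) => [-> _|_] /=.
  by move=> /(_ w (mem_head _ _)) wX; rewrite weightN weight_unitv wX.
case/and3P => _ _ /IH {}IH sX.
have sX' : {subset s <= X} by move=> v vs; apply: sX; rewrite inE vs orbT.
rewrite weightD IH // size_cat size_map size_filter -big_filter weight_sum.
rewrite (eq_big_seq (fun=> 1)) => [|n].
  by rewrite big_const_seq count_predT iter_addr_0 natz size_filter PoszD; ring.
by rewrite mem_filter weight_unitv => /andP[_ /sX' ->].
Qed.

(** Split off the latest vertex [w]. If [v] is not [w], the exponents on the other vertices are as
    large as possible and every edge at [w] contributes its earlier end. If [v = w] they are one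
    below; summing over the exceptional edge is the recursion of [eps]. *)
Lemma coefg_search s v : search s -> v \in s ->
  coefg (edges s) (outs s + unitv v) = eps s v.
Proof.
elim: s v => //= w s IH v; case: (s =P [::]) => [-> _|s0] /=.
  by rewrite inE => /eqP ->; rewrite addNr !eqxx.
case/and3P => ws _ srch; rewrite inE.
set M := [seq _ | _ <- _].
have HM : crossing [set~ w] M.
  move=> p /mapP[n]; rewrite mem_filter => /andP[en ns] -> /=.
  by rewrite !inE eqxx; split=> //; apply: contraNneq ws => <-.
have sX : {subset s <= [set~ w]}.
  by move=> n ns; rewrite !inE; apply: contraNneq ws => <-.
have HE : split_edges [set~ w] (edges s).
  by move=> p /mem_edges[/sX -> /sX ->].
have nin : num_inside [set~ w] (edges s) = size (edges s).
  by apply/eqP; rewrite -all_count; apply/allP => p /mem_edges[/sX].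
have sumM : \sum_(p <- M) unitv p.1 = \sum_(n <- s | e n w) unitv n.
  by rewrite big_map big_filter.
have wt : weight [set~ w] (\sum_(n <- s | e n w) unitv n) = (size M)%:Z.
  rewrite -sumM weight_sum (eq_big_seq (fun=> 1)) => [|p].
    by rewrite big_const_seq count_predT iter_addr_0 natz.
  by move=> /HM[p1 _]; rewrite weight_unitv p1.
case: (v =P w) => [-> _|/eqP vw /= vs].
  rewrite (coefg_cross_but1 HM HE); last first.
    by rewrite !weightD weight_outs // wt weight_unitv !inE eqxx nin; lia.
  rewrite big_map big_filter; congr (- _); rewrite big_seq_cond [RHS]big_seq_cond.
  apply: eq_bigr => n /andP[ns _]; rewrite -IH // sumM /=; congr coefg.
  set Q := \sum_(_ <- _ | _) _; apply/ffunP => u; rewrite !ffunE; ring.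
rewrite (coefg_cross_all HM HE); last first.
  by rewrite !weightD weight_outs // wt weight_unitv !inE vw nin; lia.
by rewrite -IH // sumM addrAC addrK.
Qed.

Lemma edge_list_edges s : uniq s -> edge_list (restr e [set x in s]) (edges s).
Proof.
elim: s => [|w s IH] /=; first by split=> // u v; rewrite /restr /= !inE.
case/andP => ws us0; have [us rs as_] := IH us0.
have mM u v : ((u, v) \in [seq (n, w) | n <- s & e n w]) = [&& u \in s, v == w & e u w].
  apply/mapP/and3P => [[n]|[us' /eqP -> eu]].
    by rewrite mem_filter => /andP[en ns] [-> ->].
  by exists u; rewrite ?mem_filter ?eu.
have mEl v : ((w, v) \in edges s) = false.
  by apply/negP => /mem_edges[/= ws' _ _]; rewrite ws' in ws.
have mEr u : ((u, w) \in edges s) = false.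
  by apply/negP => /mem_edges[/= _ ws' _]; rewrite ws' in ws.
split.
- rewrite cat_uniq us andbT; apply/andP; split.
    by rewrite map_inj_uniq ?filter_uniq // => a b [->].
  apply/hasPn => p /mem_edges[_ p2 _]; case: p p2 => a b /= bs; rewrite mM.
  by apply/negP => /and3P[_ /eqP bw _]; rewrite bw (negPf ws) in bs.
- move=> u v; rewrite !mem_cat !mM /restr /= !inE.
  have := rs u v; rewrite /restr /= !inE.
  case: (u =P w) => [->|_]; case: (v =P w) => [->|_];
    rewrite ?mEl ?mEr ?(negPf ws) ?e_irr ?andbF ?andbT ?orbF //=.
  by rewrite (e_sym w).
- move=> u v; rewrite !mem_cat !mM; have := as_ u v.
  by case: (u =P w) => [->|_]; case: (v =P w) => [->|_];
    rewrite ?mEl ?mEr ?(negPf ws) ?andbF.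
Qed.

End SearchOrders.

Local Notation sset s := [set x in s].

(** * Degrees inside a set, values of [eps] on low vertices, connected sets *)

Section Connectivity.
Variables (T : finType) (e : rel T).
Hypotheses (e_sym : symmetric e) (e_irr : irreflexive e).
Hypothesis (G_irred : AT_irreducible e).
Implicit Types (S : {set T}) (v w : T) (s : seq T).

Definition low : {set T} := [set v | degree e v == min_degree e].

Lemma sset_cons w s : sset (w :: s) = w |: sset s.
Proof. by apply/setP => x; rewrite !inE. Qed.

Lemma degin_sum S v : degin e S v = (\sum_(u in S) e v u)%N.
Proof.
rewrite /degin -sum1_card big_mkcond [RHS]big_mkcond; apply: eq_bigr => u _.
by rewrite inE; case: (u \in S) => //=; case: (e v u).
Qed.

Lemma degin_eq0 S v : (forall u, u \in S -> ~~ e v u) -> degin e S v = 0%N.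
Proof.
move=> H; apply/eqP; rewrite cards_eq0; apply/eqP/setP => u; rewrite !inE.
by case: (boolP (u \in S)) => //= /H/negPf.
Qed.

Lemma degin_setU1 S v w : w \notin S -> degin e (w |: S) v = (e v w + degin e S v)%N.
Proof.
move=> wS; rewrite /degin.
case: (boolP (e v w)) => evw; last first.
  apply: eq_card => u; rewrite !inE; case: (u =P w) => //= ->.
  by rewrite (negPf evw) (negPf wS).
rewrite (_ : [set _ in _ | _] = w |: [set u in S | e v u]); last first.
  by apply/setP => u; rewrite !inE; case: (u =P w) => //= ->.
by rewrite cardsU1 !inE (negPf wS).
Qed.

Lemma degin_setU S S' v : [disjoint S & S'] ->
  degin e (S :|: S') v = (degin e S v + degin e S' v)%N.
Proof.
move=> dis; rewrite /degin -cardsUI [X in (_ + X)%N](_ : _ = 0)%N ?addn0; last first.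
  apply/eqP; rewrite cards_eq0; apply/eqP/setP => u; rewrite !inE.
  case: (boolP (u \in S)) => //= uS.
  by rewrite (disjointFr dis uS) andbF.
by apply: eq_card => u; rewrite !inE andb_orl.
Qed.

Lemma degin_subset S S' v : S \subset S' -> (degin e S v <= degin e S' v)%N.
Proof.
move=> SS; apply: subset_leq_card; apply/subsetP => u; rewrite !inE.
by case/andP => /(subsetP SS) -> ->.
Qed.

Lemma degin_le_degree S v : (degin e S v <= degree e v)%N.
Proof. by apply: subset_leq_card; apply/subsetP => u; rewrite !inE => /andP[]. Qed.

Lemma degin_gt0 S v u : u \in S -> e v u -> (0 < degin e S v)%N.
Proof. by move=> uS ev; apply/card_gt0P; exists u; rewrite inE uS. Qed.

Lemma degin_ge2 S v u w : u \in S -> w \in S -> u != w -> e v u -> e v w ->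
  (2 <= degin e S v)%N.
Proof.
move=> uS wS uw ev ew; apply: leq_trans (_ : #|[set u; w]| <= _)%N.
  by rewrite cards2 uw.
by apply: subset_leq_card; apply/subsetP => x; rewrite !inE => /orP[]/eqP ->; apply/andP.
Qed.

(** [outs] counts the later neighbours. Every vertex but the root has an earlier neighbour as well,
    and the root has been lowered by 1. *)
Lemma outs_le s v : search e s -> v \in s ->
  outs e s v <= (degin e (sset s) v)%:Z - 1.
Proof.
elim: s v => //= w s IH v; case: (s =P [::]) => [-> _|s0] /=.
  by rewrite inE => /eqP ->; rewrite !ffunE eqxx; lia.
case/and3P => ws /hasP[n ns en] srch; rewrite inE sset_cons degin_setU1 ?inE //.
have sumv : (\sum_(n <- s | e n w) unitv n) v = (e v w && (v \in s))%:R.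
  rewrite sum_ffunE; case: (boolP (v \in s)) => vs.
    rewrite big_mkcond (bigD1_seq v) ?(search_uniq srch) //= andbT [unitv v v]ffunE eqxx.
    rewrite big1 ?addr0 => [|u uv]; first by case: (e v w).
    by rewrite ffunE eq_sym (negPf uv); case: ifP.
  rewrite andbF big_seq_cond big1 // => u /andP[us _]; rewrite ffunE.
  by case: eqP => // vu; rewrite vu us in vs.
case: (v =P w) => [vw _|vw /= vs].
  rewrite ffunE sumv vw (negPf ws) andbF outs_notin // e_irr.
  have : (0 < degin e (sset s) w)%N by apply: (@degin_gt0 _ _ n); rewrite ?inE // e_sym.
  by lia.
have := IH v srch vs; rewrite ffunE sumv vs andbT; case: (e v w) => /=; lia.
Qed.

Lemma degree_low v : v \in low -> degree e v = min_degree e.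
Proof. by rewrite inE => /eqP. Qed.

(* The monomial [outs + unitv w] would witness that the graph on [w :: s] is
   degree-AT. *)
Lemma eps_low w s : search e (w :: s) -> {subset w :: s <= low} ->
  (2 <= degin e (sset s) w)%N -> eps e (w :: s) w = 0.
Proof.
move=> srch sL d2; apply/eqP/negPn/negP => He.
have us := search_uniq srch.
apply: (@irreducible_coefg _ e (sset (w :: s)) (edges e (w :: s))
         (outs e (w :: s) + unitv w)) => //.
- by apply/set0Pn; exists w; rewrite !inE eqxx.
- exact: edge_list_edges.
- by rewrite coefg_search ?mem_head.
move=> v; rewrite inE => vs; rewrite (degree_low (sL v vs)).
have := outs_le srch vs; rewrite ffunE [unitv _ _]ffunE.
case: (v =P w) => [->|_]; last first.
  by rewrite addr0; move: (outs e (w :: s) v) (degin e _ v) => a b; lia.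
move=> _; have ws : w \notin s by case/andP: us.
rewrite sset_cons degin_setU1 ?inE // e_irr /=.
case: (s =P [::]) d2 => [->|s0 d2].
  rewrite /degin (_ : [set _ in _ | _] = set0) ?cards0 //.
  by apply/setP => u; rewrite !inE.
rewrite ffunE outs_notin // add0r sum_ffunE big_seq_cond big1 ?add0r; last first.
  move=> n /andP[ns _]; rewrite ffunE; case: eqP => // wn.
  by rewrite wn ns in ws.
by move: d2; move: (degin e _ w) => b; lia.
Qed.

Lemma epsE w s : s != [::] ->
  eps e (w :: s) w = - \sum_(n <- s | e n w) eps e s n.
Proof. by move=> /negPf /= ->; rewrite eqxx. Qed.

Lemma eps_cons w s v : w \notin s -> v \in s -> eps e (w :: s) v = eps e s v.
Proof.
move=> ws vs /=; case: (s =P [::]) vs => [->//|_] vs.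
by case: eqP => // vw; rewrite vw (negPf ws) in vs.
Qed.

Lemma sum_nbrs s w (F : T -> int) : uniq s ->
  \sum_(n <- s | e n w) F n = \sum_(n in [set u in sset s | e w u]) F n.
Proof.
move=> us; rewrite big_uniq_cond //= || rewrite -big_filter big_uniq ?filter_uniq //=.
by apply: eq_bigl => n; rewrite !inE ?mem_filter andbC e_sym.
Qed.

Lemma sum_eps_low w s : search e s -> w \notin s -> {subset w :: s <= low} ->
  (2 <= degin e (sset s) w)%N ->
  \sum_(n in [set u in sset s | e w u]) eps e s n = 0.
Proof.
move=> srch ws sL d2.
have [n] : exists n, n \in [set u in sset s | e w u].
  by apply/card_gt0P; apply: leq_trans d2.
rewrite !inE => /andP[ns ewn].
have srch' : search e (w :: s).
  rewrite /= ws srch andbT; apply/orP; right; apply/hasP; exists n => //.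
  by rewrite e_sym.
have s0 : s != [::] by case: (s) ns.
have := eps_low srch' sL d2; rewrite epsE // sum_nbrs ?(search_uniq srch) //.
by move/eqP; rewrite oppr_eq0 => /eqP.
Qed.

(** Connectivity is expressed by edges leaving proper subsets, since such an edge is what extends a
    search order. *)
Definition conn S : bool :=
  (S != set0) && [forall A : {set T}, (A \proper S) && (A != set0) ==>
                  [exists a in A, exists b in S :\: A, e a b]].

Lemma connP S : reflect (S != set0 /\ forall A : {set T}, A \proper S ->
    A != set0 -> exists a b, [/\ a \in A, b \in S, b \notin A & e a b]) (conn S).
Proof.
apply: (iffP andP) => -[S0 H]; split=> //.
  move=> A AS A0; have := forallP H A; rewrite AS A0 => /existsP[a /andP[aA]].
  by case/existsP => b /andP[]; rewrite inE => /andP[bA bS] eab; exists a, b.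
apply/forallP => A; apply/implyP => /andP[AS A0].
have [a [b [aA bS bA eab]]] := H A AS A0.
by apply/existsP; exists a; rewrite aA; apply/existsP; exists b; rewrite inE bS bA.
Qed.

Lemma conn_split S : S != set0 -> ~~ conn S -> exists A : {set T},
  [/\ A \proper S, A != set0 & forall a b, a \in A -> b \in S -> b \notin A -> ~~ e a b].
Proof.
move=> S0; rewrite negb_and S0 /= negb_forall => /existsP[A].
rewrite negb_imply => /andP[/andP[AS A0] H]; exists A; split=> // a b aA bS bA.
apply: contra H => eab; apply/existsP; exists a; rewrite aA.
by apply/existsP; exists b; rewrite inE bS bA.
Qed.

Lemma conn1 v : conn [set v].
Proof.
apply/connP; split; first by apply/set0Pn; exists v; rewrite inE.
by move=> A /properP[]; rewrite subset1 => /orP[/eqP ->|/eqP ->]; [case=> x -> | rewrite eqxx].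
Qed.

Lemma conn_union S S' a b : conn S -> conn S' -> a \in S -> b \in S' -> e a b ->
  conn (S :|: S').
Proof.
move=> cS cS' aS bS' eab; apply/connP; split.
  by apply/set0Pn; exists a; rewrite inE aS.
move=> A /properP[AS [x xS xA]] /set0Pn[y yA].
have aux R : conn R -> R \subset S :|: S' ->
    (exists a b, [/\ a \in A, b \in S :|: S', b \notin A & e a b])
    \/ R \subset A \/ [disjoint R & A].
  move=> /connP[_ cR] RS.
  case: (boolP (A :&: R == set0)) => [/eqP R0|R0].
    by right; right; rewrite -setI_eq0 setIC R0.
  case: (boolP (R \subset A)) => RA; first by right; left.
  have [|c [d [cA dR dA ecd]]] := cR (A :&: R) _ R0.
    by rewrite properE subsetIr /=; apply: contra RA => /subsetP H;
       apply/subsetP => z /H; rewrite inE => /andP[].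
  left; exists c, d; split=> //; first by move: cA; rewrite inE => /andP[].
    exact: (subsetP RS).
  by apply: contra dA => dA; rewrite inE dA.
case: (aux S cS (subsetUl _ _)) => // HS; case: (aux S' cS' (subsetUr _ _)) => // HS'.
move: (subsetP AS y yA) xS; rewrite !inE.
case: HS HS' => [/subsetP HS|HS] [/subsetP HS'|HS'].
- by move=> _ /orP[/HS|/HS'] H; rewrite H in xA.
- move=> _ /orP[/HS H|xS']; first by rewrite H in xA.
  exists a, b; split; rewrite ?inE ?bS' ?orbT ?(HS a) //.
  by apply/negP => bA; have := disjointFr HS' bS'; rewrite bA.
- move=> _ /orP[xS|/HS' H]; last by rewrite H in xA.
  exists b, a; split; rewrite ?inE ?aS ?(HS' b) // 1?e_sym //.
  by apply/negP => aA; have := disjointFr HS aS; rewrite aA.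
- by case/orP => yS; [have := disjointFr HS yS|have := disjointFr HS' yS]; rewrite yA.
Qed.

Lemma conn_setU1 S v u : conn S -> u \in S -> e v u -> conn (v |: S).
Proof. by move=> cS uS ev; apply: conn_union (conn1 v) cS _ uS ev; rewrite inE. Qed.

Lemma search_conn s : search e s -> conn (sset s).
Proof.
elim: s => //= w s IH; rewrite sset_cons => /orP[/eqP ->|/and3P[ws /hasP[n ns en] /IH cs]].
  by rewrite (_ : sset [::] = set0) ?setU0 ?conn1 //; apply/setP => x; rewrite !inE.
by apply: (conn_setU1 cs (u := n)); rewrite ?inE // e_sym.
Qed.

Lemma conn_extend S s : conn S -> search e s -> {subset s <= S} ->
  exists s', search e (s' ++ s) /\ sset (s' ++ s) = S.
Proof.
move=> cS; move: {2}(#|S :\: sset s|) (leqnn #|S :\: sset s|) => n.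
elim: n s => [|n IH] s ns srch sS.
  exists [::]; split=> //; apply/setP => x; apply/idP/idP; first by rewrite inE => /sS.
  move=> xS; apply/negPn/negP => xs; move: ns; rewrite leqn0 cards_eq0 => /eqP/setP/(_ x).
  by move: xs; rewrite !inE => ->; rewrite xS.
case: (boolP (sset s == S)) => [/eqP <-|neS]; first by exists [::].
have sub : sset s \subset S by apply/subsetP => x; rewrite inE => /sS.
have [_ /(_ (sset s))] := connP _ cS.
case; first by rewrite properEneq neS.
  by apply/set0Pn; case: (s) srch => // w s' _; exists w; rewrite inE mem_head.
move=> a [b [/[!inE] as_ bS bs eab]].
have [||| s' [srch' defS]] := IH (b :: s).
- rewrite -ltnS; apply: leq_trans ns; apply: proper_card; apply/properP; split.
    by apply/subsetP => x; rewrite !inE negb_or => /andP[/andP[_ ->] ->].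
  by exists b; rewrite !inE ?bS ?(negPf bs) ?eqxx.
- by rewrite /= bs srch /=; apply/orP; right; rewrite andbT; apply/hasP; exists a.
- by move=> x; rewrite inE => /orP[/eqP ->|/sS].
by exists (rcons s' b); rewrite cat_rcons.
Qed.

(** The latest vertex of a search order rooted at [r]: the rest is still a search order. *)
Lemma conn_noncut S r : conn S -> r \in S -> (2 <= #|S|)%N ->
  exists w, [/\ w \in S, w != r & conn (S :\ w)].
Proof.
move=> cS rS S2; have [||[|w s] [srch defS]] := @conn_extend S [:: r] cS.
- by [].
- by move=> x; rewrite inE => /eqP ->.
- move: S2; rewrite -defS /= (_ : sset [:: r] = [set r]) ?cards1 //.
  by apply/setP => x; rewrite !inE.
exists w; rewrite -defS /= !inE eqxx; split=> //.
  case/andP: (search_uniq srch) => H _; apply: contraNneq H => ->.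
  by rewrite mem_cat mem_head orbT.
have /= := srch; case: eqP => [|_ /= /and3P[ws _ srch']]; first by case: (s).
rewrite (_ : sset _ :\ w = sset (s ++ [:: r])) ?search_conn //.
apply/setP => x; rewrite !inE; case: eqP => //= ->.
by rewrite (negPf ws).
Qed.

(** [D] is a union, possibly empty, of components of [S :\ u]. *)
Definition closed_by S u (D : {set T}) :=
  [/\ D \subset S, u \notin D &
   forall a b, a \in D -> b \in S -> e a b -> b \in u |: D].

Lemma conn_side S u D : conn S -> u \in S -> closed_by S u D -> conn (u |: D).
Proof.
move=> /connP[S0 cS] uS [DS uD clD]; apply/connP; split.
  by apply/set0Pn; exists u; rewrite setU11.
have uDS : u |: D \subset S.
  by apply/subsetP => x; rewrite !inE => /orP[/eqP ->//|/(subsetP DS)].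
move=> A /properP[/subsetP AuD [x xuD xA]] A0.
case: (boolP (u \in A)) => uA; last first.
  have AD : A \subset D.
    apply/subsetP => y yA; have := AuD y yA; rewrite !inE => /orP[/eqP yu|//].
    by rewrite -yu yA in uA.
  case: (cS A _ A0) => [|a [b [aA bS bA eab]]].
    by apply/properP; split; [exact: subset_trans DS|exists u].
  by exists a, b; split=> //; apply: clD (eab) => //; apply: (subsetP AD).
have [||a [b [aA bS bA eab]]] := cS ((u |: D) :\: A).
- apply/properP; split; first exact: subset_trans (subsetDl _ _) uDS.
  by exists u; rewrite // !inE uA.
- by apply/set0Pn; exists x; rewrite inE xA.
have aD : a \in D.
  move: aA; rewrite !inE => /andP[aA /orP[/eqP au|//]]; by rewrite au uA in aA.
have bA' : b \in A.
  by move: bA; rewrite in_setD (clD a b) // andbT negbK.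
exists b, a; split=> //; last by rewrite e_sym.
  by rewrite inE aD orbT.
by move: aA; rewrite inE => /andP[].
Qed.

Lemma conn_setD_side S u D : conn S -> u \in S -> closed_by S u D -> conn (S :\: D).
Proof.
move=> /connP[S0 cS] uS [DS uD clD]; apply/connP; split.
  by apply/set0Pn; exists u; rewrite inE uD.
move=> A /properP[/subsetP ASD [x xSD xA]] A0.
have out a b : a \in S -> a \notin D -> a != u -> b \in S -> e a b -> b \notin D.
  move=> aS aD au bS eab; apply/negP => bD.
  by have := clD b a bD aS; rewrite e_sym eab !inE (negPf au) (negPf aD) => /(_ isT).
case: (boolP (u \in A)) => uA; last first.
  case: (cS A _ A0) => [|a [b [aA bS bA eab]]].
    apply/properP; split; last by exists u.
    by apply/subsetP => y /ASD; rewrite inE => /andP[].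
  exists a, b; split=> //; rewrite inE bS andbT.
  have := ASD a aA; rewrite inE => /andP[aD aS]; apply: out (eab) => //.
  by apply: contraNneq uA => <-.
have [||a [b [aA bS bA eab]]] := cS ((S :\: D) :\: A).
- apply/properP; split; last by exists u; rewrite // !inE uA.
  by apply/subsetP => y; rewrite !inE => /and3P[].
- by apply/set0Pn; exists x; rewrite inE xA.
move: aA; rewrite !inE => /and3P[aA aD aS].
have bD : b \notin D by apply: out (eab) => //; apply: contraNneq aA => ->.
have bA' : b \in A by move: bA; rewrite !inE bD bS /= andbT negbK.
by exists b, a; split; rewrite ?inE ?aD // e_sym.
Qed.

End Connectivity.

(** * Blocks of the low-degree part *)

Section MinimalConnectedSets.
Variables (T : finType) (e : rel T).
Hypotheses (e_sym : symmetric e) (e_irr : irreflexive e).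
Hypothesis (G_irred : AT_irreducible e).
Implicit Types (S B : {set T}) (v w : T) (s : seq T).

Notation low := (low e).
Notation conn := (conn e).
Notation degin := (degin e).

(** A Steiner set for the terminals [B], minimal under inclusion. *)
Definition minimal_conn S B :=
  [/\ conn S, B \subset S & forall S' : {set T}, S' \proper S -> B \subset S' -> ~~ conn S'].

Definition triangle_free S :=
  forall a b c, a \in S -> b \in S -> c \in S -> e a b -> e b c -> e a c -> False.

Lemma conn_degin_gt0 S v : conn S -> v \in S -> (2 <= #|S|)%N -> (0 < degin S v)%N.
Proof.
move=> /connP[_ cS] vS S2.
have [||a [b [/[!inE]/eqP -> bS _ eab]]] := cS [set v].
- by rewrite properEcard sub1set vS cards1.
- by apply/set0Pn; exists v; rewrite inE.
exact: degin_gt0 eab.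
Qed.

(** If [u] is a cut vertex, a side away from [w] must contain a terminal unless [u] is one:
    otherwise deleting this side would leave a smaller connected set around [B]. If [u] is not a cut
    vertex, it is itself a terminal and the empty side will do. *)
Lemma minimal_conn_side S B w u : minimal_conn S B -> w \in S -> u \in S -> w != u ->
  exists D, [/\ closed_by e S u D, w \notin D & exists b, b \in B /\ b \in u |: D].
Proof.
move=> [cS BS minS] wS uS wu.
case: (boolP (conn (S :\ u))) => cu.
  exists set0; split; rewrite ?inE //.
    by split; rewrite ?sub0set ?inE // => a b; rewrite inE.
  exists u; rewrite setU11; split=> //; apply: contraTT cu => uB; apply: minS.
    exact: properD1.
  apply/subsetP => x xB; rewrite !inE (subsetP BS) // andbT.
  by apply: contraNneq uB => <-.
have [|A [/properP[AS [x xS xA]] A0 nA]] := conn_split _ cu.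
  by apply/set0Pn; exists w; rewrite !inE wu.
have [D [clD wD D0]] : exists D, [/\ closed_by e S u D, w \notin D & D != set0].
  case: (boolP (w \in A)) => wA; [exists ((S :\ u) :\: A)|exists A]; split=> //.
  - split; first by apply/subsetP => y; rewrite !inE => /and3P[].
      by rewrite !inE eqxx andbF.
    move=> a b aD bS eab; rewrite !inE bS; case: (b =P u) => //= /eqP bu.
    rewrite andbT; apply/negP => bA; move: aD; rewrite inE => /andP[aA aS].
    by have := nA b a bA aS aA; rewrite e_sym eab.
  - by rewrite inE wA.
  - by apply/set0Pn; exists x; rewrite inE xA.
  split; first by apply/subsetP => y /(subsetP AS); rewrite inE => /andP[].
    by apply/negP => /(subsetP AS); rewrite !inE eqxx.
  move=> a b aA bS eab; rewrite !inE; case: (b =P u) => //= /eqP bu.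
  have bSu : b \in S :\ u by rewrite !inE bu.
  by apply: contraT => bA; have := nA a b aA bSu bA; rewrite eab.
exists D; split=> //.
case: (boolP [exists b in B, b \in D]) => [/existsP[b /andP[bB bD]]|nB].
  by exists b; rewrite inE bD orbT.
have cD := conn_setD_side e_sym cS uS clD.
suff : ~~ conn (S :\: D) by rewrite cD.
apply: minS.
- apply/properP; split; first exact: subsetDl.
  by have /set0Pn[y yD] := D0; exists y; rewrite ?inE ?yD //; case: clD => /subsetP/(_ y yD).
- apply/subsetP => y yB; rewrite inE (subsetP BS) // andbT.
  by apply: contra nB => yD; apply/existsP; exists y; rewrite yB.
Qed.

Lemma card_ge3 S a b c : a \in S -> b \in S -> c \in S -> a != b -> a != c -> b != c ->
  (2 < #|S|)%N.
Proof.
move=> aS bS cS ab ac bc; apply: leq_trans (_ : #|[set a; b; c]| <= _)%N.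
  by rewrite setUAC setUC cardsU1 cards2 !inE ac (eq_sym b c) !negb_or ?(eq_sym c) ?ab ?ac ?bc ?(eq_sym b) ?ab.
by apply: subset_leq_card; apply/subsetP => x; rewrite !inE => /orP[/orP[]|]/eqP ->.
Qed.

(** Since [S :\ w] is connected, [w] is a terminal. Two neighbours [u1], [u2] of [w] would each have
    a side away from [w] with a further terminal. So there are three terminals, and by minimality
    [S] consists of [w] and the two sides with their roots. *)
Lemma minimal_conn_leaf S B w : minimal_conn S B -> w \in S -> conn (S :\ w) ->
  (#|B| <= 2)%N \/ (#|B| <= 3)%N /\ triangle_free S -> (degin S w <= 1)%N.
Proof.
move=> mS wS cw HB; have [cS BS minS] := mS; rewrite leqNgt; apply/negP.
rewrite /degin => /card_gt1P[u1 [u2 []]]; rewrite !inE => /andP[u1S ew1] /andP[u2S ew2] u12.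
have wB : w \in B.
  apply: contraTT cw => wB; apply: minS; first exact: properD1.
  apply/subsetP => x xB; rewrite !inE (subsetP BS) // andbT.
  by apply: contraNneq wB => <-.
have wu1 : w != u1 by apply: contraTneq ew1 => <-; rewrite e_irr.
have wu2 : w != u2 by apply: contraTneq ew2 => <-; rewrite e_irr.
have [D1 [cl1 wD1 [b1 [b1B b1D]]]] := minimal_conn_side mS wS u1S wu1.
have [D2 [cl2 wD2 [b2 [b2B b2D]]]] := minimal_conn_side mS wS u2S wu2.
have [D1S u1D1 H1] := cl1; have [D2S u2D2 H2] := cl2.
have u2D1 : u2 \notin D1.
  apply/negP => /H1 /(_ wS); rewrite e_sym ew2 => /(_ isT).
  by rewrite !inE (negPf wu1) (negPf wD1).
have u1D2 : u1 \notin D2.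
  apply/negP => /H2 /(_ wS); rewrite e_sym ew1 => /(_ isT).
  by rewrite !inE (negPf wu2) (negPf wD2).
have D12 : D1 :&: D2 = set0.
  apply/eqP/negPn/negP => D0; have [_ cS'] := connP _ _ cS.
  have [|a [b [/[!inE]/andP[aD1 aD2] bS bD eab]]] := cS' (D1 :&: D2) _ D0.
    apply/properP; split; first by apply: subset_trans (subsetIl _ _) D1S.
    by exists w; rewrite // inE (negPf wD1).
  move: bD (H1 a b aD1 bS eab) (H2 a b aD2 bS eab); rewrite !inE.
  case: (b =P u1) => [->|_] /=; first by rewrite (negPf u1D2) orbF (negPf u12).
  case: (b =P u2) => [->|_] /=; first by rewrite (negPf u2D1).
  by move=> /negP nb b1' b2'; apply: nb; rewrite b1' b2'.
have b12 : b1 != b2.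
  apply/eqP => bb; move: b1D b2D; rewrite -bb !inE.
  case: (b1 =P u1) => [->|_] /=; first by rewrite (negPf u12) (negPf u1D2).
  case: (b1 =P u2) => [->|_] /=; first by rewrite (negPf u2D1).
  by move=> h1 h2; have := in_set0 b1; rewrite -D12 inE h1 h2.
have wb1 : w != b1.
  by apply: contraTneq b1D => <-; rewrite !inE (negPf wu1) (negPf wD1).
have wb2 : w != b2.
  by apply: contraTneq b2D => <-; rewrite !inE (negPf wu2) (negPf wD2).
have B3 := card_ge3 wB b1B b2B wb1 wb2 b12.
case: HB => [|[B3' tf]]; first by rewrite leqNgt B3.
have defB x : x \in B -> [|| x == w, x == b1 | x == b2].
  move=> xB; apply: contraTT B3' => nx; rewrite -ltnNge.
  move: nx; rewrite !negb_or => /and3P[xw x1 x2].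
  apply: leq_trans (_ : #|x |: [set w; b1; b2]| <= _)%N.
    rewrite cardsU1 !inE (negPf xw) (negPf x1) (negPf x2) /= ltnS.
    by apply: (@card_ge3 _ w b1 b2); rewrite ?inE ?eqxx ?orbT.
  by apply: subset_leq_card; apply/subsetP => y; rewrite !inE
     => /orP[/eqP ->//|/orP[/orP[]|]/eqP ->].
set C1 := u1 |: D1; set C2 := u2 |: D2.
have c1 : conn (w |: C1).
  by apply: (conn_setU1 e_sym (conn_side e_sym cS u1S cl1) (u := u1)); rewrite ?setU11.
have c12 : conn ((w |: C1) :|: C2).
  apply: (conn_union e_sym c1 (conn_side e_sym cS u2S cl2) (a := w) (b := u2)) => //.
    by rewrite setU11.
  by rewrite setU11.
have sub : (w |: C1) :|: C2 \subset S.
  apply/subsetP => x; rewrite !inE => /orP[/orP[/eqP ->//|/orP[/eqP ->//|]]|/orP[/eqP ->//|]].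
    exact: (subsetP D1S).
  exact: (subsetP D2S).
have defS : (w |: C1) :|: C2 = S.
  apply/eqP; rewrite eqEproper sub /=; apply/negP => pS.
  suff : ~~ conn ((w |: C1) :|: C2) by rewrite c12.
  apply: minS pS _.
  apply/subsetP => x /defB /or3P[]/eqP ->; rewrite in_setU.
  - by rewrite setU11.
  - by rewrite in_setU1 b1D orbT.
  - by rewrite b2D orbT.
(* Without [w] the two sides are still joined, and only an edge between [u1] and [u2] can join them:
   a triangle with [w]. *)
have [_ cw'] := connP _ _ cw.
have [||a [b [aC bSw bC eab]]] := cw' C1.
- apply/properP; split.
    apply/subsetP => x xC; rewrite !inE; apply/andP; split.
      by apply: contraTneq xC => ->; rewrite !inE (negPf wu1) (negPf wD1).
    by rewrite -defS in_setU in_setU1 xC orbT.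
  exists u2; first by rewrite !inE u2S andbT eq_sym.
  by rewrite !inE negb_or (eq_sym u2) u12 u2D1.
- by apply/set0Pn; exists u1; rewrite setU11.
have bS : b \in S by move: bSw; rewrite inE => /andP[].
have bC2 : b \in C2.
  have := bS; rewrite -defS in_setU in_setU1 => /orP[/orP[|H]|//]; last by rewrite H in bC.
  by move: bSw; rewrite !inE => /andP[/negPf ->].
have au1 : a = u1.
  move: aC; rewrite !inE => /orP[/eqP//|aD].
  by have := H1 a b aD bS eab; rewrite -/C1 (negPf bC).
have bu2 : b = u2.
  move: bC2; rewrite !inE => /orP[/eqP//|bD].
  have := H2 b a bD; rewrite au1 => /(_ u1S); rewrite e_sym -{1}au1 eab => /(_ isT).
  by rewrite !inE (negPf u12) (negPf u1D2).
by apply: (tf w u1 u2) => //; rewrite -au1 -bu2.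
Qed.

(** The neighbour [u] inherits the role of the removed terminal: adding [w] to a smaller connected
    set through [u] would contradict the minimality of [S]. *)
Lemma minimal_conn_step S B w u : minimal_conn S B -> w \in B -> u \in S -> e w u ->
  conn (S :\ w) -> minimal_conn (S :\ w) (u |: B :\ w).
Proof.
move=> [cS BS minS] wB uS ewu cw; split=> //.
  apply/subsetP => x; rewrite !inE => /orP[/eqP ->|/andP[-> /(subsetP BS) //]].
  by rewrite uS andbT; apply: contraTneq ewu => ->; rewrite e_irr.
move=> S' /properP[S'S [x xS xS']] BS'; apply/negP => cS'.
have cwS' : conn (w |: S').
  by apply: (conn_setU1 e_sym cS' (u := u)) => //; apply: (subsetP BS'); rewrite setU11.
suff : ~~ conn (w |: S') by rewrite cwS'.
apply: minS.
- apply/properP; split.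
    apply/subsetP => y; rewrite !inE => /orP[/eqP ->|/(subsetP S'S)].
      exact: (subsetP BS).
    by rewrite !inE => /andP[].
  move: xS; rewrite !inE => /andP[xw xS]; exists x => //.
  by rewrite !inE negb_or xw.
- apply/subsetP => y yB; rewrite !inE; case: (y =P w) => //= /eqP yw.
  by apply: (subsetP BS'); rewrite !inE yw yB orbT.
Qed.

Fixpoint tree_order s : bool :=
  if s is w :: s' then
    (s' == [::]) || [&& w \notin s', degin (sset s') w == 1%N & tree_order s']
  else false.

Lemma tree_search s : tree_order s -> search e s.
Proof.
elim: s => //= w s IH /orP[->//|/and3P[-> /eqP d1 /IH ->]]; rewrite andbT.
apply/orP; right; have /card_gt0P[u] : (0 < degin (sset s) w)%N by rewrite d1.
by rewrite !inE => /andP[us ewu]; apply/hasP; exists u => //; rewrite e_sym.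
Qed.

(** Remove vertices other than [r] one by one, keeping the set connected. Each of them is a leaf,
    and replacing it by its neighbour among the terminals does not increase their number. *)
Lemma minimal_conn_tree S B r : minimal_conn S B -> r \in B ->
  (#|B| <= 2)%N \/ (#|B| <= 3)%N /\ triangle_free S ->
  exists s, [/\ tree_order (rcons s r) & sset (rcons s r) = S].
Proof.
move: {2}(#|S|) (leqnn #|S|) => n; elim: n S B => [|n IH] S B nS mS rB HB.
  have [cS BS _] := mS; move: nS; rewrite leqn0 cards_eq0 => /eqP S0.
  by have := subsetP BS r rB; rewrite S0 inE.
have [cS BS minS] := mS; have rS := subsetP BS r rB.
case: (leqP #|S| 1) => S1.
  have /cards1P[x defS] : #|S| == 1%N by rewrite eqn_leq S1; apply/card_gt0P; exists r.
  exists [::]; split=> //; rewrite defS; move: rS; rewrite defS inE => /eqP ->.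
  by apply/setP => y; rewrite !inE.
have [w [wS wr cw]] := conn_noncut e_sym cS rS S1.
have d1 : degin S w = 1%N.
  by apply/eqP; rewrite eqn_leq (minimal_conn_leaf mS) // conn_degin_gt0.
have wB : w \in B.
  apply: contraTT cw => wB; apply: minS; first exact: properD1.
  apply/subsetP => x xB; rewrite !inE (subsetP BS) // andbT.
  by apply: contraNneq wB => <-.
have /card_gt0P[u] : (0 < degin S w)%N by rewrite d1.
rewrite inE => /andP[uS ewu].
have Bc : (#|u |: B :\ w| <= #|B|)%N.
  by rewrite cardsU1 [X in (_ <= X)%N](cardsD1 w) wB; case: (_ \notin _).
have [||||s [tr defs]] := IH (S :\ w) (u |: B :\ w).
- by rewrite -ltnS (leq_trans _ nS) // [X in (_ < X)%N](cardsD1 w) wS.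
- exact: minimal_conn_step.
- by rewrite !inE rB (eq_sym r w) wr orbT.
- case: HB => [B2|[B3 tf]]; [left|right]; rewrite ?(leq_trans Bc) //; split=> //.
  by move=> a b c; rewrite !inE => /andP[_ aS] /andP[_ bS] /andP[_ cS']; apply: tf.
have ws : w \notin rcons s r.
  by move/setP/(_ w): defs; rewrite !inE eqxx => ->.
exists (w :: s); split; last by rewrite rcons_cons sset_cons defs setD1K.
rewrite rcons_cons /= ws tr andbT; apply/orP; right => /=.
rewrite defs; apply/eqP; rewrite -d1 -{2}(setD1K wS) degin_setU1 ?e_irr //.
by rewrite !inE eqxx.
Qed.

Lemma degin1_sum S w u (F : T -> int) : degin S w = 1%N -> u \in S -> e w u ->
  \sum_(n in [set x in S | e w x]) F n = F u.
Proof.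
move=> /eqP/cards1P[x defx] uS ewu.
have : u \in [set x in S | e w x] by rewrite inE uS.
by rewrite defx inE => /eqP ->; rewrite big_set1.
Qed.

Lemma eps_tree s v : tree_order s -> v \in s -> eps e s v = 1 \/ eps e s v = - 1.
Proof.
elim: s v => //= w s IH v; case: (s =P [::]) => [-> _|s0] /=.
  by rewrite inE => /eqP ->; rewrite eqxx; left.
case/and3P => ws /eqP d1 tr; rewrite inE; case: eqP => [_ _|_ /= vs]; last exact: IH.
have us := search_uniq (tree_search tr).
have /card_gt0P[u] : (0 < degin (sset s) w)%N by rewrite d1.
rewrite inE => /andP[us' ewu]; rewrite (sum_nbrs e_sym) //.
rewrite (degin1_sum _ d1 us' ewu).
move: us'; rewrite inE => us'.
by case: (IH u tr us') => ->; [right|left]; rewrite ?opprK.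
Qed.

Lemma clique_edge (K : {set T}) a b : clique e K -> a \in K -> b \in K -> a != b -> e a b.
Proof. by move=> /forall_inP/(_ a) H aK bK ab; move/forall_inP: (H aK) => /(_ b bK)/implyP/(_ ab). Qed.

Lemma clique_conn (K : {set T}) : clique e K -> K != set0 -> conn K.
Proof.
move=> cK K0; apply/connP; split=> // A /properP[AK [x xK xA]] /set0Pn[a aA].
exists a, x; split=> //; apply: clique_edge cK _ _ _ => //; first exact: (subsetP AK).
by apply: contraNneq xA => <-.
Qed.

(** Start with the root [q] and then [x]. Every other vertex of the clique has these two as earlier
    neighbours, so [eps_low] gives it the value 0. *)
Lemma eps_clique (K : {set T}) q x : clique e K -> K \subset low -> q \in K -> x \in K ->
  q != x -> exists s, [/\ search e s, sset s = K, eps e s q = 1, eps e s x = - 1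
    & forall v, v != q -> v != x -> eps e s v = 0].
Proof.
move=> cK KL qK xK qx.
have base : search e [:: x; q].
  by rewrite /= inE eq_sym qx /= orbF (clique_edge cK).
have cnK : conn K by apply: clique_conn => //; apply/set0Pn; exists q.
have [|s' [srch defs]] := conn_extend cnK base.
  by move=> y; rewrite !inE => /orP[]/eqP ->.
exists (s' ++ [:: x; q]); split=> //.
- elim: s' srch {defs} => [_|w s' IH srch].
    by rewrite /= (negPf qx) eqxx.
  have /= := srch; case: eqP => [|_ /= /and3P[ws _ /IH {}IH]]; first by case: (s').
  case: (q =P w) => [qw|//]; case/negP: ws.
  by rewrite -qw mem_cat !inE eqxx !orbT.
- elim: s' srch {defs} => [_|w s' IH srch].
    by rewrite /= eqxx big_cons big_nil (clique_edge cK) //= eqxx addr0.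
  have /= := srch; case: eqP => [|_ /= /and3P[ws _ /IH {}IH]]; first by case: (s').
  case: (x =P w) => [qw|//]; case/negP: ws.
  by rewrite -qw mem_cat !inE eqxx !orbT.
move=> v vq vx; have sK : {subset s' ++ [:: x; q] <= K}.
  by move=> y ys; rewrite -defs inE.
elim: s' srch sK {defs} => [_ _|w s' IH srch sK].
  by rewrite /= (negPf vx) (negPf vq).
have srch0 := srch.
have /= := srch; case: eqP => [|_ /= /and3P[ws _ /IH {}IH]]; first by case: (s').
case: (v =P w) => [vw|_]; last first.
  by apply: IH => y ys; apply: sK; rewrite /= inE ys orbT.
rewrite (_ : - _ = eps e (w :: s' ++ [:: x; q]) w); last by rewrite epsE //; case: (s').
apply: (eps_low e_sym e_irr G_irred srch0).
  by move=> y /sK /(subsetP KL).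
have wK : w \in K by apply: sK; rewrite /= inE eqxx.
apply: (@degin_ge2 _ _ _ _ q x); rewrite ?inE ?mem_cat ?inE ?eqxx ?orbT //.
  by apply: clique_edge cK _ _ _ => //; rewrite -vw.
by apply: clique_edge cK _ _ _ => //; rewrite -vw.
Qed.

End MinimalConnectedSets.

(** * Triangle-free blocks have maximum degree two *)

Section TriangleFreeBlocks.
Variables (T : finType) (e : rel T).
Hypotheses (e_sym : symmetric e) (e_irr : irreflexive e).
Hypothesis (G_irred : AT_irreducible e).
Implicit Types (S B : {set T}) (v w : T) (s : seq T).

Notation low := (low e).
Notation conn := (conn e).
Notation degin := (degin e).

Lemma sset_cat s s' : sset (s ++ s') = sset s :|: sset s'.
Proof. by apply/setP => x; rewrite !inE mem_cat. Qed.

Lemma eps_head w s : search e s -> eps e (w :: s) w =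
  - \sum_(n in [set u in sset s | e w u]) eps e s n.
Proof.
move=> srch; rewrite epsE; last by case: (s) srch.
by rewrite (sum_nbrs e_sym) // (search_uniq srch).
Qed.

Lemma search_cons w s u : search e s -> w \notin s -> u \in s -> e w u -> search e (w :: s).
Proof.
move=> srch ws us ewu; rewrite /= ws srch andbT; apply/orP; right.
by apply/hasP; exists u => //; rewrite e_sym.
Qed.

(** The tree hangs on [s] by the single edge [p q], so each of its vertices has exactly one earlier
    neighbour and takes minus a nonzero value. *)
Lemma eps_tree_over s r p q : search e s -> tree_order e (rcons r p) ->
  (forall x, x \in rcons r p -> x \notin s) -> q \in s -> eps e s q != 0 ->
  (forall x n, x \in r -> n \in s -> ~~ e x n) ->
  (forall n, n \in s -> e p n = (n == q)) ->
  [/\ search e (rcons r p ++ s),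
      forall v, v \in rcons r p -> eps e (rcons r p ++ s) v != 0
    & forall v, v \in s -> eps e (rcons r p ++ s) v = eps e s v].
Proof.
move=> srch + + qs q0 + Hp; elim: r => [|w r IH] tr ns nr.
  have ps : p \notin s by apply: ns; rewrite mem_head.
  have epq : e p q by rewrite Hp // eqxx.
  split.
  - exact: search_cons epq.
  - move=> v; rewrite inE => /eqP ->; rewrite eps_head // oppr_eq0.
    rewrite (_ : [set u in sset s | e p u] = [set q]) ?big_set1 //.
    apply/setP => n; rewrite !inE; apply/andP/eqP => [[ns' ]|->]; last by rewrite qs.
    by rewrite Hp // => /eqP.
  - by move=> v vs; rewrite eps_cons.
rewrite rcons_cons /=; move: tr; rewrite rcons_cons /=.
case: eqP => [|_ /= /and3P[wr /eqP d1 tr]]; first by case: (r).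
have [| |srch' eps0 epss] := IH tr.
- by move=> x xr; apply: ns; rewrite rcons_cons inE xr orbT.
- by move=> x n xr; apply: nr; rewrite inE xr orbT.
have ws : w \notin s by apply: ns; rewrite rcons_cons mem_head.
have wrs : w \notin rcons r p ++ s by rewrite mem_cat negb_or wr.
have /card_gt0P[u] : (0 < degin (sset (rcons r p)) w)%N by rewrite d1.
rewrite !inE => /andP[ur ewu].
have urs : u \in rcons r p ++ s by rewrite mem_cat ur.
have srch2 := search_cons srch' wrs urs ewu.
split=> // v; last first.
  by move=> vs; rewrite -/(eps e (w :: rcons r p ++ s) v) eps_cons ?epss // mem_cat vs orbT.
rewrite inE -/(eps e (w :: rcons r p ++ s) v) => /orP[/eqP ->|vr]; last first.
  by rewrite eps_cons ?eps0 // mem_cat vr.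
rewrite eps_head // oppr_eq0 (@degin1_sum _ _ _ _ u) ?inE ?eps0 //.
rewrite sset_cat degin_setU ?d1; last first.
  rewrite -setI_eq0; apply/eqP/setP => x; rewrite !inE; apply/andP => -[xr xs].
  by have := ns x; rewrite rcons_cons inE xr orbT xs => /(_ isT).
rewrite (_ : degin (sset s) w = 0)%N ?addn0 //; apply: degin_eq0 => n.
by rewrite inE; apply: nr; rewrite mem_head.
Qed.

Lemma block_degin_ge2 b v : conn b -> (forall w, w \in b -> conn (b :\ w)) ->
  (3 <= #|b|)%N -> v \in b -> (2 <= degin b v)%N.
Proof.
move=> cb c2 b3 vb; have d0 := conn_degin_gt0 cb vb (ltnW b3).
rewrite leqNgt; apply/negP => d1; have /eqP/cards1P[u defu] : degin b v = 1%N.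
  by apply/eqP; rewrite eqn_leq -ltnS d1.
have : u \in [set x in b | e v x] by rewrite defu inE.
rewrite inE => /andP[ub evu].
have vu : v != u by apply: contraTneq evu => ->; rewrite e_irr.
have vbu : v \in b :\ u by rewrite !inE vu.
have : (0 < degin (b :\ u) v)%N.
  apply: conn_degin_gt0 => //; first exact: c2.
  by move: b3; rewrite (cardsD1 u) ub.
case/card_gt0P => x; rewrite !inE => /andP[/andP[xu xb] evx].
have : x \in [set x in b | e v x] by rewrite inE xb.
by rewrite defu inE (negPf xu).
Qed.

(** A smallest connected set avoiding [x] and containing at least three neighbours of [x] contains
    exactly three and is a tree, on which [eps] is 1 or -1. By [sum_eps_low] the three values at the
    neighbours of [x] would sum to 0. *)
Lemma block_triangle_free (b : {set T}) : b \subset low -> conn b ->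
  (forall w, w \in b -> conn (b :\ w)) -> triangle_free e b ->
  forall x, x \in b -> (degin b x <= 2)%N.
Proof.
move=> bL cb c2 tf x xb; rewrite leqNgt; apply/negP => d3.
set A := [set u in b | e x u] in d3.
have xA : x \notin A by rewrite !inE e_irr andbF.
have P0 : conn (b :\ x) && (b :\ x \subset b :\ x) && (3 <= #|A :&: (b :\ x)|)%N.
  rewrite c2 //= subxx (setIidPl _) //; apply/subsetP => u; rewrite !inE => /andP[ub exu].
  by rewrite ub andbT; apply: contraTneq exu => ->; rewrite e_irr.
pose Q := fun S : {set T} => conn S && (S \subset b :\ x) && (3 <= #|A :&: S|)%N.
have [S /andP[/andP[cS Sb] AS] minS] := @arg_minnP _ (b :\ x) Q (fun S => #|S|) P0.
have S2 : (2 <= #|S|)%N.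
  by apply: leq_trans (subset_leq_card (subsetIr A S)); apply: ltnW.
have /set0Pn[r rS] : S != set0 by case/connP: cS.
have [w [wS wr cw]] := conn_noncut e_sym cS rS S2.
have nmin S' : S' \proper S -> conn S' -> (#|A :&: S'| <= 2)%N.
  move=> pS cS'; rewrite leqNgt; apply/negP => A3.
  have QS' : Q S' by rewrite /Q cS' A3 andbT /= (subset_trans (proper_sub pS)).
  by have := minS S' QS'; rewrite leqNgt (proper_card pS).
have A3 : #|A :&: S| = 3.
  apply/eqP; rewrite eqn_leq AS andbT.
  have := nmin (S :\ w) (properD1 wS) cw; rewrite setIDA => H.
  by rewrite (cardsD1 w) -[3%N]/(1 + 2)%N leq_add // leq_b1.
have mS : minimal_conn e S (A :&: S).
  split=> //; first exact: subsetIr.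
  move=> S' pS AS'; apply/negP => cS'; have := nmin S' pS cS'; rewrite leqNgt.
  move/negP; apply; apply: leq_trans (_ : #|A :&: S| <= _)%N; first by rewrite A3.
  by apply: subset_leq_card; rewrite subsetI AS' andbT subsetIl.
have Sb' : S \subset b by apply: subset_trans Sb (subsetDl _ _).
have /card_gt0P[q qAS] : (0 < #|A :&: S|)%N by rewrite A3.
have [|s [tr defs]] := minimal_conn_tree e_sym e_irr mS qAS.
  right; split; first by rewrite A3.
  by move=> a a' a'' aS aS' aS''; apply: tf; apply: (subsetP Sb').
have xs : x \notin rcons s q.
  have : x \notin S by apply/negP => /(subsetP Sb); rewrite !inE eqxx.
  by move/setP/(_ x): defs; rewrite !inE => ->.
have srch := tree_search e_sym tr.
have defA : [set u in sset (rcons s q) | e x u] = A :&: S.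
  rewrite defs; apply/setP => u; rewrite !inE andbC.
  by case: (boolP (u \in S)) => [/(subsetP Sb') ->|]; rewrite ?andbT ?andbF.
have := sum_eps_low e_sym e_irr G_irred srch xs.
rewrite /degin defA A3 => /(_ _ isT) H.
have {H} : \sum_(n in A :&: S) eps e (rcons s q) n = 0.
  apply: H => y; rewrite inE => /orP[/eqP ->|ys]; apply: (subsetP bL) => //.
  by apply: (subsetP Sb'); rewrite -defs inE.
(* Parity: each sign is 1 minus an even number, so the sum of three is odd. *)
rewrite (eq_bigr (fun n => 1 - 2 * (eps e (rcons s q) n == -1)%:R)); last first.
  move=> n; rewrite inE => /andP[_ nS].
  have ns : n \in rcons s q by move: nS; rewrite -defs inE.
  by case: (eps_tree e_sym tr ns) => ->.
rewrite big_split /= sumr_const A3 sumrN -mulr_sumr.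
by move: (\sum_(_ in _) _) => z; clear; rewrite natz; lia.
Qed.

End TriangleFreeBlocks.

(** * Blocks with a triangle are complete; existence of leaf blocks *)

Section BlockStructure.
Variables (T : finType) (e : rel T).
Hypotheses (e_sym : symmetric e) (e_irr : irreflexive e).
Hypothesis (G_irred : AT_irreducible e).
Implicit Types (S B K P : {set T}) (v w : T) (s : seq T).

Notation low := (low e).
Notation conn := (conn e).
Notation degin := (degin e).

Definition nbrs_of K P : {set T} := [set q in K | [exists p in P, e q p]].

Lemma nbrs_of_subset K P P' : P \subset P' -> nbrs_of K P \subset nbrs_of K P'.
Proof.
move=> PP; apply/subsetP => q; rewrite !inE => /andP[-> /existsP[p /andP[pP eqp]]] /=.
by apply/existsP; exists p; rewrite (subsetP PP).
Qed.

Lemma nbrs_of_setU K P P' : nbrs_of K (P :|: P') = nbrs_of K P :|: nbrs_of K P'.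
Proof.
apply/eqP; rewrite eqEsubset; apply/andP; split; last first.
  by rewrite subUset !nbrs_of_subset ?subsetUl ?subsetUr.
apply/subsetP => q; rewrite !inE => /andP[-> /existsP[p /andP[]]] /=.
rewrite inE => /orP[] pP eqp; apply/orP; [left|right]; apply/existsP; exists p;
  by rewrite pP.
Qed.

Lemma nbrs_ofP K P q p : q \in K -> p \in P -> e q p -> q \in nbrs_of K P.
Proof. by move=> qK pP eqp; rewrite inE qK; apply/existsP; exists p; rewrite pP. Qed.

Lemma card_le1_eq (A : {set T}) x y : (#|A| <= 1)%N -> x \in A -> y \in A -> x = y.
Proof.
move=> A1 xA yA; apply/eqP; apply: contraTT A1 => xy; rewrite -ltnNge.
by apply/card_gt1P; exists x, y.
Qed.

(** Take a maximal connected set around a vertex outside [K]. If it had at most one neighbour [q] in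
    [K], it would be separated from the rest of [K] in [b :\ q], which is connected. *)
Lemma ear_exists (b K : {set T}) : K \proper b -> (2 <= #|K|)%N ->
  (forall w, w \in b -> conn (b :\ w)) ->
  exists P, [/\ conn P, P \subset b :\: K & (2 <= #|nbrs_of K P|)%N].
Proof.
move=> /properP[Kb [p pb pK]] K2 c2.
pose Q := fun C : {set T} => [&& conn C, C \subset b :\: K & p \in C].
have Q1 : Q [set p] by rewrite /Q conn1 sub1set !inE pb pK eqxx.
have [C /and3P[cC Cb pC] maxC] := @arg_maxnP _ [set p] Q (fun C => #|C|) Q1.
exists C; split=> //; rewrite leqNgt; apply/negP => N1.
have [q qK Nq] : exists2 q, q \in K & nbrs_of K C \subset [set q].
  case: (set_0Vmem (nbrs_of K C)) => [->|[q qN]].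
    have /card_gt0P[q qK] : (0 < #|K|)%N by apply: ltnW.
    by exists q => //; rewrite sub0set.
  exists q; first by move: qN; rewrite inE => /andP[].
  by apply/subsetP => y yN; rewrite inE; apply/eqP; apply: card_le1_eq N1 _ _.
have [_ cq] := connP _ _ (c2 q (subsetP Kb q qK)).
have CK x : x \in C -> x \in K = false.
  by move=> /(subsetP Cb); rewrite inE => /andP[/negPf].
have Cb' x : x \in C -> x \in b by move=> /(subsetP Cb); rewrite inE => /andP[].
have [||a [x [aC xb xC eax]]] := cq C.
- apply/properP; split.
    apply/subsetP => x xC; rewrite !inE Cb' // andbT.
    by apply: contraTneq qK => <-; rewrite CK.
  have /card_gt0P[y] : (0 < #|K :\ q|)%N by move: K2; rewrite (cardsD1 q) qK.
  rewrite !inE => /andP[yq yK]; exists y; first by rewrite !inE yq (subsetP Kb).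
  by apply: contraTN yK => /CK ->.
- by apply/set0Pn; exists p.
move: xb; rewrite !inE => /andP[xq xb].
case: (boolP (x \in K)) => xK.
  have /(subsetP Nq) : x \in nbrs_of K C by apply: nbrs_ofP aC _ => //; rewrite e_sym.
  by rewrite inE (negPf xq).
have QC : Q (x |: C).
  rewrite /Q (conn_setU1 e_sym cC aC) 1?e_sym //= subUset sub1set Cb !inE xK xb pC.
  by rewrite orbT.
by have := maxC _ QC; rewrite /= cardsU1 xC add1n ltnn.
Qed.

(** If a maximum clique [K] is not the whole block, a smallest ear [P] over [K] closes a search
    order at a vertex with two earlier neighbours. The values on [K] can be chosen by [eps_clique]
    so that their sum there is not 0. *)
Lemma block_triangle (b : {set T}) a1 a2 a3 : b \subset low ->
  (forall w, w \in b -> conn (b :\ w)) ->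
  a1 \in b -> a2 \in b -> a3 \in b -> e a1 a2 -> e a2 a3 -> e a1 a3 -> clique e b.
Proof.
move=> bL c2 a1b a2b a3b e12 e23 e13.
have ne x y : e x y -> x != y by apply: contraTneq => ->; rewrite e_irr.
pose Q := fun K : {set T} => (K \subset b) && clique e K.
have Q0 : Q [set a1; a2; a3].
  apply/andP; split.
    by apply/subsetP => x; rewrite !inE => /orP[/orP[]|]/eqP ->.
  apply/forall_inP => x xK; apply/forall_inP => y yK; apply/implyP.
  by move: xK yK; rewrite !inE => /orP[/orP[]|]/eqP -> /orP[/orP[]|]/eqP ->;
    rewrite ?eqxx // => _; rewrite // e_sym.
have [K /andP[Kb cK] maxK] := @arg_maxnP _ [set a1; a2; a3] Q (fun C => #|C|) Q0.
have K3 : (3 <= #|K|)%N.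
  apply: leq_trans (maxK _ Q0).
  by apply: (@card_ge3 _ _ a1 a2 a3); rewrite ?inE ?eqxx ?orbT //; apply: ne.
case: (boolP (K == b)) => [/eqP <- //|Kneb].
have Kp : K \proper b by rewrite properEneq Kneb.
have KL : K \subset low by apply: subset_trans bL.
have [P0 [cP0 P0b P02]] := ear_exists Kp (ltnW K3) c2.
pose R := fun P : {set T} => [&& conn P, P \subset b :\: K & (2 <= #|nbrs_of K P|)%N].
have R0 : R P0 by apply/and3P.
have [P /and3P[cP Pb P2] minP] := @arg_minnP _ P0 R (fun C => #|C|) R0.
have PK x : x \in P -> x \notin K.
  by move=> /(subsetP Pb); rewrite inE => /andP[].
have Pb' x : x \in P -> x \in b by move=> /(subsetP Pb); rewrite inE => /andP[].
have nminP P' : P' \proper P -> conn P' -> (#|nbrs_of K P'| <= 1)%N.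
  move=> pP cP'; rewrite leqNgt; apply/negP => N2.
  have RP' : R P' by rewrite /R cP' N2 (subset_trans (proper_sub pP)).
  by have := minP P' RP'; rewrite leqNgt (proper_card pP).
have /set0Pn[r rP] : P != set0 by case/connP: cP.
case: (leqP #|P| 1) => [P1|Pge2].
  have defP : P = [set r].
    by apply/setP => x; rewrite inE; apply/idP/eqP => [xP|->//]; apply: card_le1_eq P1 _ _.
  have [q qN] : exists q, q \in nbrs_of K P by apply/card_gt0P; apply: ltnW.
  have nbP x : (x \in nbrs_of K P) = (x \in K) && e r x.
    rewrite inE defP; congr (_ && _); apply/existsP/idP => [[p]|erx].
      by rewrite inE => /andP[/eqP ->]; rewrite e_sym.
    by exists r; rewrite inE eqxx e_sym.
  have rK := PK r rP.
  (* A one-vertex ear [r] misses some [x1] in [K] by maximality. With value 1 at a neighbour [q], -1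
     at [x1] and 0 elsewhere, the neighbours of [r] sum to 1. *)
  have [x1 x1K nx1] : exists2 x, x \in K & ~~ e r x.
    apply/exists_inP; apply: contraT; rewrite negb_exists_in => /forall_inP Hr.
    have Qr : Q (r |: K).
      rewrite /Q subUset sub1set Pb' //= Kb /=.
      apply/forall_inP => x xK; apply/forall_inP => y yK; apply/implyP => xy.
      move: xK yK xy; rewrite !inE => /orP[/eqP ->|xK] /orP[/eqP ->|yK]; rewrite ?eqxx // => xy.
      - by have := Hr y yK; rewrite negbK.
      - by have := Hr x xK; rewrite negbK e_sym.
      - exact: clique_edge cK _ _ xy.
    by have := maxK _ Qr; rewrite /= cardsU1 rK add1n ltnn.
  have qK : q \in K by move: qN; rewrite inE => /andP[].
  have erq : e r q by move: qN; rewrite nbP => /andP[].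
  have qx1 : q != x1 by apply: contraTneq erq => ->.
  have [s [srch defs e1 ex e0]] := eps_clique e_sym e_irr G_irred cK KL qK x1K qx1.
  have rs : r \notin s by move: rK; rewrite -defs inE.
  have defN : [set u in sset s | e r u] = nbrs_of K P.
    by apply/setP => x; rewrite nbP defs inE.
  have := sum_eps_low e_sym e_irr G_irred srch rs.
  rewrite /degin defN => /(_ _ P2) H.
  have {H} : \sum_(n in nbrs_of K P) eps e s n = 0.
    apply: H => y; rewrite inE => /orP[/eqP ->|ys]; first by apply/(subsetP bL)/Pb'.
    by apply: (subsetP KL); rewrite -defs inE.
  rewrite (bigD1 q) //= e1 big1 ?addr0 // => x /andP[xN xq].
  by apply: e0 => //; apply: contraTneq xN => ->; rewrite nbP (negPf nx1) andbF.
(* A longer smallest ear has two removable vertices [p] and [p']. The ear without either one sees at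
   most one vertex of [K]. This makes [p] and [p'] the only vertices of the ear with neighbours in
   [K], one each, namely [q2] and [q1]. *)
have [p [pP pr cPp]] := conn_noncut e_sym cP rP Pge2.
have [p' [p'P p'p cPp']] := conn_noncut e_sym cP pP Pge2.
have prop1 x : x \in P -> [set x] \proper P.
  by move=> xP; rewrite properEcard sub1set xP cards1.
have single x y y' : x \in P -> y \in nbrs_of K [set x] -> y' \in nbrs_of K [set x] -> y = y'.
  by move=> xP; apply: card_le1_eq; apply: nminP (conn1 _ _); apply: prop1.
have noncut x : x \in P -> conn (P :\ x) -> exists q2 q1,
    [/\ q2 \in nbrs_of K [set x], q1 \in nbrs_of K (P :\ x), q1 != q2 &
        forall y, y \in nbrs_of K (P :\ x) -> y = q1].
  move=> xP cx; have N1 := nminP _ (properD1 xP) cx.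
  have Nx := nminP _ (prop1 x xP) (conn1 _ x).
  have N2 : (2 <= #|nbrs_of K [set x] :|: nbrs_of K (P :\ x)|)%N.
    by rewrite -nbrs_of_setU setD1K.
  have := cardsUI (nbrs_of K [set x]) (nbrs_of K (P :\ x)).
  move=> HUI.
  have /card_gt0P[q2 q2N] : (0 < #|nbrs_of K [set x]|)%N by move: HUI N2 N1 Nx; clear; lia.
  have /card_gt0P[q1 q1N] : (0 < #|nbrs_of K (P :\ x)|)%N by move: HUI N2 N1 Nx; clear; lia.
  exists q2, q1; split=> //.
    apply/eqP => qq; have : (0 < #|nbrs_of K [set x] :&: nbrs_of K (P :\ x)|)%N.
      by apply/card_gt0P; exists q2; rewrite in_setI q2N -qq q1N.
    by move: HUI N2 N1 Nx; clear; lia.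
  by move=> y yN; apply: card_le1_eq N1 _ _.
have [q2 [q1 [q2N q1N q12 Nq1]]] := noncut p pP cPp.
have [q1' [q2' [q1'N _ _ Nq2]]] := noncut p' p'P cPp'.
have sub1 x y : x \in P -> x != y -> [set x] \subset P :\ y.
  by move=> xP xy; rewrite sub1set !inE xy.
have defq2 : q2 = q2'.
  by apply: Nq2; apply: (subsetP (nbrs_of_subset K _)) q2N; apply: sub1; rewrite // eq_sym.
have defq1 : q1' = q1.
  by apply: Nq1; apply: (subsetP (nbrs_of_subset K _)) q1'N; apply: sub1.
have q1K : q1 \in K by move: q1N; rewrite inE => /andP[].
have q2K : q2 \in K by move: q2N; rewrite inE => /andP[].
have epq2 : e p q2.
  move: q2N; rewrite inE => /andP[_ /existsP[x /andP[]]]; rewrite inE => /eqP ->.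
  by rewrite e_sym.
have ep'q1 : e p' q1.
  move: q1'N; rewrite defq1 inE => /andP[_ /existsP[x /andP[]]]; rewrite inE => /eqP ->.
  by rewrite e_sym.
have pn n : n \in K -> e p n = (n == q2).
  move=> nK; apply/idP/eqP => [epn|-> //].
  by apply: (single p) => //; apply: nbrs_ofP (set11 _) _ => //; rewrite e_sym.
have p'n n : n \in K -> e p' n = (n == q1).
  move=> nK; apply/idP/eqP => [epn|-> //].
  apply: (single p') => //; last by rewrite -defq1.
  by apply: nbrs_ofP (set11 _) _ => //; rewrite e_sym.
have other x n : x \in P -> x != p -> x != p' -> n \in K -> ~~ e x n.
  move=> xP xp xp' nK; apply/negP => exn; case/eqP: q12.
  have nN : n \in nbrs_of K [set x] by apply: nbrs_ofP (set11 _) _ => //; rewrite e_sym.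
  have := Nq1 n (subsetP (nbrs_of_subset K (sub1 x p xP xp)) _ nN).
  have := Nq2 n (subsetP (nbrs_of_subset K (sub1 x p' xP xp')) _ nN).
  by rewrite defq2 => -> ->.
have mP : minimal_conn e P [set p; p'].
  split=> //; first by rewrite subUset !sub1set pP.
  move=> P' pP' ppP'; apply/negP => cP'.
  have := nminP _ pP' cP'; rewrite leqNgt => /negP; apply; apply/card_gt1P.
  move: ppP'; rewrite subUset !sub1set => /andP[pP1 pP2].
  exists q1, q2; split=> //.
    by apply: nbrs_ofP pP2 _ => //; rewrite e_sym.
  by apply: nbrs_ofP pP1 _ => //; rewrite e_sym.
have pp2 : (#|[set p; p']| <= 2)%N by rewrite cards2; case: (_ != _).
have dp : degin P p = 1%N.
  apply/eqP; rewrite eqn_leq (minimal_conn_leaf e_sym e_irr mP) //; last by left.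
  by rewrite conn_degin_gt0.
have [u] : exists u, u \in [set u in P | e p u] by apply/card_gt0P; rewrite -/(degin P p) dp.
rewrite inE => /andP[uP epu].
have pB : p \in [set p; p'] by rewrite !inE eqxx.
have mP' := minimal_conn_step e_sym e_irr mP pB uP epu cPp.
have [||t [tr deft]] := minimal_conn_tree e_sym e_irr (r := p') mP'.
- by rewrite !inE p'p eqxx !orbT.
- left; rewrite cardsU1; have : (#|[set p; p'] :\ p| <= 1)%N.
    by move: pp2; rewrite (cardsD1 p) pB.
  by case: (_ \notin _) => //= H; apply: leq_trans H _.
(* A third vertex of [K] takes the value -1, so that [q1] can have 1 and [q2] has 0. Carried into
   the ear from [q1] the value stays nonzero up to the neighbour [u] of [p], and [p] sees only [u]
   and [q2]. *)
have [q3 q3K /andP[q31 q32]] : exists2 q, q \in K & (q != q1) && (q != q2).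
  apply/exists_inP; apply: contraTT K3; rewrite negb_exists_in => /forall_inP H.
  rewrite -ltnNge ltnS; apply: leq_trans (_ : #|[set q1; q2]| <= _)%N; last first.
    by rewrite cards2; case: (_ != _).
  apply: subset_leq_card; apply/subsetP => x xK; have := H x xK.
  by rewrite negb_and !negbK !inE.
rewrite eq_sym in q31.
have [s [srch defs e1 ex e0]] := eps_clique e_sym e_irr G_irred cK KL q1K q3K q31.
have sK x : (x \in s) = (x \in K) by rewrite -defs inE.
have tP x : (x \in rcons t p') = (x \in P :\ p) by rewrite -deft inE.
have [|||||srch' eps0 epss] := @eps_tree_over _ e e_sym s t p' q1 srch tr.
- by move=> x; rewrite tP sK !inE => /andP[_ /PK].
- by rewrite sK.
- by rewrite e1.
- move=> x n xt; rewrite sK => nK.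
  have xtp : x \in rcons t p' by rewrite mem_rcons inE xt orbT.
  have := xtp; rewrite tP !inE => /andP[xp xP]; apply: other => //.
  have := search_uniq (tree_search e_sym tr); rewrite rcons_uniq => /andP[p't _].
  by apply: contraNneq p't => <-.
- by move=> n; rewrite sK; apply: p'n.
have ps : p \notin rcons t p' ++ s.
  by rewrite mem_cat tP sK !inE eqxx /= PK.
have up : u != p by apply: contraTneq epu => ->; rewrite e_irr.
have uq2 : u != q2 by apply: contraTneq q2K => <-; rewrite PK.
have q2q3 : q2 != q3 by rewrite eq_sym.
have defN : [set x in sset (rcons t p' ++ s) | e p x] = [set u; q2].
  apply/setP => x; rewrite [LHS]inE [x \in sset _]inE mem_cat tP sK !inE.
  apply/andP/orP => [[/orP[/andP[xp xP]|xK] epx]|[/eqP ->|/eqP ->]].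
  - left; apply/eqP; apply: (@card_le1_eq [set u in P | e p u]).
    + by rewrite -/(degin P p) dp.
    + by rewrite inE xP.
    + by rewrite inE uP.
  - by right; rewrite -pn.
  - by rewrite up uP epu.
  - by rewrite q2K orbT epq2.
have := sum_eps_low e_sym e_irr G_irred srch' ps.
rewrite /degin defN cards2 uq2 => /(_ _ isT) H.
have {H} : \sum_(n in [set u; q2]) eps e (rcons t p' ++ s) n = 0.
  apply: H => y; rewrite inE mem_cat tP sK => /orP[/eqP ->|/orP[|yK]].
  - by apply/(subsetP bL)/Pb'.
  - by case/setD1P => _ yP; apply/(subsetP bL)/Pb'.
  - exact: (subsetP KL).
rewrite big_setU1 ?inE //= big_set1 (epss q2) ?sK // (e0 q2) 1?eq_sym // addr0.
have ut : u \in rcons t p' by rewrite tP !inE up.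
by move=> H; have := eps0 u ut; rewrite H.
Qed.

(** Cycles are recorded by their degrees, since the counting sees only [degsum]. *)
Lemma block_clique_or_cycle (b : {set T}) : b \subset low -> conn b -> (2 <= #|b|)%N ->
  (forall w, w \in b -> conn (b :\ w)) ->
  clique e b \/ (3 <= #|b|)%N /\ forall v, v \in b -> degin b v = 2.
Proof.
move=> bL cb b2 c2.
case: (boolP [exists a1 in b, exists a2 in b, exists a3 in b,
               [&& e a1 a2, e a2 a3 & e a1 a3]]) => [|ntr].
  case/existsP => a1 /andP[a1b /existsP[a2 /andP[a2b /existsP[a3 /andP[a3b]]]]].
  by case/and3P => e12 e23 e13; left; apply: (@block_triangle b a1 a2 a3).
have tf : triangle_free e b.
  move=> a1 a2 a3 a1b a2b a3b e12 e23 e13; case/negP: ntr.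
  apply/existsP; exists a1; rewrite a1b; apply/existsP; exists a2; rewrite a2b.
  by apply/existsP; exists a3; rewrite a3b e12 e23 e13.
case: (leqP 3 #|b|) => b3; [right|left].
  split=> // v vb; apply/eqP; rewrite eqn_leq block_triangle_free //=.
  exact: block_degin_ge2.
apply/forall_inP => x xb; apply/forall_inP => y yb; apply/implyP => xy.
have defb : b = [set x; y].
  apply/eqP; rewrite eq_sym eqEcard cards2 xy -ltnS b3 andbT.
  by apply/subsetP => z; rewrite !inE => /orP[]/eqP ->.
have := conn_degin_gt0 cb xb b2; case/card_gt0P => z; rewrite defb !inE.
by case/andP => /orP[]/eqP ->; rewrite ?e_irr.
Qed.

(** Among all pairs of a cut vertex [x] and a side [D] choose one with [D] smallest; a cut vertex
    inside [x |: D] would cut off a smaller side. Without such pairs [S] is a block and any vertex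
    serves as the root. *)
Lemma leaf_block S : conn S -> (2 <= #|S|)%N -> exists x (b : {set T}),
  [/\ x \in b, b \subset S, conn b & (2 <= #|b|)%N] /\
  [/\ forall w, w \in b -> conn (b :\ w), closed_by e S x (b :\ x) & conn (S :\: (b :\ x))].
Proof.
move=> cS S2.
pose cut := fun p : T * {set T} => [&& p.1 \in S, p.2 != set0, p.2 \proper (S :\ p.1) &
  [forall a in p.2, forall c in S, e a c ==> (c \in p.1 |: p.2)]].
case: (boolP [exists p, cut p]) => [/existsP[p0 cut0]|ncut]; last first.
  have /card_gt0P[x xS] : (0 < #|S|)%N by apply: ltnW.
  exists x, S; split; split=> //.
  - move=> w wS; apply: contraT => cw; case/negP: ncut.
    have [|A [AS A0 nA]] := conn_split _ cw.
      by rewrite -card_gt0; move: S2; rewrite (cardsD1 w) wS.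
    apply/existsP; exists (w, A); rewrite /cut /= wS A0 AS /=.
    apply/forall_inP => a aA; apply/forall_inP => c cS'; apply/implyP => eac.
    rewrite !inE; case: (c =P w) => //= /eqP cw'; apply: contraT => cA.
    by have := nA a c aA; rewrite !inE cw' cS' eac => /(_ isT cA).
  - split; [exact: subsetDl|by rewrite !inE eqxx|].
    by move=> a c _ cS' _; rewrite !inE; case: (c =P x) => //=.
  - rewrite (_ : _ :\: _ = [set x]) ?conn1 //; apply/setP => y; rewrite !inE.
    by case: (y =P x) => [->|] //=; case: (y \in S).
have [[x D] /and4P[/= xS D0 DS clD] minD] := @arg_minnP _ p0 cut (fun p => #|p.2|) cut0.
have cl : closed_by e S x D.
  split.
  - by apply: subset_trans (proper_sub DS) (subsetDl _ _).
  - by apply/negP => /(subsetP (proper_sub DS)); rewrite !inE eqxx.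
  - by move=> a c aD cS' eac; move/forall_inP: clD => /(_ a aD)/forall_inP/(_ c cS')/implyP/(_ eac).
have [DS' xD Hcl] := cl.
have bx : (x |: D) :\ x = D by rewrite setU1K.
exists x, (x |: D); split; split; rewrite ?bx ?setU11 //.
- by rewrite subUset sub1set xS.
- exact: conn_side cl.
- by rewrite cardsU1 xD add1n ltnS card_gt0.
- move=> w; rewrite !inE => /orP[/eqP ->|wD].
    rewrite bx; apply: contraT => cD.
    have [A [AD A0 nA]] := conn_split D0 cD.
    have := minD (x, A); rewrite /cut /= leqNgt (proper_card AD) => H; apply: H.
    rewrite xS A0 (proper_sub_trans AD (proper_sub DS)) /=.
    apply/forall_inP => a aA; apply/forall_inP => c cS'; apply/implyP => eac.
    have aD := subsetP (proper_sub AD) a aA.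
    have := Hcl a c aD cS' eac; rewrite !inE => /orP[->//|cD'].
    by apply/orP; right; apply: contraT => cA; have := nA a c aA cD' cA; rewrite eac.
  have xw : x != w by apply: contraTneq wD => <-.
  apply: contraT => cD.
  have [|A [/properP[AD [y yD yA]] A0 nA]] := conn_split _ cD.
    by apply/set0Pn; exists x; rewrite !inE xw eqxx.
  have [A' [A'D A'0 xA' nA']] : exists A' : {set T}, [/\ A' \subset (x |: D) :\ w, A' != set0, x \notin A' &
      forall a b, a \in A' -> b \in (x |: D) :\ w -> b \notin A' -> ~~ e a b].
    case: (boolP (x \in A)) => xA; last by exists A.
    exists (((x |: D) :\ w) :\: A); split; first exact: subsetDl.
    - by apply/set0Pn; exists y; rewrite in_setD yA.
    - by rewrite in_setD xA.
    - move=> a c; rewrite in_setD => /andP[aA aD] cD'; rewrite in_setD cD' andbT negbK => cA.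
      by rewrite e_sym; apply: nA.
  have A'D' : A' \subset D :\ w.
    apply/subsetP => z zA; have := subsetP A'D z zA; rewrite !inE => /andP[-> /orP[/eqP zx|//]].
    by rewrite -zx zA in xA'.
  have := minD (w, A'); rewrite /cut /= leqNgt.
  have -> : (#|A'| < #|D|)%N.
    by apply: leq_ltn_trans (subset_leq_card A'D') _; rewrite [X in (_ < X)%N](cardsD1 w) wD.
  move=> H; apply: H; rewrite A'0 (subsetP DS') //=; apply/andP; split.
    apply/properP; split.
      by apply: subset_trans A'D' _; apply: setSD.
    by exists x; rewrite // !inE xw.
  apply/forall_inP => a aA; apply/forall_inP => c cS'; apply/implyP => eac.
  have aD : a \in D by have := subsetP A'D' a aA; rewrite inE => /andP[].
  have := Hcl a c aD cS' eac; rewrite in_setU1 => cxD.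
  rewrite in_setU1; case: (c =P w) => //= /eqP cw; apply: contraT => cA.
  have cD' : c \in (x |: D) :\ w by rewrite !inE cw.
  by have := nA' a c aA cD' cA; rewrite eac.
- exact: conn_setD_side cl.
Qed.

End BlockStructure.

(** * Clusters *)

Section Clusters.
Variables (T : finType) (e : rel T).
Hypotheses (e_sym : symmetric e) (e_irr : irreflexive e).
Hypothesis (G_irred : AT_irreducible e).
Implicit Types (S K Z : {set T}) (v w : T) (s : seq T).

Notation low := (low e).
Notation conn := (conn e).
Notation degin := (degin e).
Notation delta := (min_degree e).

Inductive cluster : {set T} -> Prop :=
| cluster1 K : clique e K -> #|K| = delta -> cluster K
| clusterU Z K z z' : cluster Z -> clique e K -> #|K| = delta ->
    [disjoint Z & K] -> z' \in Z -> z \in K -> e z' z ->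
    (forall a b, a \in Z -> b \in K -> e a b -> a = z' /\ b = z) ->
    cluster (Z :|: K).

(** In a cluster of low vertices: no joining edge ends at [v], so exactly one edge at [v] leaves the
    cluster. *)
Definition outer Z v := degin Z v == delta.-1.

Lemma degin_clique K v : clique e K -> v \in K -> degin K v = #|K|.-1.
Proof.
move=> cK vK; rewrite (cardsD1 v) vK /=; apply: eq_card => u; rewrite !inE.
case: (u =P v) => [->|/eqP uv]; first by rewrite e_irr andbF.
by case: (boolP (u \in K)) => //= uK; rewrite (clique_edge cK) // eq_sym.
Qed.

Lemma cluster_conn Z : (0 < delta)%N -> cluster Z -> conn Z.
Proof.
move=> d0; elim=> [K cK dK|{}Z K z z' _ cZ cK dK _ z'Z zK ez _].
  by apply: clique_conn => //; rewrite -card_gt0 dK.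
apply: (conn_union e_sym cZ _ z'Z zK ez); apply: clique_conn => //.
by rewrite -card_gt0 dK.
Qed.

Lemma cluster_degin Z v : cluster Z -> v \in Z -> (delta.-1 <= degin Z v)%N.
Proof.
elim=> [K cK dK vK|{}Z K z z' _ IH cK dK _ _ _ _ _]; first by rewrite degin_clique ?dK.
rewrite inE => /orP[/IH H|vK].
  by apply: leq_trans H _; apply: degin_subset; apply: subsetUl.
rewrite -dK -(degin_clique cK vK); apply: degin_subset; exact: subsetUr.
Qed.

Lemma eps_cat r s v : search e (r ++ s) -> v \in s -> eps e (r ++ s) v = eps e s v.
Proof.
elim: r => // w r IH srch vs.
have vrs : v \in r ++ s by rewrite mem_cat vs orbT.
have ws : w \notin r ++ s by case/andP: (search_uniq srch).
rewrite cat_cons eps_cons // IH //; move: srch => /=.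
by case: eqP => [H|_ /and3P[]//]; rewrite H in vrs.
Qed.

Lemma search_behead w s : s != [::] -> search e (w :: s) -> search e s.
Proof. by move=> /negPf /= -> /= /and3P[]. Qed.

Lemma eps_zero_ext r s w : s != [::] -> search e (r ++ s) ->
  (forall n w, n \in s -> w \in r -> e w n -> eps e s n = 0) ->
  w \in r -> eps e (r ++ s) w = 0.
Proof.
move=> s0; elim: r w => // x r IH w srch H.
have rs0 : r ++ s != [::] by case: (r).
have srch' := search_behead rs0 srch.
have xs : x \notin r ++ s by case/andP: (search_uniq srch).
have H' n y : n \in s -> y \in r -> e y n -> eps e s n = 0.
  by move=> ns yr; apply: H => //; rewrite inE yr orbT.
rewrite inE cat_cons => /orP[/eqP ->|wr]; last first.
  by rewrite eps_cons ?IH // mem_cat wr.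
rewrite eps_head // big1 ?oppr0 // => n; rewrite !inE mem_cat => /andP[/orP[nr|ns] exn].
  exact: IH.
by rewrite eps_cat //; apply: H exn => //; rewrite mem_head.
Qed.

Lemma eps_low_ext r s w : s != [::] -> search e (r ++ s) -> {subset r ++ s <= low} ->
  (forall w, w \in r -> (2 <= degin (sset s) w)%N) ->
  w \in r -> eps e (r ++ s) w = 0.
Proof.
move=> s0; elim: r w => // x r IH w srch sL H.
have rs0 : r ++ s != [::] by case: (r).
have srch' := search_behead rs0 srch.
have xs : x \notin r ++ s by case/andP: (search_uniq srch).
rewrite inE cat_cons => /orP[/eqP ->|wr].
  apply: eps_low => //; apply: leq_trans (H x (mem_head _ _)) _.
  by apply: degin_subset; rewrite sset_cat subsetUr.
rewrite eps_cons //; last by rewrite mem_cat wr.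
apply: IH => //.
  by move=> y ys; apply: sL; rewrite cat_cons inE ys orbT.
by move=> y yr; apply: H; rewrite inE yr orbT.
Qed.

Definition isolates Z v v' s :=
  [/\ search e s, sset s = Z, eps e s v != 0, eps e s v' != 0 &
      forall w, w \in Z -> outer Z w -> w != v -> w != v' -> eps e s w = 0].

(** Induction on the gluing. The ends [z'] and [z] of the joining edge are not outer in the union,
    so their values are unrestricted; but [z'] is outer in the old part, where the induction
    hypothesis controls its value. *)
Lemma cluster_isolate Z : (2 <= delta)%N -> cluster Z -> Z \subset low ->
  forall v v', v \in Z -> v' \in Z -> v != v' -> outer Z v -> outer Z v' ->
  exists s, isolates Z v v' s.
Proof.
move=> d2; elim=> [K cK dK|{}Z K z z' clZ IH cK dK dis z'Z zK ez cross] ZL v v' vZ v'Z vv' ov ov'.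
  have [s [srch defs e1 ex e0]] := eps_clique e_sym e_irr G_irred cK ZL vZ v'Z vv'.
  by exists s; split; rewrite ?e1 ?ex // => w _ _; apply: e0.
have zZL : Z \subset low by apply: subset_trans ZL; apply: subsetUl.
have KL : K \subset low by apply: subset_trans ZL; apply: subsetUr.
have cU : conn (Z :|: K) by apply: cluster_conn; [apply: ltnW|apply: clusterU ez cross].
have dU w : degin (Z :|: K) w = (degin Z w + degin K w)%N by apply: degin_setU.
have ZK w : w \in Z -> w \in K = false by move=> wZ; apply: disjointFr dis wZ.
have nz' : outer (Z :|: K) z' = false.
  apply/negP; rewrite /outer dU => /eqP H.
  have := cluster_degin clZ z'Z; have := degin_gt0 zK ez.
  by move: H; clear -d2; lia.
have nz : outer (Z :|: K) z = false.
  apply/negP; rewrite /outer dU => /eqP H.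
  have := degin_clique cK zK; have : (0 < degin Z z)%N by apply: (degin_gt0 z'Z); rewrite e_sym.
  by move: H; rewrite dK; clear -d2; lia.
have degKZ w : w \in Z -> w != z' -> degin K w = 0%N.
  move=> wZ wz; apply: degin_eq0 => x xK; apply/negP => ewx; have [wz' _] := cross _ _ wZ xK ewx.
  by rewrite wz' eqxx in wz.
have outZ w : w \in Z -> outer (Z :|: K) w -> w != z' /\ outer Z w.
  move=> wZ ow; have wz : w != z' by apply: contraTneq ow => ->; rewrite nz'.
  by split=> //; move: ow; rewrite /outer dU degKZ // addn0.
have oz' : outer Z z'.
  have z'L : z' \in low by apply: (subsetP zZL).
  have := degin_le_degree e (Z :|: K) z'; rewrite (degree_low z'L) dU.
  have := cluster_degin clZ z'Z; have := degin_gt0 zK ez; rewrite /outer.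
  by move: (degin Z z') (degin K z') => a b; clear; lia.
have ext s0 : search e s0 -> s0 != [::] -> {subset s0 <= Z :|: K} ->
   exists r, [/\ search e (r ++ s0), sset (r ++ s0) = Z :|: K & forall x, x \in r -> x \notin s0].
  move=> srch _ sub; have [r [srch' defr]] := conn_extend cU srch sub; exists r; split=> //.
  move=> x xr; have := search_uniq srch'; rewrite cat_uniq => /and3P[_ /hasPn H _].
  by apply: contraTN xr => /H.
(* For [v] in [Z] and [v'] in [K], isolate [v] and [z'] in [Z] and pass the nonzero value on through
   [z] to [v']. All other vertices of [K] come later, see both [z] and [v'], and get 0. *)
have mixed : forall v v', v \in Z -> v' \in Z :|: K -> v' \notin Z -> v != v' ->
      outer (Z :|: K) v -> outer (Z :|: K) v' -> exists s, isolates (Z :|: K) v v' s.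
  move=> {v v' vZ v'Z vv' ov ov'} v v' vZ v'U v'Z vv' ov ov'.
  move: v'U; rewrite inE (negPf v'Z) /= => v'K.
  have [vz oZv] := outZ v vZ ov.
  have [s [srch defs e1 e2 e0]] := IH zZL v z' vZ z'Z vz oZv oz'.
  have sZ x : (x \in s) = (x \in Z) by rewrite -defs inE.
  have v'z : v' != z by apply: contraTneq ov' => ->; rewrite nz.
  have zs : z \notin s by rewrite sZ; apply: contraTN zK => /ZK ->.
  have srch1 : search e (z :: s).
    by apply: (@search_cons _ e e_sym z s z') => //; rewrite ?sZ // e_sym.
  have eK x y : x \in K -> y \in K -> x != y -> e x y by move=> *; apply: clique_edge cK _ _ _.
  have v's : v' \notin z :: s by rewrite inE negb_or v'z sZ.
  have srch2 : search e (v' :: z :: s).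
    by apply: (@search_cons _ e e_sym v' (z :: s) z) => //; rewrite ?mem_head ?eK.
  have ez0 : eps e (z :: s) z != 0.
    rewrite eps_head // oppr_eq0 (_ : [set u in sset s | e z u] = [set z']) ?big_set1 //.
    apply/setP => x; rewrite !inE sZ; apply/andP/eqP => [[xZ ezx]|->].
      by rewrite e_sym in ezx; case: (cross _ _ xZ zK ezx).
    by rewrite z'Z e_sym.
  have ev0 : eps e (v' :: z :: s) v' != 0.
    rewrite eps_head // oppr_eq0 (_ : [set u in sset (z :: s) | e v' u] = [set z]) ?big_set1 //.
    apply/setP => x; rewrite !inE sZ; apply/andP/eqP => [[/orP[/eqP//|xZ] evx]|->].
      by rewrite e_sym in evx; have [_ H] := cross _ _ xZ v'K evx; rewrite H eqxx in v'z.
    by rewrite eqxx eK.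
  have [//||r [srch' defr nr]] := ext _ srch2.
    by move=> x; rewrite !inE sZ => /or3P[/eqP ->|/eqP ->|->]; rewrite ?v'K ?zK ?orbT.
  have retain x : x \in s -> eps e (r ++ [:: v', z & s]) x = eps e s x.
    move=> xs; rewrite eps_cat ?inE ?xs ?orbT // eps_cons ?inE ?xs ?orbT //.
    by rewrite eps_cons.
  exists (r ++ [:: v', z & s]); split=> //.
  - by rewrite retain ?sZ.
  - by rewrite eps_cat ?mem_head.
  - move=> w wU ow wv wv'; case: (boolP (w \in s)) => ws.
      rewrite retain //; move: ws; rewrite sZ => ws.
      by have [wz owZ] := outZ w ws ow; apply: e0.
    have wz : w != z by apply: contraTneq ow => ->; rewrite nz.
    apply: eps_low_ext => //.
    + by move=> x xs; apply: (subsetP ZL); rewrite -defr inE.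
    + move=> x xr; have := nr x xr; rewrite !inE !negb_or => /and3P[xv' xz xs].
      have xK : x \in K.
        have : x \in Z :|: K by rewrite -defr inE mem_cat xr.
        by rewrite inE -sZ (negPf xs).
      by apply: (@degin_ge2 _ _ _ _ v' z); rewrite ?inE ?eqxx ?orbT ?eK.
    + move: wU; rewrite -defr inE mem_cat => /orP[//|].
      by rewrite !inE (negPf wv') (negPf wz) (negPf ws).
case: (boolP (v \in Z)) => vZ'; case: (boolP (v' \in Z)) => vZ''.
(* Both in [Z]: then [z'] has value 0, which spreads over [K]. *)
- have [vz oZv] := outZ v vZ' ov; have [vz' oZv'] := outZ v' vZ'' ov'.
  have [s [srch defs e1 e2 e0]] := IH zZL v v' vZ' vZ'' vv' oZv oZv'.
  have sZ x : (x \in s) = (x \in Z) by rewrite -defs inE.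
  have s0 : s != [::] by case: (s) srch.
  have [|r [srch' defr nr]] := ext s srch s0; first by move=> x; rewrite sZ inE => ->.
  exists (r ++ s); split=> //; rewrite ?eps_cat ?sZ //.
  move=> w wU ow wv wv'; case: (boolP (w \in s)) => ws.
    rewrite eps_cat //; move: ws; rewrite sZ => ws; apply: e0 => //.
    by case: (outZ w ws ow).
  apply: eps_zero_ext => //; last first.
    by move: wU; rewrite -defr inE mem_cat (negPf ws) orbF.
  move=> n x; rewrite sZ => nZ xr exn.
  have xK : x \in K.
    have : x \in Z :|: K by rewrite -defr inE mem_cat xr.
    by rewrite inE -sZ (negPf (nr x xr)).
  have [-> _] : n = z' /\ x = z by apply: cross => //; rewrite e_sym.
  by apply: e0 => //; rewrite eq_sym.
- exact: mixed.
- have [s [srch defs e1 e2 e0]] : exists s, isolates (Z :|: K) v' v s.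
    by apply: mixed; rewrite // eq_sym.
  by exists s; split=> // w wU ow wv wv'; apply: e0.
(* Both in [K]: then [z], being different from both, has value 0, which spreads over [Z]. *)
- have := vZ; rewrite inE (negPf vZ') /= => vK.
  have := v'Z; rewrite inE (negPf vZ'') /= => v'K.
  have [s [srch defs e1 ex e0]] := eps_clique e_sym e_irr G_irred cK KL vK v'K vv'.
  have sK x : (x \in s) = (x \in K) by rewrite -defs inE.
  have s0 : s != [::] by case: (s) srch.
  have [|r [srch' defr nr]] := ext s srch s0; first by move=> x; rewrite sK inE => ->; rewrite orbT.
  exists (r ++ s); split=> //; rewrite ?eps_cat ?sK ?e1 ?ex //.
  move=> w wU ow wv wv'; case: (boolP (w \in s)) => ws.
    by rewrite eps_cat //; apply: e0.
  apply: eps_zero_ext => //; last first.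
    by move: wU; rewrite -defr inE mem_cat (negPf ws) orbF.
  move=> n x; rewrite sK => nK xr exn.
  have xZ : x \in Z.
    have : x \in Z :|: K by rewrite -defr inE mem_cat xr.
    by rewrite inE -[x \in K]sK (negPf (nr x xr)) orbF.
  have [_ ->] := cross _ _ xZ nK exn.
  by apply: e0; [apply: contraTneq ov => <-|apply: contraTneq ov' => <-]; rewrite nz.
Qed.

End Clusters.

(** * Counting edges in the low-degree part *)

Section Arithmetic.
Variable d : nat.
Hypothesis d4 : (4 <= d)%N.

(** The solution of [slope * d - d * (d - 1) = 2], that is, surplus 2 for a copy of K_d. *)
Definition slope : rat := d%:R - 1 + 2 / d%:R.

(* The contribution to the potential below of a low vertex without low
   neighbours. *)
Definition vweight : rat := slope - alpha d.+1 * d%:R.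

Lemma d_ge4 : (4 : rat) <= d%:R.
Proof. by rewrite (ler_nat _ 4). Qed.

Lemma alphaE : alpha d.+1 = 1 / 2 - 1 / (d%:R * (d%:R - 1)).
Proof. by rewrite /alpha -natr1; congr (_ - _ / (_ * _)); ring. Qed.

Lemma alpha_bounds : 5 / 12 <= alpha d.+1 <= (1 / 2 : rat).
Proof.
rewrite alphaE; have := d_ge4; move: (d%:R : rat) => x x4.
have p : 0 < x * (x - 1) by apply: mulr_gt0; lra.
have q : 1 / (x * (x - 1)) <= 1 / 12 by rewrite ler_pdivrMr //; nra.
have r : 0 <= 1 / (x * (x - 1)) by apply: divr_ge0; lra.
lra.
Qed.

Lemma vweightE : vweight = (d%:R - 2) / 2 + 2 / d%:R + 1 / (d%:R - 1).
Proof.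
rewrite /vweight /slope alphaE; have := d_ge4; move: (d%:R : rat) => x x4.
by field; apply/andP; split; lra.
Qed.

Lemma vweight_ge : 2 - alpha d.+1 <= vweight.
Proof.
rewrite vweightE alphaE; have := d_ge4; move: (d%:R : rat) => x x4.
rewrite -subr_ge0.
have -> : (x - 2) / 2 + 2 / x + 1 / (x - 1) - (2 - (1 / 2 - 1 / (x * (x - 1)))) =
          (x - 2) * (x - 3) / (2 * x) by field; apply/andP; split; lra.
by apply: divr_ge0; [apply: mulr_ge0; lra|lra].
Qed.

Lemma vweight_ge2 : (5 <= d)%N -> 2 <= vweight.
Proof.
move=> d5; have x5 : (5 : rat) <= d%:R by rewrite (ler_nat _ 5).
rewrite vweightE; move: (d%:R : rat) x5 => x x5.
rewrite -subr_ge0.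
have -> : (x - 2) / 2 + 2 / x + 1 / (x - 1) - 2 =
   ((x-5)^+3 + 8 * (x-5)^+2 + 17 * (x-5) + 6) / (2 * x * (x - 1)).
  by field; apply/andP; split; lra.
apply: divr_ge0; last by apply: mulr_ge0; lra.
have y0 : 0 <= x - 5 by lra.
by rewrite !addr_ge0 // ?mulr_ge0 ?exprn_ge0.
Qed.

(** The gain per removed vertex for a leaf block K_(d-2), the largest clique that is removed without
    a mark when d is at least 5 and the block is not K_d. *)
Lemma vweight_clique : vweight - (1 - alpha d.+1) * (d%:R - 2) = 2 / (d%:R - 1).
Proof.
rewrite vweightE alphaE; have := d_ge4; move: (d%:R : rat) => x x4.
by field; apply/andP; split; lra.
Qed.

(** The equation that determines [alpha]: d - 2 vertices of K_(d-1) disappear with its degree sum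
    (d-1)(d-2), and the weight of the root changes from [vweight] to 2. *)
Lemma mark_balance :
  (d%:R - 2) * vweight - (1 - alpha d.+1) * ((d%:R - 1) * (d%:R - 2)) - (2 - vweight) = 0.
Proof.
rewrite vweightE alphaE; have := d_ge4; move: (d%:R : rat) => x x4.
by field; apply/andP; split; lra.
Qed.

End Arithmetic.

Lemma vweight4 : vweight 4 = 11 / 6.
Proof. by rewrite vweightE. Qed.

Lemma alpha4 : alpha 5 = 5 / 12.
Proof. by rewrite (@alphaE 4). Qed.

(** * The potential of a set of low vertices and its change at a leaf block *)

Section Potential.
Variables (T : finType) (e : rel T).
Hypotheses (e_sym : symmetric e) (e_irr : irreflexive e).
Hypothesis (G_irred : AT_irreducible e).
Hypothesis (delta_ge4 : (4 <= min_degree e)%N).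
Hypothesis (omega_le : (clique_number e <= min_degree e)%N).
Implicit Types (S K Z M : {set T}) (v w x : T) (F : {set {set T}}).

Notation low := (low e).
Notation conn := (conn e).
Notation degin := (degin e).
Notation delta := (min_degree e).
Notation cluster := (cluster e).
Notation outer := (outer e).
Notation dd := (delta%:R : rat).
Notation al := (alpha delta.+1).
Notation Aw := (vweight delta).

Definition degsum S : nat := \sum_(v in S) degin S v.
Definition sigma S : rat := slope delta * #|S|%:R - (degsum S)%:R.
(** For low vertices, the number of edges from [S :\: C] to vertices outside [S]. *)
Definition gap S (C : {set T}) : rat := \sum_(v in S :\: C) (dd - (degin S v)%:R).
(* Vertices in [M] stand for a whole removed block and weigh 2 instead of
   [vweight delta]. *)
Definition potential S M C : rat := sigma S - al * gap S C + #|M|%:R * (2 - Aw).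

(** The last condition gives every cluster a free vertex: its only edge out of the cluster stays
    inside [S]. For low [S] it therefore never meets a vertex of larger degree. *)
Definition cluster_family S F :=
  [/\ forall Z, Z \in F -> cluster Z /\ Z \subset S,
      forall Z Z', Z \in F -> Z' \in F -> Z != Z' ->
        forall a b, a \in Z -> b \in Z' -> a != b /\ ~~ e a b
    & forall Z, Z \in F -> exists v, [/\ v \in Z, outer Z v & degin S v = delta]].

Lemma degin_lowle S v : v \in low -> (degin S v <= delta)%N.
Proof. by move=> vL; rewrite -(degree_low vL) degin_le_degree. Qed.

Lemma degsum_setU S S' : [disjoint S & S'] ->
  (degsum (S :|: S') = degsum S + degsum S' + \sum_(v in S) degin S' v
     + \sum_(v in S') degin S v)%N.
Proof.
move=> dis; rewrite /degsum (big_setID S) /= setUK setDUl setDv set0U.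
rewrite (setDidPl _); last by rewrite disjoint_sym.
under eq_bigr do rewrite degin_setU //.
under [X in (_ + X)%N]eq_bigr do rewrite degin_setU //.
by rewrite !big_split /=; lia.
Qed.

Section Leaf.
Variables (S b : {set T}) (x : T).
Hypotheses (xb : x \in b) (bS : b \subset S) (cl : closed_by e S x (b :\ x)).
Let S' := S :\: (b :\ x).

Lemma leaf_xS' : x \in S'.
Proof. by rewrite !inE eqxx (subsetP bS). Qed.

Lemma leaf_degin_in v : v \in b :\ x -> degin S v = degin b v.
Proof.
move=> vb; apply: eq_card => u; rewrite !inE.
apply/andP/andP => -[uS evu]; split=> //; last exact: (subsetP bS).
have [_ _ H] := cl; have := H v u vb uS evu.
by rewrite setD1K.
Qed.

Lemma leaf_degin_out v : v \in S' -> v != x -> degin S v = degin S' v.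
Proof.
rewrite inE => /andP[vb vS] vx; apply: eq_card => u; rewrite !inE.
case: (boolP (e v u)) => evu; rewrite ?andbF // !andbT; case: (boolP (u \in S)) => uS; rewrite ?andbF // andbT.
symmetry; apply/negP => ub; have [_ _ H] := cl.
have := H u v; rewrite !inE ub => /(_ isT vS); rewrite e_sym evu => /(_ isT).
by rewrite (negPf vx) /=; move: vb; rewrite !inE vx /= => /negPf ->.
Qed.

Lemma leaf_setI : S :&: (b :\ x) = b :\ x.
Proof. by apply/setIidPr; case: cl. Qed.

Lemma leaf_degin_x : degin S x = (degin S' x + degin b x)%N.
Proof.
have -> : degin b x = degin (b :\ x) x by rewrite -{1}(setD1K xb) degin_setU1 ?e_irr ?inE ?eqxx.
rewrite -degin_setU; first by rewrite -{1}(setID S (b :\ x)) leaf_setI setUC.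
by rewrite -setI_eq0 /S' setDE -setIA (setIC (~: _)) setICr setI0.
Qed.

Lemma leaf_degsum : degsum S = (degsum S' + degsum b)%N.
Proof.
rewrite /degsum (big_setID (b :\ x)) leaf_setI /= -/S'.
rewrite (eq_bigr (fun v => degin b v)); last exact: leaf_degin_in.
rewrite (bigD1 x leaf_xS') /= leaf_degin_x.
rewrite [X in (_ + (_ + X))%N](eq_bigr (fun v => degin S' v)); last first.
  by move=> v /andP[vS vx]; apply: leaf_degin_out.
rewrite [X in _ = (X + _)%N](bigD1 x leaf_xS') /=.
rewrite [X in _ = (_ + X)%N](bigD1 x xb) /=.
rewrite (eq_bigl (fun v => (v \in b) && (v != x))); last by move=> v; rewrite !inE andbC.
by move: (\sum_(_ in b | _) _)%N (\sum_(_ in S' | _) _)%N => p q; clear; lia.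
Qed.

Lemma leaf_card : #|S| = (#|S'| + #|b :\ x|)%N.
Proof. by rewrite -(cardsID (b :\ x) S) leaf_setI addnC. Qed.

Lemma leaf_gap (C : {set T}) : C \subset S' ->
  gap S C = gap S' C + #|b :\ x|%:R * dd - (degsum b)%:R + (x \in C)%:R * (degin b x)%:R.
Proof.
move=> CS; rewrite /gap (big_setID (b :\ x)) /=.
have -> : (S :\: C) :&: (b :\ x) = b :\ x.
  apply/setP => v; rewrite !inE; case: (v =P x) => [_|vx] /=; first by rewrite andbF.
  case: (boolP (v \in b)) => vb; rewrite ?andbF // (subsetP bS) // !andbT.
  apply/negP => vC; have := subsetP CS v vC; rewrite !inE vb andbT.
  by move/eqP: vx => ->.
have -> : (S :\: C) :\: (b :\ x) = S' :\: C by rewrite /S' !setDDl setUC.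
have -> : \sum_(v in b :\ x) (dd - (degin S v)%:R) =
          #|b :\ x|%:R * dd - ((degsum b)%:R - (degin b x)%:R).
  rewrite (eq_bigr (fun v => dd - (degin b v)%:R)); last by move=> v vb; rewrite leaf_degin_in.
  rewrite big_split /= sumr_const mulr_natl sumrN; congr (_ - _).
  rewrite /degsum natr_sum (bigD1 x xb) /= addrC addrK.
  by apply: eq_bigl => v; rewrite !inE andbC.
have -> : \sum_(v in S' :\: C) (dd - (degin S v)%:R) =
    \sum_(v in S' :\: C) (dd - (degin S' v)%:R) - (x \notin C)%:R * (degin b x)%:R.
  case: (boolP (x \in C)) => xC /=.
    rewrite mul0r subr0; apply: eq_bigr => v; rewrite inE => /andP[vC vS].
    by rewrite leaf_degin_out //; apply: contraNneq vC => ->.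
  have xSC : x \in S' :\: C by rewrite inE xC leaf_xS'.
  rewrite !(bigD1 x xSC) /= leaf_degin_x natrD.
  rewrite (eq_bigr (fun v => dd - (degin S' v)%:R)); last first.
    by move=> v /andP[/setDP[vS vC] vx]; rewrite leaf_degin_out.
  by move: (\sum_(i | _) _) => q; ring.
by move: (\sum_(_ in _) _) => q; case: (x \in C) => /=; ring.
Qed.

Lemma leaf_potential M M' (C : {set T}) : C \subset S' ->
  potential S M C = potential S' M' C + #|b :\ x|%:R * Aw - (1 - al) * (degsum b)%:R
    - al * ((x \in C)%:R * (degin b x)%:R) + (#|M|%:R - #|M'|%:R) * (2 - Aw).
Proof.
move=> CS; rewrite /potential /sigma leaf_degsum leaf_card leaf_gap // !natrD.
by rewrite /vweight; ring.
Qed.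

End Leaf.

End Potential.

(** * Numerical gain from removing a leaf block *)

Section Gains.
Variables (d nb m : nat).
Hypotheses (d4 : (4 <= d)%N) (m_nb : (m <= nb)%N) (m5 : (0 < m)%N -> (5 <= d)%N).

Lemma marked_weight_ge : (5 <= d)%N ->
  2 * nb%:R <= nb%:R * vweight d + m%:R * (2 - vweight d).
Proof.
move=> d5; have A2 := vweight_ge2 d4 d5.
have mn : (m%:R : rat) <= nb%:R by rewrite ler_nat.
by nra.
Qed.

(** Without marks and for [5 <= d] the worst block is K_(d-2), see [vweight_clique]. For [d = 4] a
    triangle still gains 2 * 11/6 - 6 * 7/12 = 1/6. Marked vertices occur only in blocks with
    [nb <= 2], where weight 2 per vertex suffices. *)
Lemma clique_gain : ((5 <= d)%N -> (nb.+3 <= d)%N) -> (d = 4%N -> (nb <= 2)%N) ->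
  ((0 < m)%N -> (nb <= 2)%N) ->
  0 <= nb%:R * vweight d - (1 - alpha d.+1) * (nb.+1%:R * nb%:R) + m%:R * (2 - vweight d).
Proof.
move=> h5 h4 hm; have /andP[a1 a2] := alpha_bounds d4.
have small : (5 <= d)%N -> (nb <= 2)%N ->
  0 <= nb%:R * vweight d - (1 - alpha d.+1) * (nb.+1%:R * nb%:R) + m%:R * (2 - vweight d).
  move=> d5 nb2; have := marked_weight_ge d5.
  by case: (nb) nb2 => [|[|[|]]] // _ H; move: H a1 a2; lra.
case: (posnP m) => [m0|mp]; last by apply: small; [apply: m5|apply: hm].
rewrite m0 mul0r addr0; case: (ltnP 4 d) => d5.
  have := vweight_clique d4.
  have x5 : (5 : rat) <= d%:R by rewrite (ler_nat _ 5).
  have nd : (nb%:R + 3 : rat) <= d%:R by rewrite -natrD ler_nat addn3 h5.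
  have p : 0 <= (2 : rat) / (d%:R - 1) by apply: divr_ge0; lra.
  have n0 : (0 : rat) <= nb%:R by rewrite ler0n.
  rewrite -natr1 => E; move: E p => <- p.
  have q : 0 <= vweight d - (1 - alpha d.+1) * (nb%:R + 1).
    by apply: le_trans p _; rewrite lerD2l lerN2; nra.
  by have := mulr_ge0 n0 q; lra.
have de4 : d = 4%N by apply/eqP; rewrite eqn_leq d5.
rewrite de4 vweight4 alpha4; have := h4 de4.
by case: (nb) => [|[|[|]]] // _; lra.
Qed.

Lemma cycle_gain : (2 <= nb)%N ->
  0 <= nb%:R * vweight d - (1 - alpha d.+1) * (2 * nb.+1%:R) + m%:R * (2 - vweight d).
Proof.
move=> nb2; have /andP[a1 a2] := alpha_bounds d4.
have n2 : (2 : rat) <= nb%:R by rewrite (ler_nat _ 2).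
rewrite -natr1; case: (ltnP 4 d) => d5.
  by have := marked_weight_ge d5; nra.
have de4 : d = 4%N by apply/eqP; rewrite eqn_leq d5.
have -> : m = 0%N by case: (posnP m) => // /m5; rewrite de4.
by rewrite de4 vweight4 alpha4; lra.
Qed.

(** The isolated [- alpha] is the loss at a root lying in a cluster; for an unmarked vertex the
    inequality is [vweight_ge]. *)
Lemma edge_gain : nb = 1%N ->
  0 <= nb%:R * vweight d - (1 - alpha d.+1) * 2 - alpha d.+1 + m%:R * (2 - vweight d).
Proof.
move=> nb1; have /andP[a1 a2] := alpha_bounds d4; have A2 := vweight_ge d4.
move: m_nb; rewrite nb1; case: (m) => [|[|]] // _; lra.
Qed.

End Gains.

(** * Removing a leaf block does not increase the potential *)

Section LeafPotential.
Variables (T : finType) (e : rel T).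
Hypotheses (e_sym : symmetric e) (e_irr : irreflexive e).
Hypothesis (G_irred : AT_irreducible e).
Hypothesis (delta_ge4 : (4 <= min_degree e)%N).
Hypothesis (omega_le : (clique_number e <= min_degree e)%N).
Implicit Types (S K Z M : {set T}) (v w x : T) (F : {set {set T}}).

Notation low := (low e).
Notation conn := (conn e).
Notation degin := (degin e).
Notation delta := (min_degree e).
Notation cluster := (cluster e).
Notation outer := (outer e).
Notation al := (alpha delta.+1).
Notation Aw := (vweight delta).
Notation family := (cluster_family e).
Notation potential := (potential e).
Notation sigma := (sigma e).
Notation degsum := (degsum e).

Lemma clique_le K : clique e K -> (#|K| <= delta)%N.
Proof. by move=> cK; apply: leq_trans omega_le; apply: (@bigop.bigmax_sup _ K). Qed.

Lemma degsum_clique K : clique e K -> degsum K = (#|K| * #|K|.-1)%N.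
Proof.
move=> cK; rewrite /degsum (eq_bigr (fun=> #|K|.-1)) ?sum_nat_const //.
by move=> v vK; apply: degin_clique.
Qed.

Lemma family_cover S F : family S F -> cover F \subset S.
Proof. by case=> H _ _; apply/bigcupsP => Z /H[]. Qed.

Lemma cover_degin S F v : family S F -> v \in cover F -> (delta.-1 <= degin S v)%N.
Proof.
move=> [H _ _] /bigcupP[Z ZF vZ]; have [clZ ZS] := H Z ZF.
exact: leq_trans (cluster_degin e_irr clZ vZ) (degin_subset _ _ ZS).
Qed.

Lemma card_setID_split M S (B : {set T}) : M \subset S -> B \subset S ->
  #|M| = (#|M :&: (S :\: B)| + #|M :&: B|)%N.
Proof.
move=> MS BS; rewrite -(cardsID B M) addnC; congr (#|pred_of_set _| + _)%N.
by apply/setP => y; rewrite !inE; case: (boolP (y \in M)) => [/(subsetP MS) ->|_]; rewrite ?andbT ?andbF.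
Qed.

(** A root inside a cluster already has delta - 1 neighbours in the rest, so its block is a single
    edge. A clique with a marked vertex other than its root has at most three vertices, since marked
    vertices have degree at most 2. *)
Lemma potential_leaf S (b : {set T}) x M (C : {set T}) :
  S \subset low -> x \in b -> b \subset S -> (2 <= #|b|)%N -> closed_by e S x (b :\ x) ->
  M \subset S -> (forall m, m \in M -> (degin S m <= 2)%N) -> (M != set0 -> 5 <= delta)%N ->
  C \subset S :\: (b :\ x) ->
  (x \in C -> delta.-1 <= degin (S :\: (b :\ x)) x)%N ->
  [/\ clique e b, (#|b| < delta)%N & (5 <= delta)%N -> (#|b| < delta.-1)%N]
  \/ (3 <= #|b|)%N /\ (forall v, v \in b -> degin b v = 2) ->
  potential (S :\: (b :\ x)) (M :&: (S :\: (b :\ x))) C <= potential S M C.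
Proof.
move=> SL xb bS b2 cl MS M2 M5 CS xC Hb.
rewrite (leaf_potential e_sym e_irr xb bS cl M (M :&: (S :\: (b :\ x))) CS).
have bxS : b :\ x \subset S by apply: subset_trans (subsetDl _ _) bS.
have := card_setID_split MS bxS.
set m := #|M :&: (b :\ x)|; set nb := #|b :\ x|; set M' := M :&: _ => cM.
have cb : #|b| = nb.+1 by rewrite (cardsD1 x) xb.
have mnb : (m <= nb)%N by apply: subset_leq_card; apply: subsetIr.
have m5 : (0 < m)%N -> (5 <= delta)%N.
  by case/card_gt0P => y; rewrite inE => /andP[yM _]; apply: M5; apply/set0Pn; exists y.
suff gain : 0 <= nb%:R * Aw - (1 - al) * (degsum b)%:R
    - al * ((x \in C)%:R * (degin b x)%:R) + m%:R * (2 - Aw).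
  rewrite cM natrD; move: gain; set p := potential _ _ _.
  by move: p (degsum b)%:R => p q; lra.
have dbx : (degin b x <= 1)%N || (x \notin C).
  case: (boolP (x \in C)) => //= xC'; last by rewrite orbT.
  have := leaf_degin_x e_irr xb cl; have := xC xC'.
  have := degin_lowle S (subsetP SL x (subsetP bS x xb)).
  by move: (degin S x) (degin _ x) (degin b x) delta_ge4 => p q r; clear; lia.
case: Hb => [[cqb bd bd5]|[b3 b2d]].
  have dx : degin b x = nb by rewrite degin_clique // cb.
  rewrite degsum_clique // cb natrM /=.
  have mnb2 : (0 < m)%N -> (nb <= 2)%N.
    case/card_gt0P => y; rewrite inE => /andP[yM ybx].
    have := M2 y yM; rewrite (leaf_degin_in xb bS cl ybx) degin_clique ?cb //.
    by move: ybx; rewrite inE => /andP[].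
  case: (boolP (x \in C)) dbx => xC' /=.
    rewrite orbF {1}dx => nb1; have {}nb1 : nb = 1%N.
      by move: b2; rewrite cb; move: nb1; case: (nb) => [|[|]].
    have := edge_gain delta_ge4 mnb nb1; rewrite dx nb1.
    by move: (m%:R) => q; lra.
  move=> _; rewrite mul0r mulr0 subr0; apply: clique_gain => //.
  - by move=> d5; have := bd5 d5; rewrite cb; move: d5; clear; lia.
  - by move=> d4; move: bd; rewrite cb d4.
have -> : degsum b = (2 * nb.+1)%N.
  by rewrite /degsum (eq_bigr (fun=> 2)) // sum_nat_const cb mulnC.
move: dbx; rewrite (b2d x xb) /= => /negPf ->; rewrite mul0r mulr0 subr0 natrM.
by apply: cycle_gain => //; rewrite -ltnS -cb.
Qed.

(* Removing a leaf block K_(delta - 1) would increase the potential too much;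
   instead its root is marked and weighs 2 from then on. *)
Lemma potential_mark S (b : {set T}) x M (C : {set T}) :
  x \in b -> b \subset S -> closed_by e S x (b :\ x) -> clique e b -> #|b| = delta.-1 ->
  M \subset S :\: b -> C \subset S :\: (b :\ x) -> x \notin C ->
  potential S M C = potential (S :\: (b :\ x)) (x |: M) C.
Proof.
move=> xb bS cl cqb cb MS CS xC.
rewrite (leaf_potential e_sym e_irr xb bS cl M (x |: M) CS) (negPf xC) mul0r mulr0 subr0.
have xM : x \notin M by apply/negP => /(subsetP MS); rewrite inE xb.
have d1 : (#|b| = delta - 1)%N by rewrite cb subn1.
have cbx : #|b :\ x| = (delta - 2)%N.
  by move: d1; rewrite (cardsD1 x) xb; move: delta_ge4; clear; lia.
rewrite degsum_clique // d1 cardsU1 xM -subn1 natrM -subnDA cbx.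
have h2 : ((delta - 2)%N%:R : rat) = delta%:R - 2 by rewrite natrB // ltnW // ltnW.
have h1 : ((delta - 1)%N%:R : rat) = delta%:R - 1 by rewrite natrB // ltnW // ltnW // ltnW.
rewrite h2 h1 natrD.
have := mark_balance delta_ge4.
by move: (potential _ _ _) (#|M|%:R : rat) => p q /=; lra.
Qed.

End LeafPotential.

(** * Attaching a copy of K_delta by one edge *)

Section CliqueGluing.
Variables (T : finType) (e : rel T).
Hypotheses (e_sym : symmetric e) (e_irr : irreflexive e).
Hypothesis (G_irred : AT_irreducible e).
Hypothesis (delta_ge4 : (4 <= min_degree e)%N).
Hypothesis (omega_le : (clique_number e <= min_degree e)%N).
Implicit Types (S K Z M : {set T}) (v w x : T) (F : {set {set T}}).

Notation low := (low e).
Notation conn := (conn e).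
Notation degin := (degin e).
Notation delta := (min_degree e).
Notation cluster := (cluster e).
Notation outer := (outer e).
Notation al := (alpha delta.+1).
Notation Aw := (vweight delta).
Notation cfamily := (cluster_family e).
Notation potential := (potential e).
Notation sigma := (sigma e).
Notation degsum := (degsum e).

Lemma delta_cast_pred : (delta.-1%:R : rat) = delta%:R - 1.
Proof. by rewrite -subn1 natrB // (leq_trans _ delta_ge4). Qed.

Lemma sigma_clique K : clique e K -> #|K| = delta -> sigma K = 2.
Proof.
move=> cK dK; rewrite /sigma degsum_clique // dK natrM delta_cast_pred /slope.
have := d_ge4 delta_ge4; move: (delta%:R : rat) => x x4.
by field; apply: lt0r_neq0; apply: lt_le_trans x4.
Qed.

Lemma marked_in_block S (b : {set T}) M : clique e b -> b \subset S -> (4 <= #|b|)%N ->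
  M \subset S -> (forall m, m \in M -> (degin S m <= 2)%N) -> M \subset S :\: b.
Proof.
move=> cb bS b4 MS M2; apply/subsetP => m mM; rewrite inE (subsetP MS) // andbT.
apply/negP => mb; have := M2 m mM; rewrite leqNgt => /negP; apply.
apply: leq_trans (degin_subset _ _ bS); rewrite degin_clique //.
by rewrite -ltnS prednK // (leq_trans _ b4).
Qed.

Section AddClique.
Variables (S K : {set T}) (z z' : T).
Hypotheses (dis : [disjoint S & K]) (cK : clique e K) (dK : #|K| = delta).
Hypotheses (z'S : z' \in S) (zK : z \in K) (ez : e z' z).
Hypothesis cross : forall a b, a \in S -> b \in K -> e a b -> a = z' /\ b = z.

Lemma addclique_degK v : v \in S -> degin K v = (v == z').
Proof.
move=> vS; case: (v =P z') => [->|/eqP vz].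
  apply/eqP/cards1P; exists z; apply/setP => u; rewrite !inE.
  apply/andP/eqP => [[uK ezu]|->//]; by case: (cross z'S uK ezu).
apply: degin_eq0 => u uK; apply/negP => evu; have [vz' _] := cross vS uK evu.
by rewrite vz' eqxx in vz.
Qed.

Lemma addclique_degS v : v \in K -> degin S v = (v == z).
Proof.
move=> vK; case: (v =P z) => [->|/eqP vz].
  apply/eqP/cards1P; exists z'; apply/setP => u; rewrite !inE.
  apply/andP/eqP => [[uS ezu]|->]; last by rewrite z'S e_sym.
  by rewrite e_sym in ezu; case: (cross uS zK ezu).
apply: degin_eq0 => u uS; apply/negP => evu; rewrite e_sym in evu; have [_ vz'] := cross uS vK evu.
by rewrite vz' eqxx in vz.
Qed.

(** The clique brings the surplus 2, and the joining edge raises the degree sum by 2. *)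
Lemma addclique_sigma : sigma (S :|: K) = sigma S.
Proof.
have s1 : (\sum_(v in S) degin K v = 1)%N.
  rewrite (bigD1 z') //= addclique_degK // eqxx big1 // => v /andP[vS /negPf vz].
  by rewrite addclique_degK // vz.
have s2 : (\sum_(v in K) degin S v = 1)%N.
  rewrite (bigD1 z) //= addclique_degS // eqxx big1 // => v /andP[vS /negPf vz].
  by rewrite addclique_degS // vz.
have := sigma_clique cK dK; rewrite /sigma degsum_setU // s1 s2 cardsU.
rewrite (eqP (_ : S :&: K == set0)) ?setI_eq0 // cards0 subn0 !natrD.
by move: (degsum S)%:R (degsum K)%:R (#|S|%:R) (#|K|%:R : rat) => p q r s; lra.
Qed.

Lemma addclique_gap F : cover F \subset S ->
  gap e (S :|: K) (cover F :|: K) = gap e S (cover F) - (z' \notin cover F)%:R.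
Proof.
move=> FS; rewrite /gap.
have -> : (S :|: K) :\: (cover F :|: K) = S :\: cover F.
  apply/setP => v; rewrite !inE; case: (boolP (v \in K)) => vK; rewrite ?orbT ?orbF //=.
  by rewrite (disjointFl dis vK) andbF.
have degv v : v \in S -> degin (S :|: K) v = (degin S v + (v == z'))%N.
  by move=> vS; rewrite degin_setU // addclique_degK.
case: (boolP (z' \in cover F)) => zF /=.
  rewrite subr0; apply: eq_bigr => v /setDP[vS vF]; rewrite degv //.
  by rewrite (_ : (v == z') = false) ?addn0 //; apply: contraNF vF => /eqP ->.
have zSF : z' \in S :\: cover F by rewrite inE zF.
rewrite !(bigD1 z' zSF) /= degv // eqxx natrD.
rewrite (eq_bigr (fun v => delta%:R - (degin S v)%:R)); last first.
  by move=> v /andP[/setDP[vS vF] /negPf vz]; rewrite degv // vz addn0.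
by move: (\sum_(i | _) _) => q /=; ring.
Qed.

End AddClique.

Lemma disjoint_of_notin (A B : {set T}) : (forall x, x \in A -> x \notin B) -> [disjoint A & B].
Proof.
move=> H; rewrite -setI_eq0; apply/eqP/setP => x; rewrite !inE.
by apply/andP => -[/H/negPf ->].
Qed.

Lemma cover_setU1 (Z : {set T}) F : cover (Z |: F) = Z :|: cover F.
Proof.
apply/setP => x; apply/bigcupP/setUP => [[Y /setU1P[->|YF] xY]|[xZ|/bigcupP[Y YF xY]]].
- by left.
- by right; apply/bigcupP; exists Y.
- by exists Z; rewrite ?setU11.
- by exists Y; rewrite ?setU1r.
Qed.

Lemma cover_disjoint_mem F (Z Z' : {set T}) v : 
  (forall Z Z', Z \in F -> Z' \in F -> Z != Z' ->
        forall a b, a \in Z -> b \in Z' -> a != b /\ ~~ e a b) ->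
  Z \in F -> Z' \in F -> v \in Z -> v \in Z' -> Z = Z'.
Proof.
move=> sep ZF ZF' vZ vZ'; apply/eqP; apply: contraT => ZZ.
by have [] := sep Z Z' ZF ZF' ZZ v v vZ vZ'; rewrite eqxx.
Qed.

(** A cluster that is all of [S] has no free vertex and cannot belong to a [cluster_family]; its
    larger surplus [4 * al] has to make up for this. *)
Definition counted S M :=
  cluster S /\ 4 * al <= sigma S \/
  exists F, cfamily S F /\ al * #|F|%:R <= potential S M (cover F).

(** If [z'] lies in no cluster of the family, [K] becomes a new one with free vertex [z]; it is paid
    for by the edge at [z'], which leaves [gap]. If [z'] lies in a cluster [Z], then [Z] grows by
    [K] and keeps its free vertex. *)
Lemma counted_addclique S K z z' M : S :|: K \subset low -> [disjoint S & K] ->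
  clique e K -> #|K| = delta -> z' \in S -> z \in K -> e z' z ->
  (forall a b, a \in S -> b \in K -> e a b -> a = z' /\ b = z) ->
  M \subset S -> counted S M -> counted (S :|: K) M.
Proof.
move=> SKL dis cK dK z'S zK ez cross MS.
have d0 : (0 < delta)%N by apply: leq_trans delta_ge4.
case=> [[clS sS]|[F [[F1 F2 F3] HF]]].
  by left; split; [apply: clusterU ez cross|rewrite (addclique_sigma dis cK dK z'S zK ez cross)].
have famF : cfamily S F by split.
have FS := family_cover famF.
have sig := addclique_sigma dis cK dK z'S zK ez cross.
have gp := addclique_gap dis z'S zK ez cross FS.
have up v : v \in S -> degin S v = delta -> degin (S :|: K) v = delta.
  move=> vS dv; apply/eqP; rewrite eqn_leq degin_lowle ?(subsetP SKL) ?inE ?vS //=.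
  by rewrite -dv degin_subset // subsetUl.
right; case: (boolP (z' \in cover F)) => zF; last first.
  exists (K |: F); split; last first.
    rewrite cover_setU1 [K :|: cover F]setUC /potential sig gp zF /=.
    have cF : #|K |: F|%:R <= 1 + #|F|%:R :> rat.
      by rewrite cardsU1 natrD lerD2r (ler_nat _ _ 1) leq_b1.
    have /andP[a1 _] := alpha_bounds delta_ge4.
    move: HF; rewrite /potential; set g := gap _ _ _; move: cF (g).
    by move: (#|M|%:R * _) (sigma S) (#|K |: F|%:R : rat) (#|F|%:R : rat) => p q r s cF g' HF; nra.
  split.
  - move=> Z /setU1P[->|/F1[clZ ZS]]; split; rewrite ?subsetUr //; first exact: cluster1.
    by apply: subset_trans ZS (subsetUl _ _).
  - have sep Z a b : Z \in F -> a \in Z -> b \in K -> a != b /\ ~~ e a b.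
      move=> ZF aZ bK; have [_ ZS] := F1 Z ZF; have aS := subsetP ZS a aZ.
      split; first by apply: contraTneq bK => <-; rewrite (disjointFr dis aS).
      apply/negP => eab; have [az' _] := cross _ _ aS bK eab.
      by case/negP: zF; rewrite -az'; apply/bigcupP; exists Z.
    move=> Z Z' /setU1P[->|ZF] /setU1P[->|ZF']; rewrite ?eqxx // => ZZ a b aZ bZ.
    + by have [] := sep Z' b a ZF' bZ aZ; rewrite eq_sym e_sym.
    + exact: sep ZF aZ bZ.
    + exact: F2 ZZ a b aZ bZ.
  - move=> Z /setU1P[->|ZF].
      exists z; split=> //; first by rewrite /outer degin_clique // dK.
      rewrite setUC degin_setU; last by rewrite disjoint_sym.
      rewrite (addclique_degS z'S zK ez cross) // eqxx degin_clique // dK addn1.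
      by rewrite prednK.
    have [v [vZ ov dv]] := F3 Z ZF; exists v; split=> //; apply: up => //.
    by have [_ ZS] := F1 Z ZF; apply: (subsetP ZS).
have [Z ZF z'Z] := bigcupP zF; have [clZ ZS] := F1 Z ZF.
have disZ : [disjoint Z & K] by apply: disjointWl dis.
have crossZ a b : a \in Z -> b \in K -> e a b -> a = z' /\ b = z.
  by move=> aZ; apply: cross; apply: (subsetP ZS).
have cZK : cluster (Z :|: K) by apply: clusterU ez crossZ.
exists ((Z :|: K) |: F :\ Z); split; last first.
  have -> : cover ((Z :|: K) |: F :\ Z) = cover F :|: K.
    by rewrite cover_setU1 -{2}(setD1K ZF) cover_setU1 setUAC.
  rewrite /potential sig gp zF subr0; apply: le_trans HF; apply: ler_wpM2l.
    by have /andP[a1 _] := alpha_bounds delta_ge4; lra.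
  rewrite ler_nat cardsU1 [X in (_ <= X)%N](cardsD1 Z) ZF.
  by rewrite leq_add2r leq_b1.
have sepK Z' a b : Z' \in F -> Z' != Z -> a \in Z' -> b \in K -> a != b /\ ~~ e a b.
  move=> ZF' ZZ aZ bK; have [_ ZS'] := F1 Z' ZF'; have aS := subsetP ZS' a aZ.
  split; first by apply: contraTneq bK => <-; rewrite (disjointFr dis aS).
  apply/negP => eab; have [az' _] := cross _ _ aS bK eab.
  by case/eqP: ZZ; apply: (cover_disjoint_mem F2 ZF' ZF (v := z')) => //; rewrite -az'.
have sepZ Z' a b : Z' \in F -> Z' != Z -> a \in Z' -> b \in Z :|: K -> a != b /\ ~~ e a b.
  move=> ZF' ZZ aZ /setUP[bZ|bK]; last exact: sepK ZF' ZZ aZ bK.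
  exact: F2 ZZ a b aZ bZ.
split.
- move=> Y /setU1P[->|/setD1P[_ /F1[clY YS]]]; split=> //; first exact: setSU.
  by apply: subset_trans YS (subsetUl _ _).
- move=> Y Y' /setU1P[->|/setD1P[YZ YF]] /setU1P[->|/setD1P[YZ' YF']]; rewrite ?eqxx // => YY a b aY bY.
  + by have [] := sepZ Y' b a YF' YZ' bY aY; rewrite eq_sym e_sym.
  + exact: sepZ YF YZ aY bY.
  + exact: F2 YY a b aY bY.
- move=> Y /setU1P[->|/setD1P[YZ YF]]; last first.
    have [v [vZ ov dv]] := F3 Y YF; exists v; split=> //; apply: up => //.
    by have [_ YS] := F1 Y YF; apply: (subsetP YS).
  have [v [vZ ov dv]] := F3 Z ZF; have vS := subsetP ZS v vZ.
  exists v; split; [by rewrite inE vZ| |exact: up].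
  rewrite /outer degin_setU // (addclique_degK z'S zK ez cross) //.
  case: (v =P z') => [vz|_]; last by rewrite addn0.
  (* a neighbour z besides delta neighbours in S is impossible *)
  have := degin_lowle (S :|: K) (subsetP SKL v (subsetP (subsetUl _ _) v vS)).
  rewrite degin_setU // (addclique_degK z'S zK ez cross) // dv vz eqxx addn1.
  by rewrite ltnn.
Qed.

End CliqueGluing.

(** * Induction over leaf blocks, then over components *)

Section CountingInduction.
Variables (T : finType) (e : rel T).
Hypotheses (e_sym : symmetric e) (e_irr : irreflexive e).
Hypothesis (G_irred : AT_irreducible e).
Hypothesis (delta_ge4 : (4 <= min_degree e)%N).
Hypothesis (omega_le : (clique_number e <= min_degree e)%N).
Implicit Types (S K Z M : {set T}) (v w x : T) (F : {set {set T}}).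

Notation low := (low e).
Notation conn := (conn e).
Notation degin := (degin e).
Notation delta := (min_degree e).
Notation cluster := (cluster e).
Notation outer := (outer e).
Notation al := (alpha delta.+1).
Notation Aw := (vweight delta).
Notation cfamily := (cluster_family e).
Notation potential := (potential e).
Notation sigma := (sigma e).
Notation degsum := (degsum e).
Notation counted := (counted e).

Lemma cluster_family_mono S S' F : S' \subset S -> S \subset low ->
  cfamily S' F -> cfamily S F.
Proof.
move=> SS SL [F1 F2 F3]; split=> //.
  by move=> Z /F1[clZ ZS]; split=> //; apply: subset_trans SS.
move=> Z ZF; have [v [vZ ov dv]] := F3 Z ZF; exists v; split=> //.
have vS : v \in S by have [_ ZS] := F1 Z ZF; apply/(subsetP SS)/(subsetP ZS).
by apply/eqP; rewrite eqn_leq degin_lowle ?(subsetP SL) //= -dv degin_subset.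
Qed.

(** Induction on [S] by a leaf block: a copy of K_delta is glued back with its root, K_(delta - 1)
    is traded for a mark if [5 <= delta], and any other block is removed at no loss by
    [potential_leaf]. *)
Lemma conn_counted S M : conn S -> S \subset low -> M \subset S ->
  (forall m, m \in M -> (degin S m <= 2)%N) -> (M != set0 -> 5 <= delta)%N ->
  counted S M.
Proof.
have dp : (0 < delta)%N by apply: leq_trans delta_ge4.
move: {2}(#|S|) (leqnn #|S|) => n; elim: n S M => [|n IH] S M nS cS SL MS M2 M5.
  by move: nS; rewrite leqn0 cards_eq0; case/connP: cS => /negPf ->.
case: (leqP #|S| 1) => S1.
  have /set0Pn[r rS] : S != set0 by case/connP: cS.
  have defS : S = [set r].
    by apply/setP => y; rewrite inE; apply/idP/eqP => [yS|->//]; apply: card_le1_eq S1 _ _.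
  right; exists set0; split; first by split=> Z; rewrite inE.
  have -> : cover set0 = set0 :> {set T} by rewrite /cover big_set0.
  rewrite cards0 mulr0 /potential /gap /sigma /degsum setD0 defS cards1 !big_set1.
  have -> : degin [set r] r = 0%N.
    apply/eqP; rewrite cards_eq0; apply/eqP/setP => y; rewrite !inE.
    by case: eqP => [->|//]; rewrite e_irr.
  have A2 := vweight_ge delta_ge4; have /andP[_ al2] := alpha_bounds delta_ge4.
  have -> : slope delta * 1 - 0 - al * (delta%:R - 0) = Aw.
    by rewrite /vweight mulr1 !subr0.
  have : (#|M| <= 1)%N by rewrite -(cards1 r) -defS subset_leq_card.
  by case: #|M| => [|[|]] // _; lra.
have [x [b [[xb bS cb b2] [c2 cl cS']]]] := leaf_block e_sym cS S1.
set S' := S :\: (b :\ x) in cS'.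
have bL : b \subset low by apply: subset_trans SL.
have xS' : x \in S' := leaf_xS' xb bS.
have S'S : S' \subset S by apply: subsetDl.
have S'L : S' \subset low by apply: subset_trans SL.
have xL : x \in low by apply: (subsetP bL).
have cS'S : (#|S'| < #|S|)%N.
  rewrite (leaf_card cl) -/S' -{1}[#|S'|]addn0 ltn_add2l card_gt0.
  by rewrite -card_gt0; move: b2; rewrite (cardsD1 x) xb.
have S'n : (#|S'| <= n)%N by rewrite -ltnS; apply: leq_trans nS.
have dx := leaf_degin_x e_irr xb cl; rewrite -/S' in dx.
have dxle := degin_lowle S xL.
have Hb := block_clique_or_cycle e_sym e_irr G_irred bL cb b2 c2.
case: (boolP (clique e b && (#|b| == delta))) => [/andP[cqb /eqP bd]|nbd].
  have b4 : (4 <= #|b|)%N by rewrite bd.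
  case: (boolP (S == b)) => [/eqP ->|Sb].
    left; split; first exact: cluster1.
    by rewrite sigma_clique //; have /andP[_ al2] := alpha_bounds delta_ge4; lra.
  have db : degin b x = delta.-1 by rewrite degin_clique // bd.
  have [y yS yb] : exists2 y, y \in S & y \notin b.
    by apply/subsetPn; apply: contra Sb => Sb; rewrite eqEsubset Sb.
  have yS' : y \in S' by rewrite !inE (negPf yb) andbF.
  have yx : y != x by apply: contraNneq yb => ->.
  have S'2 : (2 <= #|S'|)%N by apply/card_gt1P; exists y, x.
  (* The root already has delta - 1 neighbours in [b], so one edge joins [b] to the rest. *)
  have dS'1 : degin S' x = 1%N.
    have := conn_degin_gt0 cS' xS' S'2; move: dx dxle; rewrite db.
    by move: (degin S x) (degin S' x) dp => p q; clear; lia.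
  have [z' defz'] : exists z', [set u in S' | e x u] = [set z'] by apply/cards1P; apply/eqP.
  have : z' \in [set u in S' | e x u] by rewrite defz' inE.
  rewrite inE => /andP[z'S' exz'].
  have z'x : z' != x by apply: contraTneq exz' => ->; rewrite e_irr.
  have defS'' : S' :\: [set x] = S :\: b.
    by rewrite /S' setDDl setUC setD1K.
  have z'S : z' \in S :\: b by rewrite -defS'' inE z'S' inE z'x.
  have cS'' : conn (S :\: b).
    rewrite -defS''; apply: (conn_setD_side e_sym cS' z'S'); split.
    - by rewrite sub1set.
    - by rewrite inE.
    - move=> a c /set1P -> cS0 exc; have : c \in [set u in S' | e x u] by rewrite inE cS0.
      by rewrite defz' => /set1P ->; rewrite setU11.
  have defS : S = (S :\: b) :|: b by rewrite setUC -{1}(setID S b) (setIidPr bS).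
  have MSb : M \subset S :\: b by apply: marked_in_block MS M2.
  rewrite defS; apply: (@counted_addclique _ e e_sym e_irr delta_ge4 omega_le _ _ x z') => //.
  - by rewrite -defS.
  - by apply: disjoint_of_notin => w; rewrite inE => /andP[].
  - by rewrite e_sym.
  - move=> a c; rewrite inE => /andP[ab aS] cb' eac.
    have [_ _ Hcl] := cl; have cx : c = x.
      apply/eqP; apply: contraT => cx; have cbx : c \in b :\ x by rewrite !inE cx.
      by have := Hcl c a cbx aS; rewrite e_sym eac setD1K // (negPf ab) => /(_ isT).
    split=> //; have : a \in [set u in S' | e x u].
      by rewrite inE -cx e_sym eac andbT !inE (negPf ab) andbF.
    by rewrite defz' => /set1P.
  apply: IH => //.
  - by rewrite -ltnS; apply: leq_trans nS; apply: leq_ltn_trans cS'S; apply: subset_leq_card; rewrite -defS'' subsetDl.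
  - by apply: subset_trans SL; apply: subsetDl.
  - by move=> m mM; apply: leq_trans (M2 m mM); apply: degin_subset; apply: subsetDl.
case: (boolP [&& clique e b, #|b| == delta.-1 & 5 <= delta]%N) => [/and3P[cqb /eqP bd d5]|nbd'].
  have b4 : (4 <= #|b|)%N by rewrite bd -ltnS prednK.
  have db : degin b x = delta.-2 by rewrite degin_clique // bd.
  have dS'2 : (degin S' x <= 2)%N.
    by move: dx dxle; rewrite db; move: (degin S x) (degin S' x) d5 => p q; clear; lia.
  have MSb := marked_in_block e_irr cqb bS b4 MS M2.
  (* With at most two neighbours left, the root can be marked and lies in no cluster. *)
  have nd : (degin S' x < delta.-1)%N.
    by apply: leq_ltn_trans dS'2 _; move: d5; clear; lia.
  have [||||||[clS' _]|[F [famF HF]]] := IH S' (x |: M) => //.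
  - rewrite subUset sub1set xS' /=; apply: subset_trans MSb _.
    by apply: setDS; apply: subsetDl.
  - move=> m /setU1P[->//|mM]; apply: leq_trans (M2 m mM); exact: degin_subset.
  - by have := cluster_degin e_irr clS' xS'; rewrite leqNgt nd.
  have xF : x \notin cover F.
    by apply/negP => /(cover_degin e_irr famF); rewrite leqNgt nd.
  right; exists F; split; first exact: cluster_family_mono famF.
  by rewrite (potential_mark e_sym e_irr delta_ge4 xb bS cl) // (family_cover famF).
set M' := M :&: S'.
have [F [famF HF]] : exists F, [/\ cfamily S F, cover F \subset S',
     (x \in cover F -> delta.-1 <= degin S' x)%N & al * #|F|%:R <= potential S' M' (cover F)].
  have [||||[clS' sS']|[F [famF HF]]] := IH S' M' _ cS' S'L => //.
  - exact: subsetIr.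
  - by move=> m /setIP[mM _]; apply: leq_trans (M2 m mM); apply: degin_subset.
  - by case/set0Pn => m /setIP[mM _]; apply: M5; apply/set0Pn; exists m.
  (* The rest is a whole cluster, but within [S] it is no longer alone: [x] has its last neighbour
     in [b] and becomes the free vertex. *)
  - have covS : cover [set S'] = S' by rewrite /cover big_set1.
    have dS' := cluster_degin e_irr clS' xS'.
    have d1 : degin S' x = delta.-1 /\ degin S x = delta.
      have := conn_degin_gt0 cb xb b2; move: dx dxle dS'.
      by move: (degin S x) (degin S' x) (degin b x) dp => p q r; clear; lia.
    exists [set S']; split.
    + split.
      * by move=> Z /set1P ->.
      * by move=> Z Z' /set1P -> /set1P ->; rewrite eqxx.
      * by move=> Z /set1P ->; exists x; case: d1 => d1 d1'; rewrite /outer d1.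
    + by rewrite covS.
    + by [].
    (* Vertices of a cluster have degree at least delta - 1, too large for a mark. *)
    + have -> : M' = set0.
        apply/setP => m; rewrite inE [RHS]inE; apply/andP => -[mM mS'].
        have := M2 m mM; rewrite leqNgt => /negP; apply.
        apply: leq_trans (degin_subset e m S'S).
        apply: leq_trans (cluster_degin e_irr clS' mS').
        by rewrite -ltnS prednK.
      rewrite covS /potential /gap setDv big_set0 !cards1 cards0.
      by have /andP[al1 _] := alpha_bounds delta_ge4; move: sS'; lra.
  - exists F; split=> //; first exact: cluster_family_mono famF.
      exact: family_cover famF.
    exact: cover_degin.
case: HF => FS' xF HF.
right; exists F; split=> //; apply: le_trans HF _.
apply: potential_leaf => //.
case: Hb => [cqb|]; [left|by right].
have ble := clique_le omega_le cqb.
have blt : (#|b| < delta)%N.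
  by rewrite ltn_neqAle ble andbT; apply: contra nbd => ->; rewrite cqb.
split=> // d5; rewrite ltn_neqAle -ltnS prednK // blt andbT.
by apply: contra nbd' => ->; rewrite cqb d5.
Qed.

(** [FA] holds the clusters with a free vertex, [FB] those that are components of their own; only
    the latter are charged four units. *)
Definition counted_by S (FA FB : {set {set T}}) :=
  [/\ forall Z, Z \in FA :|: FB -> cluster Z /\ Z \subset S,
      forall Z Z', Z \in FA :|: FB -> Z' \in FA :|: FB -> Z != Z' ->
        forall a b, a \in Z -> b \in Z' -> a != b /\ ~~ e a b,
      forall Z, Z \in FA -> exists v, [/\ v \in Z, outer Z v & degin S v = delta]
    & al * (#|FA|%:R + 4 * #|FB|%:R) <= sigma S - al * gap e S (cover (FA :|: FB))].

Lemma low_counted S : S \subset low -> exists FA FB, counted_by S FA FB.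
Proof.
move: {2}(#|S|) (leqnn #|S|) => n; elim: n S => [|n IH] S nS SL.
  move: nS; rewrite leqn0 cards_eq0 => /eqP ->; exists set0, set0; split.
  - by move=> Z; rewrite !inE.
  - by move=> Z Z'; rewrite !inE.
  - by move=> Z; rewrite !inE.
  by rewrite /sigma /gap /degsum !cards0 set0D !big_set0; lra.
case: (boolP (S == set0)) => [/eqP S0|S0]; first by apply: IH; rewrite S0 ?cards0 ?sub0set.
case: (boolP (conn S)) => cS.
  have [||| [clS sS]|[F [[F1 F2 F3] HF]]] := @conn_counted S set0 cS SL.
  - exact: sub0set.
  - by move=> m; rewrite inE.
  - by rewrite eqxx.
  - exists set0, [set S]; rewrite /counted_by set0U; split.
    + by move=> Z /set1P ->.
    + by move=> Z Z' /set1P -> /set1P ->; rewrite eqxx.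
    + by move=> Z; rewrite inE.
    + by rewrite /cover big_set1 /gap setDv big_set0 cards0 cards1; lra.
  - exists F, set0; rewrite /counted_by setU0; split=> //.
    by move: HF; rewrite /potential !cards0 mul0r addr0 mulr0 addr0.
have [A [AS A0 nA]] := conn_split S0 cS.
have As : A \subset S := proper_sub AS.
have [FA1 [FB1 [P1 P2 P3 P4]]] : exists FA FB, counted_by A FA FB.
  apply: IH; last exact: subset_trans SL.
  by rewrite -ltnS; apply: leq_trans nS; apply: proper_card.
have [FA2 [FB2 [Q1 Q2 Q3 Q4]]] : exists FA FB, counted_by (S :\: A) FA FB.
  apply: IH; last by apply: subset_trans SL; apply: subsetDl.
  rewrite -ltnS; apply: leq_trans nS; rewrite -[X in (_ < X)%N](cardsID A S).
  by rewrite -[X in (X < _)%N]add0n ltn_add2r card_gt0 (setIidPr As).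
exists (FA1 :|: FA2), (FB1 :|: FB2).
have defF : (FA1 :|: FA2) :|: (FB1 :|: FB2) = (FA1 :|: FB1) :|: (FA2 :|: FB2).
  by rewrite setUACA.
have sep a b : a \in A -> b \in S :\: A -> a != b /\ ~~ e a b.
  move=> aA /setDP[bS bA]; split; first by apply: contraNneq bA => <-.
  exact: nA.
have defS : S = A :|: (S :\: A) by rewrite -{1}(setID S A) (setIidPr As).
have dis : [disjoint A & S :\: A] by apply: disjoint_of_notin => y yA; rewrite inE yA.
have d1 v : v \in A -> degin S v = degin A v.
  move=> vA; rewrite {1}defS degin_setU // (_ : degin (S :\: A) v = 0)%N ?addn0 //.
  by apply: degin_eq0 => u uS; apply/negP => evu; have [_] := sep v u vA uS; rewrite evu.
have d2 v : v \in S :\: A -> degin S v = degin (S :\: A) v.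
  move=> vA; rewrite {1}defS degin_setU // (_ : degin A v = 0)%N //.
  by apply: degin_eq0 => u uS; apply/negP => evu; have [_] := sep u v uS vA; rewrite e_sym evu.
have P3' Z : Z \in FA1 -> exists v, [/\ v \in Z, outer Z v & degin S v = delta].
  move=> ZF; have [v [vZ ov dv]] := P3 Z ZF; exists v; split=> //; rewrite d1 //.
  by have [|_ ZA] := P1 Z; [rewrite inE ZF|apply: (subsetP ZA)].
have Q3' Z : Z \in FA2 -> exists v, [/\ v \in Z, outer Z v & degin S v = delta].
  move=> ZF; have [v [vZ ov dv]] := Q3 Z ZF; exists v; split=> //; rewrite d2 //.
  by have [|_ ZA] := Q1 Z; [rewrite inE ZF|apply: (subsetP ZA)].
rewrite /counted_by defF; move: (FA1 :|: FB1) (FA2 :|: FB2) P1 P2 P4 Q1 Q2 Q4 {defF} => F1 F2 P1 P2 P4 Q1 Q2 Q4.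
have cov1 : cover F1 \subset A by apply/bigcupsP => Z /P1[].
have cov2 : cover F2 \subset S :\: A by apply/bigcupsP => Z /Q1[].
split.
- move=> Z /setUP[/P1[clZ ZA]|/Q1[clZ ZA]]; split=> //; first exact: subset_trans As.
  by apply: subset_trans ZA (subsetDl _ _).
- move=> Z Z' /setUP[ZF|ZF] /setUP[ZF'|ZF'] ZZ a b aZ bZ.
  + exact: P2 ZZ a b aZ bZ.
  + have [_ ZA] := P1 Z ZF; have [_ ZA'] := Q1 Z' ZF'.
    by apply: sep; [apply: (subsetP ZA)|apply: (subsetP ZA')].
  + have [_ ZA] := Q1 Z ZF; have [_ ZA'] := P1 Z' ZF'.
    by rewrite eq_sym e_sym; apply: sep; [apply: (subsetP ZA')|apply: (subsetP ZA)].
  + exact: Q2 ZZ a b aZ bZ.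
- by move=> Z /setUP[/P3'|/Q3'].
have sigE : sigma S = sigma A + sigma (S :\: A).
  have s1 : (\sum_(v in A) degin (S :\: A) v = 0)%N.
    rewrite big1 // => v vA; have := d1 v vA; rewrite {1}defS degin_setU //.
    by move: (degin A v) => p; clear; lia.
  have s2 : (\sum_(v in S :\: A) degin A v = 0)%N.
    rewrite big1 // => v vA; have := d2 v vA; rewrite {1}defS degin_setU //.
    by move: (degin (S :\: A) v) => p; clear; lia.
  rewrite {1}defS /sigma degsum_setU // s1 s2 cardsU.
  rewrite (eqP (_ : A :&: (S :\: A) == set0)) ?setI_eq0 // cards0 subn0 !addn0 !natrD.
  by ring.
have gapE : gap e S (cover (F1 :|: F2)) = gap e A (cover F1) + gap e (S :\: A) (cover F2).
  have covU : cover (F1 :|: F2) = cover F1 :|: cover F2.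
    by rewrite /cover bigcup_setU.
  rewrite /gap covU (big_setID A) /=; congr (_ + _).
    apply: eq_big => [v|v /setIP[_ vA]]; last by rewrite d1.
    rewrite !inE; case: (boolP (v \in A)) => vA; rewrite ?andbF // (subsetP As) // !andbT.
    case: (boolP (v \in cover F2)) => [/(subsetP cov2)|_]; last by rewrite orbF.
    by rewrite inE vA.
  apply: eq_big => [v|v /setDP[/setDP[vS _] vA]]; last by rewrite d2 // inE vA.
  rewrite !inE; case: (boolP (v \in A)) => vA; rewrite ?andbF //=.
  case: (boolP (v \in cover F1)) => [/(subsetP cov1)|_] //; by rewrite (negPf vA).
rewrite sigE gapE.
have c1 : #|FA1 :|: FA2|%:R <= #|FA1|%:R + #|FA2|%:R :> rat.
  by rewrite -natrD ler_nat -cardsUI leq_addr.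
have c2 : #|FB1 :|: FB2|%:R <= #|FB1|%:R + #|FB2|%:R :> rat.
  by rewrite -natrD ler_nat -cardsUI leq_addr.
have /andP[al1 al2] := alpha_bounds delta_ge4.
move: P4 Q4 c1 c2.
move: (sigma A) (sigma _) (gap _ _ _) (gap _ _ _) (#|FA1|%:R : rat) (#|FA2|%:R : rat)
  (#|FB1|%:R : rat) (#|FB2|%:R : rat) (#|FA1 :|: FA2|%:R : rat) (#|FB1 :|: FB2|%:R : rat).
move=> s1 s2 g1 g2 a1 a2 b1 b2 a b; nra.
Qed.

End CountingInduction.

(** * Products of linear forms *)

Section Product.
Variables (T : finType) (e : rel T).
Hypotheses (e_sym : symmetric e) (e_irr : irreflexive e).
Hypothesis (G_irred : AT_irreducible e).
Implicit Types (S K Z : {set T}) (v w : T) (s : seq T) (t : {ffun T -> int}).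

Notation low := (low e).
Notation degin := (degin e).
Notation delta := (min_degree e).

Lemma coefg_neq0 (E : seq (T * T)) : (forall p, p \in E -> p.1 != p.2) ->
  exists t, coefg E t != 0.
Proof.
elim: E => [|p E IH] HE; first by exists 0; rewrite /= eqxx.
have [|t ct] := IH; first by move=> q qE; apply: HE; rewrite inE qE orbT.
have p12 := HE p (mem_head _ _).
pose b (u : T) : int := (u == p.1)%:R - (u == p.2)%:R.
have bp : b p.1 != 0 by rewrite /b eqxx (negPf p12).
have [|t' Ht'] := @linear_form_neq0 _ (coefg E) (size E) b p.1 t _ bp ct.
  move=> t' ct' v; have [|/andP[_ H] _] := @coefg_support _ setT E t' _ ct' v.
    by move=> q _; rewrite !inE.
  by apply: le_trans H _; rewrite lez_nat count_size.
exists t'; move: Ht' => /=; congr (_ != 0).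
rewrite (bigD1 p.1) //= (bigD1 p.2) 1?eq_sym //= big1 ?addr0 => [|u /andP[/negPf u1 /negPf u2]].
  by rewrite /b !eqxx (eq_sym p.2) (negPf p12) /=; ring.
by rewrite /b u1 u2 subrr mul0r.
Qed.

Lemma count_edges s v : uniq s ->
  (count (fun p => (p.1 == v) || (p.2 == v)) (edges e s) <= degin (sset s) v)%N.
Proof.
elim: s => //= w s IH /andP[ws us]; rewrite count_cat sset_cons degin_setU1 ?inE //.
rewrite count_map.
case: (v =P w) => [->|/eqP vw].
  rewrite (_ : count _ (edges e s) = 0)%N; last first.
    apply/eqP; rewrite eqn0Ngt -has_count; apply/hasPn => p /mem_edges[p1 p2 _].
    rewrite negb_or; apply/andP; split; [apply: contraTneq p1|apply: contraTneq p2];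
      by move=> ->.
  rewrite addn0 e_irr add0n; apply: leq_trans (count_size _ _) _.
  rewrite -(card_uniqP (filter_uniq _ us)); apply: subset_leq_card.
  by apply/subsetP => n; rewrite mem_filter !inE e_sym => /andP[-> ->].
apply: leq_add (IH us).
rewrite (@eq_count _ _ (pred1 v)) => [|n /=]; last first.
  by rewrite [w == v]eq_sym (negPf vw) orbF.
rewrite count_uniq_mem ?filter_uniq // mem_filter.
by case: (e v w) => //=; case: (_ \in _).
Qed.

Lemma edge_list_cat (A B : {set T}) (M E1 E2 : seq (T * T)) : [disjoint A & B] ->
  edge_list (restr e A) E1 -> edge_list (restr e B) E2 -> uniq M ->
  (forall a b, ((a, b) \in M) = [&& a \in A, b \in B & e a b]) ->
  edge_list (restr e (A :|: B)) (M ++ E1 ++ E2).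
Proof.
move=> dis [u1 r1 a1] [u2 r2 a2] uM mM.
have AB x : x \in A -> (x \in B) = false by move=> xA; apply: disjointFr dis xA.
have BA x : x \in B -> (x \in A) = false by move=> xB; apply: disjointFl dis xB.
have E1A a b : (a, b) \in E1 -> a \in A /\ b \in A.
  by move=> H; have := r1 a b; rewrite H /restr /= => /and3P[].
have E2B a b : (a, b) \in E2 -> a \in B /\ b \in B.
  by move=> H; have := r2 a b; rewrite H /restr /= => /and3P[].
split.
- rewrite !cat_uniq uM u1 u2 !andbT /=; apply/andP; split; apply/hasPn => -[a b].
    rewrite mem_cat mM => /orP[/E1A[aA bA]|/E2B[aB bB]].
      by rewrite (AB _ bA) andbF.
    by rewrite (BA _ aB).
  by move=> /E2B[aB bB]; apply/negP => /E1A[aA _]; rewrite (AB _ aA) in aB.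
- move=> u v; rewrite !mem_cat.
  have bool6 (x y z x' y' z' : bool) :
      (x || (y || z)) || (x' || (y' || z')) = (x || x') || ((y || y') || (z || z')).
    by case: x; case: y; case: z; case: x'; case: y'; case: z'.
  rewrite bool6 -r1 -r2 !mM /restr /= !inE (e_sym v u).
  have := AB u; have := AB v; have := BA u; have := BA v.
  case: (u \in A); case: (v \in A); case: (u \in B); case: (v \in B); case: (e u v) => //=;
    by do ?[move=> /(_ isT)// | move=> _].
- move=> u v; rewrite !mem_cat; apply/negP => /andP[/or3P[H1|H1|H1] /or3P[H2|H2|H2]].
  + by move: H1 H2; rewrite !mM => /and3P[uA _ _] /and3P[_ uB _]; rewrite (AB _ uA) in uB.
  + by move: H1; rewrite mM => /and3P[_ vB _]; have [vA _] := E1A _ _ H2; rewrite (AB _ vA) in vB.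
  + by move: H1; rewrite mM => /and3P[uA _ _]; have [_ uB] := E2B _ _ H2; rewrite (AB _ uA) in uB.
  + by move: H2; rewrite mM => /and3P[_ uB _]; have [uA _] := E1A _ _ H1; rewrite (AB _ uA) in uB.
  + by have := a1 u v; rewrite H1 H2.
  + by have [uA _] := E1A _ _ H1; have [_ uB] := E2B _ _ H2; rewrite (AB _ uA) in uB.
  + by move: H2; rewrite mM => /and3P[vA _ _]; have [_ vB] := E2B _ _ H1; rewrite (AB _ vA) in vB.
  + by have [uB _] := E2B _ _ H1; have [_ uA] := E1A _ _ H2; rewrite (AB _ uA) in uB.
  + by have := a2 u v; rewrite H1 H2.
Qed.

Section Forms.
Variables (Y : {set T}) (F : {set {set T}}) (ord : {set T} -> seq T).
Hypothesis F_ord : forall Z, Z \in F -> search e (ord Z) /\ sset (ord Z) = Z.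
Hypothesis F_low : forall Z, Z \in F -> Z \subset low.
Hypothesis F_sep : forall Z Z', Z \in F -> Z' \in F -> Z != Z' ->
  forall a b, a \in Z -> b \in Z' -> a != b /\ ~~ e a b.
Hypothesis Y_deg : forall y, y \in Y -> degree e y = delta.+1.

(** Up to sign, the coefficient of the variable of [y] in the linear form of [Z]. *)
Definition yform Z y : int := (y \in Y)%:R * \sum_(v <- ord Z | e v y) eps e (ord Z) v.

Definition cross_edges Z : seq (T * T) :=
  [seq (v, y) | v <- ord Z, y <- [seq y <- enum Y | e v y]].

Definition all_edges (zs : seq {set T}) : seq (T * T) :=
  foldr (fun Z E => cross_edges Z ++ edges e (ord Z) ++ E) (edges e (enum Y)) zs.

(** On every cluster the exponents add up to one less than the number of factors touching it, so
    exactly one edge from the cluster to [Y] must contribute its end in [Y]. *)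
Definition target (zs : seq {set T}) : {ffun T -> int} :=
  \sum_(Z <- zs) (outs e (ord Z) + \sum_(p <- cross_edges Z) unitv p.1).

(* The coefficients of the product of the forms and of the graph polynomial of
   [Y], up to sign. *)
Fixpoint form_prod (zs : seq {set T}) t : int :=
  if zs is Z :: zs' then - \sum_y yform Z y * form_prod zs' (t - unitv y)
  else coefg (edges e (enum Y)) t.

Definition covers (zs : seq {set T}) : {set T} := [set x | has (fun Z : {set T} => x \in Z) zs].

Lemma subset_cons Z zs : {subset Z :: zs <= F} -> Z \in F /\ {subset zs <= F}.
Proof. by move=> zF; split=> [|W Wz]; apply: zF; rewrite inE ?eqxx ?Wz ?orbT. Qed.

Lemma mem_ord Z x : Z \in F -> (x \in ord Z) = (x \in Z).
Proof. by move=> ZF; have [_ {2}<-] := F_ord ZF; rewrite inE. Qed.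

Lemma Y_notin_Z Z y : Z \in F -> y \in Y -> y \notin Z.
Proof.
move=> ZF yY; apply/negP => yZ; have := Y_deg yY.
by rewrite (degree_low (subsetP (F_low ZF) y yZ)) => /eqP; rewrite ltn_eqF.
Qed.

Lemma mem_cross Z a b : Z \in F -> ((a, b) \in cross_edges Z) = [&& a \in Z, b \in Y & e a b].
Proof.
move=> ZF; apply/allpairsPdep/and3P => [[x [y []]]|[aZ bY eab]].
  by rewrite mem_filter mem_enum mem_ord // => xZ /andP[exy yY] [-> ->].
by exists a, b; rewrite mem_filter mem_enum mem_ord // eab.
Qed.

Lemma uniq_cross Z : Z \in F -> uniq (cross_edges Z).
Proof.
move=> ZF; apply: allpairs_uniq_dep.
- by have [srch _] := F_ord ZF; apply: search_uniq srch.
- by move=> v _; apply: filter_uniq; apply: enum_uniq.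
- by move=> [a b] [c d] _ _ /= [-> ->].
Qed.

Lemma all_edges_in zs p : {subset zs <= F} -> p \in all_edges zs ->
  p.1 \in Y :|: covers zs /\ p.2 \in Y :|: covers zs.
Proof.
elim: zs => [|Z zs IH] zF /=.
  by move=> /mem_edges[]; rewrite !mem_enum !inE => -> ->.
have [ZF zF'] := subset_cons zF.
rewrite !mem_cat => /or3P[|/mem_edges[]|/(IH zF')].
- by case: p {IH} => a b; rewrite mem_cross // => /and3P[aZ bY _]; rewrite !inE /= aZ bY orbT.
- by rewrite !mem_ord // !inE /= => -> ->; rewrite !orbT.
- by rewrite !inE /= => -[/orP[->|->] /orP[->|->]]; rewrite ?orbT.
Qed.

Lemma covers_disjoint Z zs x : {subset Z :: zs <= F} -> Z \notin zs -> x \in Z ->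
  x \notin Y :|: covers zs.
Proof.
move=> zF Zz xZ; have ZF : Z \in F by apply: zF; rewrite mem_head.
rewrite !inE negb_or; apply/andP; split.
  by apply: contraTN xZ; apply: Y_notin_Z.
apply/hasPn => W Wz; apply/negP => xW.
have WF : W \in F by apply: zF; rewrite inE Wz orbT.
have ZW : Z != W by apply: contraNneq Zz => ->.
by have [] := F_sep ZF WF ZW xZ xW; rewrite eqxx.
Qed.

Lemma target_notin zs x : {subset zs <= F} -> x \notin covers zs -> target zs x = 0.
Proof.
rewrite /target; elim: zs => [|Z zs IH] zF; first by rewrite big_nil ffunE.
rewrite !inE /= negb_or => /andP[xZ xzs]; rewrite big_cons ffunE.
have ZF : Z \in F by apply: zF; rewrite mem_head.
rewrite IH ?inE // => [|W Wz]; last by apply: zF; rewrite inE Wz orbT.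
rewrite addr0 ffunE outs_notin ?mem_ord // add0r sum_ffunE big_seq big1 // => -[a b].
rewrite mem_cross // => /and3P[aZ _ _]; rewrite ffunE; case: eqP => // xa.
by rewrite xa aZ in xZ.
Qed.

Lemma coefg_all_edges zs t : uniq zs -> {subset zs <= F} ->
  (forall v, v \notin Y -> t v = 0) ->
  coefg (all_edges zs) (target zs + t) = form_prod zs t.
Proof.
elim: zs t => [|Z zs IH] t /= uz zF tY.
  by rewrite /target big_nil add0r.
case/andP: uz => Zz uz.
have [ZF zF'] := subset_cons zF.
have [srch defZ] := F_ord ZF.
set M := cross_edges Z.
have HM : crossing Z M.
  by case=> a b; rewrite mem_cross // => /and3P[aZ bY _]; split=> //; apply: Y_notin_Z.
have inZ p : p \in edges e (ord Z) -> p.1 \in Z /\ p.2 \in Z.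
  by move=> /mem_edges[]; rewrite !mem_ord.
have outZ p : p \in all_edges zs -> p.1 \notin Z /\ p.2 \notin Z.
  move=> /(all_edges_in zF')[p1 p2].
  by split; [apply: contraTN p1|apply: contraTN p2]; apply: covers_disjoint.
have HE : split_edges Z (edges e (ord Z) ++ all_edges zs).
  move=> p; rewrite mem_cat => /orP[/inZ[-> ->]//|/outZ[/negPf -> /negPf ->]//].
have nin : num_inside Z (edges e (ord Z) ++ all_edges zs) = size (edges e (ord Z)).
  rewrite /num_inside count_cat [X in (_ + X)%N](_ : _ = 0)%N ?addn0.
    by apply/eqP; rewrite -all_count; apply/allP => p /inZ[].
  apply/eqP; rewrite eqn0Ngt -has_count; apply/hasPn => p /outZ[p1 _]; exact: p1.
have tZ v : v \in Z -> t v = 0.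
  by move=> vZ; apply: tY; apply: contraTN vZ; apply: Y_notin_Z.
have targZ v : v \in Z -> target zs v = 0.
  move=> vZ; apply: target_notin => //.
  by have := covers_disjoint zF Zz vZ; rewrite inE negb_or => /andP[].
have wM : weight Z (\sum_(p <- M) unitv p.1) = (size M)%:Z.
  rewrite weight_sum (eq_big_seq (fun=> 1)) => [|p /HM[p1 _]].
    by rewrite big_const_seq count_predT iter_addr_0 natz.
  by rewrite weight_unitv p1.
have defT : target (Z :: zs) = outs e (ord Z) + \sum_(p <- M) unitv p.1 + target zs.
  by rewrite /target big_cons.
rewrite defT (coefg_cross_but1 HM HE); last first.
  rewrite !weightD weight_outs // => [|x]; last by rewrite mem_ord.
  have w1 : weight Z (target zs) = 0 by rewrite /weight big1.
  have w2 : weight Z t = 0 by rewrite /weight big1.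
  by rewrite wM nin w1 w2 PoszD; ring.
congr (- _).
(* An exceptional edge [(a, b)] leaves the exponents [outs + unitv a] on [Z], with coefficient
   [eps a] by [coefg_search], and consumes one unit at [b]. *)
transitivity (\sum_(p <- M) eps e (ord Z) p.1 * form_prod zs (t - unitv p.2)).
  rewrite big_seq [RHS]big_seq; apply: eq_bigr => -[a b]; rewrite mem_cross //=.
  case/and3P => aZ bY eab; rewrite -coefg_search ?mem_ord // -IH //; last first.
    move=> v vY; rewrite !ffunE tY //; case: eqP => [vb|_]; last by rewrite subr0.
    by rewrite vb bY in vY.
  rewrite -(coefg_disjoint inZ outZ).
  - congr coefg; set Q := \sum_(_ <- _) _; apply/ffunP => v.
    by rewrite !ffunE; ring.
  - move=> v vZ; rewrite !ffunE outs_notin ?mem_ord // add0r.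
    by case: eqP => // va; rewrite va aZ in vZ.
  - move=> v vZ; rewrite ffunE targZ // add0r !ffunE tZ // sub0r.
    case: eqP => [vb|_]; last by rewrite oppr0.
    by have := Y_notin_Z ZF bY; rewrite -vb vZ.
rewrite big_allpairs_dep /=.
under eq_bigr => v _ do rewrite big_filter big_enum_cond /= big_mkcondr.
rewrite exchange_big /= [RHS](bigID (fun y => y \in Y)) /= [X in _ = _ + X]big1 ?addr0; last first.
  by move=> y /negPf yY; rewrite /yform yY mul0r mul0r.
apply: eq_bigr => y yY; rewrite /yform yY mul1r mulr_suml [RHS]big_mkcond.
by apply: eq_bigr => v _; case: (e v y).
Qed.

Lemma form_mem Z y : yform Z y != 0 -> y \in Y.
Proof. by rewrite /yform; case: (y \in Y) => //; rewrite mul0r eqxx. Qed.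

Lemma sset_enum (A : {set T}) : sset (enum A) = A.
Proof. by apply/setP => x; rewrite inE mem_enum. Qed.

Lemma form_prod_support zs t : form_prod zs t != 0 -> forall v,
  (v \notin Y -> t v = 0) /\
  t v <= (degin Y v + count (fun Z => yform Z v != 0) zs)%:Z.
Proof.
elim: zs t => [|Z zs IH] t /= ft v.
  have [|/andP[_ H] H'] := @coefg_support _ Y _ t _ ft v.
    by move=> p /mem_edges[]; rewrite !mem_enum.
  split=> //; apply: le_trans H _; rewrite addn0 lez_nat.
  by have := @count_edges (enum Y) v (enum_uniq _); rewrite sset_enum.
have [y] : exists y, yform Z y * form_prod zs (t - unitv y) != 0.
  apply/existsP; apply: contraNT ft => /existsPn H.
  by rewrite oppr_eq0 big1 // => y _; have := H y; rewrite negbK => /eqP.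
rewrite mulf_eq0 negb_or => /andP[fy /IH/(_ v)]; rewrite !ffunE => -[H1 H2].
have yY := form_mem fy; split.
  move=> vY; have := H1 vY; case: eqP => [vy|_]; last by rewrite subr0.
  by rewrite vy yY in vY.
move: H2; case: (v =P y) => [->|_]; first by rewrite fy /=; move: (t y) (count _ _) (degin Y y) => a b c; clear; lia.
by move: (t v) (count _ _) (degin Y v) (yform Z v != 0) => a b c f; clear; case: f => /=; lia.
Qed.

Lemma form_prod_neq0 zs : (forall Z, Z \in zs -> exists y, yform Z y != 0) ->
  exists t, form_prod zs t != 0.
Proof.
elim: zs => [|Z zs IH] Hz /=.
  by apply: coefg_neq0 => p /mem_edges[_ _]; apply: contraTneq => ->; rewrite e_irr.
have [|t ft] := IH; first by move=> W Wz; apply: Hz; rewrite inE Wz orbT.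
have [y fy] := Hz Z (mem_head _ _).
have [|t' Ht'] := @linear_form_neq0 _ (form_prod zs) (#|T| + size zs) (yform Z) y t _ fy ft.
  move=> t' ft' v; have [_ H] := form_prod_support ft' v; apply: le_trans H _.
  by rewrite lez_nat leq_add ?max_card ?count_size.
by exists t'; rewrite oppr_eq0.
Qed.

Lemma edge_list_all zs : uniq zs -> {subset zs <= F} ->
  edge_list (restr e (Y :|: covers zs)) (all_edges zs).
Proof.
elim: zs => [|Z zs IH] /=.
  move=> _ _; rewrite (_ : covers [::] = set0) ?setU0; last by apply/setP => x; rewrite !inE.
  by rewrite -{1}(sset_enum Y); apply: edge_list_edges => //; apply: enum_uniq.
case/andP => Zz uz zF.
have [ZF zF'] := subset_cons zF.
have [srch defZ] := F_ord ZF.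
rewrite (_ : Y :|: covers (Z :: zs) = Z :|: (Y :|: covers zs)); last first.
  by apply/setP => x; rewrite !inE /= orbCA.
apply: edge_list_cat.
- rewrite -setI_eq0; apply/eqP/setP => x; rewrite inE [RHS]inE; apply/andP => -[xZ].
  exact/negP/(covers_disjoint zF Zz xZ).
- by rewrite -{1}defZ; apply: edge_list_edges => //; apply: search_uniq srch.
- exact: IH.
- exact: uniq_cross.
- move=> a b; rewrite mem_cross // !inE; case: (boolP (a \in Z)) => //= aZ.
  case: (boolP (b \in Y)) => //= bY; symmetry; apply/andP => -[/hasP[W Wz bW] eab].
  have ZW : Z != W by apply: contraNneq Zz => ->.
  by have [_] := F_sep ZF (zF' W Wz) ZW aZ bW; rewrite eab.
Qed.

Lemma sum_cross_le Z v : Z \in F ->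
  (\sum_(p <- cross_edges Z) unitv p.1) v <= (degin Y v)%:Z.
Proof.
move=> ZF; rewrite sum_ffunE.
rewrite (eq_bigr (fun p => (p.1 == v)%:R)); last by move=> p _; rewrite ffunE eq_sym.
rewrite -natr_sum.
rewrite (_ : (\sum_(p <- cross_edges Z) (p.1 == v))%N = count (fun p => p.1 == v) (cross_edges Z)); last first.
  by rewrite -sum1_count [RHS]big_mkcond; apply: eq_bigr => p _; case: (_ == _).
rewrite natz lez_nat -size_filter.
have uf : uniq [seq p.2 | p <- cross_edges Z & p.1 == v].
  rewrite map_inj_in_uniq ?filter_uniq ?uniq_cross // => -[a b] [c d].
  by rewrite !mem_filter /= => /andP[/eqP -> _] /andP[/eqP -> _] ->.
rewrite -(size_map snd) -(card_uniqP uf); apply: subset_leq_card; apply/subsetP => y.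
case/mapP => -[a b]; rewrite mem_filter mem_cross // => /andP[/eqP /= -> /and3P[_ bY eab]] ->.
by rewrite inE bY.
Qed.

Lemma target_le zs Z v : uniq zs -> {subset zs <= F} -> Z \in zs -> v \in Z ->
  target zs v <= (degin Z v + degin Y v)%:Z - 1.
Proof.
move=> uz zF Zz vZ; have ZF := zF Z Zz; have [srch defZ] := F_ord ZF.
rewrite /target sum_ffunE (bigD1_seq Z) //= [X in _ + X]big_seq_cond [X in _ + X]big1 ?addr0; last first.
  move=> W /andP[Wz WZ]; have WF := zF W Wz.
  have vW : v \notin W.
    by apply/negP => vW; have [] := F_sep WF ZF WZ vW vZ; rewrite eqxx.
  rewrite ffunE outs_notin ?mem_ord // add0r sum_ffunE big_seq big1 // => -[a b].
  rewrite mem_cross // => /and3P[aW _ _]; rewrite ffunE; case: eqP => // va.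
  by rewrite va aW in vW.
have vo : v \in ord Z by rewrite mem_ord.
have := outs_le e_sym e_irr srch vo; rewrite defZ; have := sum_cross_le v ZF.
rewrite ffunE; move: (outs _ _ _) (\sum_(_ <- _) _) (degin Z v) (degin Y v) => a b c d'.
by move: (b v) => b'; clear; lia.
Qed.

(** The product of the forms has a nonzero monomial. At [y] its exponent is at most the degree in
    [Y] plus the number of forms containing [y]. The 2 in the hypothesis covers the strict
    inequality required by [AT] and the degree delta + 1 of [y]. On the clusters [target] is small
    enough by itself. *)
Lemma forms_contradiction : Y != set0 ->
  (forall Z, Z \in F -> exists y, yform Z y != 0) ->
  (forall y, y \in Y ->
     (#|[set Z in F | yform Z y != 0%R]| + 2 <= degin (cover F) y)%N) -> False.
Proof.
move=> Y0 nz cap; set zs := enum F.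
have uz : uniq zs := enum_uniq _.
have zF : {subset zs <= F} by move=> Z; rewrite mem_enum.
have defC : covers zs = cover F.
  apply/setP => x; rewrite inE; apply/hasP/bigcupP => -[Z ZF xZ]; exists Z => //.
    exact: zF.
  by rewrite mem_enum.
have [|t ft] := @form_prod_neq0 zs; first by move=> Z /zF; apply: nz.
have sup := form_prod_support ft.
have tY v : v \notin Y -> t v = 0 by case: (sup v).
have dis : [disjoint Y & cover F].
  rewrite -setI_eq0; apply/eqP/setP => x; rewrite inE [RHS]inE; apply/andP => -[xY].
  by case/bigcupP => Z ZF; apply/negP; apply: Y_notin_Z.
apply: (@irreducible_coefg _ e (Y :|: covers zs) (all_edges zs) (target zs + t)) => //.
- by case/set0Pn: Y0 => y yY; apply/set0Pn; exists y; rewrite inE yY.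
- exact: edge_list_all.
- by rewrite coefg_all_edges.
rewrite defC => v; rewrite inE degin_setU // => /orP[vY|/bigcupP[Z ZF vZ]].
  have [_] := sup v; rewrite ffunE target_notin //; last first.
    by rewrite defC; rewrite (disjointFr dis vY).
  have := cap v vY; rewrite (Y_deg vY).
  have -> : count (fun Z => yform Z v != 0) zs = #|[set Z in F | yform Z v != 0]|.
    rewrite -size_filter -(card_uniqP (filter_uniq _ uz)); apply: eq_card => Z.
    by rewrite mem_filter inE mem_enum andbC.
  by move: (t v) #|_| (degin Y v) (degin _ v) delta => a b c d' f; clear; lia.
rewrite ffunE tY ?addr0; last by apply: contraTN vZ; apply: Y_notin_Z.
rewrite (degree_low (subsetP (F_low ZF) v vZ)).
have Zz : Z \in zs by rewrite mem_enum.
have := target_le uz zF Zz vZ.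
have : (degin Z v <= degin (cover F) v)%N by apply: degin_subset; apply: bigcup_sup.
by move: (target zs v) (degin Z v) (degin Y v) (degin _ v) delta => a b c d' f; clear; lia.
Qed.

End Forms.

End Product.

(** * Balanced orientations *)

Section Balanced.
Variable I : finType.

Lemma abs_le1_eq (x y : int) : x = y -> -1 <= x <= 1 -> -1 <= y <= 1.
Proof. by move=> ->. Qed.

(* Every multigraph has an orientation in which in- and outdegrees differ by at
   most one: split off two edges at a common end, replacing them by one. *)
Lemma balanced_signs (N : eqType) (A : {set I}) (s t : I -> N) : exists o : I -> int,
  (forall i, o i = 1 \/ o i = -1) /\
  forall n, -1 <= \sum_(i in A) o i * ((s i == n)%:R - (t i == n)%:R) <= 1.
Proof.
move: {2}(#|A|) (leqnn #|A|) => k; elim: k A s t => [|k IH] A s t.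
  rewrite leqn0 cards_eq0 => /eqP ->; exists (fun=> 1); split; first by left.
  by move=> n; rewrite big_set0.
move=> Ak.
case: (boolP [exists i in A, exists j in A, (i != j) &&
    [|| s i == s j, s i == t j, t i == s j | t i == t j]]) => [|nsh].
  case/existsP => i /andP[iA /existsP[j /andP[jA /andP[ij sh]]]].
  have [c [p [q [c1 Hc]]]] : exists c : int, exists p q, (c = 1 \/ c = -1) /\ forall n,
      ((s i == n)%:R - (t i == n)%:R) + c * ((s j == n)%:R - (t j == n)%:R)
      = (p == n)%:R - (q == n)%:R :> int.
    case/or4P: sh => /eqP ->.
    - by exists (-1), (t j), (t i); split; [right|move=> n; ring].
    - by exists 1, (s j), (t i); split; [left|move=> n; ring].
    - by exists 1, (s i), (t j); split; [left|move=> n; ring].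
    - by exists (-1), (s i), (s j); split; [right|move=> n; ring].
  pose s' x := if x == i then p else s x; pose t' x := if x == i then q else t x.
  have [|o [o1 Ho]] := IH (A :\ j) s' t'.
    by rewrite -ltnS; apply: leq_trans Ak; rewrite [X in (_ < X)%N](cardsD1 j) jA.
  exists (fun x => if x == j then c * o i else o x); split.
    move=> x; case: eqP => // _.
    by case: c1 (o1 i) => -> [] ->; [left|right|right|left].
  move=> n; have := Ho n; rewrite (bigD1 i) /=; last by rewrite !inE ij.
  rewrite [X in _ -> -1 <= X <= 1](bigD1 j) //= eqxx.
  rewrite [X in _ -> -1 <= _ + X <= 1](bigD1 i) /=; last by rewrite iA ij.
  rewrite (negPf ij) /s' /t' eqxx -Hc.
  rewrite (eq_bigr (fun x => o x * ((s x == n)%:R - (t x == n)%:R))); last first.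
    by move=> x /andP[_ /negPf ->].
  rewrite [X in _ -> -1 <= _ + (_ + X) <= 1](eq_bigr (fun x => o x * ((s x == n)%:R - (t x == n)%:R))); last first.
    by move=> x /andP[/andP[_ /negPf ->] _].
  rewrite (eq_bigl (fun x => (x \in A) && (x != j) && (x != i))); last first.
    by move=> x; rewrite !inE; congr (_ && _); rewrite andbC.
  move: (\sum_(_ | _) _) => z; apply: abs_le1_eq; ring.
exists (fun=> 1); split; first by left.
move=> n.
case: (boolP [exists i in A, (s i == n) || (t i == n)]) => [/existsP[i /andP[iA Hi]]|Hn].
  rewrite (bigD1 i) //= big1 => [|j /andP[jA ji]].
    by case: (s i == n); case: (t i == n).
  have := nsh; rewrite negb_exists => /forallP/(_ i); rewrite iA /= negb_exists => /forallP/(_ j).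
  rewrite jA /= eq_sym ji /= !negb_or => /and4P[h1 h2 h3 h4].
  case: (s j =P n) => [sj|_]; first by rewrite sj in h1 h3; case/orP: Hi => H; rewrite H in h1 h3.
  case: (t j =P n) => [tj|_]; first by rewrite tj in h2 h4; case/orP: Hi => H; rewrite H in h2 h4.
  by rewrite subrr mulr0.
rewrite big1 // => i iA; move: Hn; rewrite negb_exists => /forallP/(_ i).
by rewrite iA /= negb_or => /andP[/negPf -> /negPf ->]; rewrite subrr mulr0.
Qed.

Definition balanced (N : eqType) (R : {set I}) (f : I -> N) (o : I -> int) :=
  forall n, -1 <= \sum_(i in R | f i == n) o i <= 1.

(** Elements of [R] are edges of a bipartite multigraph with ends [f] and [g]. A parallel pair
    receives opposite signs and cancels at both ends. There are no triples, so after removing all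
    pairs the condition on parallel edges is void. *)
Lemma balanced_selection (N1 N2 : eqType) (R : {set I}) (f : I -> N1) (g : I -> N2) :
  (forall a b c, a \in R -> b \in R -> c \in R -> a != b -> a != c -> b != c ->
     f a = f b -> f a = f c -> g a = g b -> g a = g c -> False) ->
  exists o : I -> int, [/\ forall i, o i = 1 \/ o i = -1,
    balanced R f o, balanced R g o &
    forall a b, a \in R -> b \in R -> a != b -> f a = f b -> g a = g b -> o a = - o b].
Proof.
move: {2}(#|R|) (leqnn #|R|) => k; elim: k R => [|k IH] R.
  rewrite leqn0 cards_eq0 => /eqP -> _; exists (fun=> 1); split.
  - by left.
  - by move=> n; rewrite big_pred0 // => i; rewrite inE.
  - by move=> n; rewrite big_pred0 // => i; rewrite inE.
  - by move=> a b; rewrite inE.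
move=> Rk mult.
case: (boolP [exists a in R, exists b in R, [&& a != b, f a == f b & g a == g b]]) => [|npar].
  case/existsP => a /andP[aR /existsP[b /andP[bR /and3P[ab /eqP fab /eqP gab]]]].
  have [||o [o1 of_ og op]] := IH (R :\ a :\ b).
  - rewrite -ltnS; apply: leq_trans Rk; apply: proper_card; apply/properP; split.
      by apply/subsetP => x; rewrite !inE => /and3P[].
    by exists a; rewrite // !inE eqxx andbF.
  - by move=> x y z; rewrite !inE => /and3P[_ _ xR] /and3P[_ _ yR] /and3P[_ _ zR]; apply: mult.
  have bal (N : eqType) (h : I -> N) : h a = h b -> balanced (R :\ a :\ b) h o ->
      balanced R h (fun x => if x == a then 1 else if x == b then -1 else o x).
    move=> hab H n; have := H n.
    rewrite (bigID (fun i => (i == a) || (i == b))) /=.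
    rewrite [X in _ -> -1 <= X <= 1](bigID (fun i => (i == a) || (i == b))) /=.
    rewrite [X in -1 <= X + _ <= 1 -> _]big1 ?add0r => [|x]; last first.
      by rewrite !inE => /andP[/andP[/and3P[/negPf -> /negPf ->]]].
    have -> : \sum_(i | (i \in R) && (h i == n) && ((i == a) || (i == b)))
        (if i == a then 1 else if i == b then -1 else o i) = 0 :> int.
      case: (boolP (h a == n)) => ha; last first.
        rewrite big1 // => x /andP[/andP[_ hx] /orP[]/eqP xa]; first by rewrite -xa hx in ha.
        by rewrite hab -xa hx in ha.
      rewrite (bigD1 a) /=; last by rewrite aR ha eqxx.
      rewrite (bigD1 b) /=; last by rewrite bR -hab ha eqxx orbT eq_sym ab.
      rewrite big1 ?addr0 => [|x]; first by rewrite !eqxx (eq_sym b) (negPf ab).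
      by case/andP => /andP[/andP[_ /orP[]/eqP ->]]; rewrite eqxx.
    rewrite add0r (eq_bigl (fun i => (i \in R) && (h i == n) && ~~ ((i == a) || (i == b)))); last first.
      move=> x; rewrite !inE; case: (x == a); case: (x == b); rewrite ?andbF ?andbT //=.
    rewrite [X in _ -> -1 <= X <= 1](eq_bigr o) //.
    by move=> x /andP[_]; rewrite negb_or => /andP[/negPf -> /negPf ->].
  exists (fun x => if x == a then 1 else if x == b then -1 else o x); split.
  - by move=> x; case: (x == a); [left|case: (x == b); [right|exact: o1]].
  - exact: bal.
  - exact: bal.
  - move=> x y xR yR xy fxy gxy.
    case: (x =P a) => [xa|/eqP xa].
      case: (y =P a) => [ya|/eqP ya]; first by rewrite xa ya eqxx in xy.
      case: (y =P b) => [yb|/eqP yb]; first by rewrite opprK.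
      by case: (mult a b y) => //; rewrite ?[a == y]eq_sym ?[b == y]eq_sym // -xa.
    case: (x =P b) => [xb|/eqP xb].
      case: (y =P a) => [ya|/eqP ya]; first by [].
      case: (y =P b) => [yb|/eqP yb]; first by rewrite xb yb eqxx in xy.
      by case: (mult a b y) => //; rewrite ?[a == y]eq_sym ?[b == y]eq_sym // ?fab ?gab -xb.
    case: (y =P a) => [ya|/eqP ya].
      by case: (mult a b x) => //; rewrite ?[a == x]eq_sym ?[b == x]eq_sym // -ya.
    case: (y =P b) => [yb|/eqP yb].
      by case: (mult a b x) => //; rewrite ?[a == x]eq_sym ?[b == x]eq_sym // ?fab ?gab -yb.
    by apply: op; rewrite // !inE ?xa ?xb ?ya ?yb.
(* Each sign counts positively at the [f] end and negatively at the [g] end, which the symmetric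
   bound does not see. *)
have [o [o1 Ho]] := balanced_signs R (fun i => inl (f i) : N1 + N2) (fun i => inr (g i)).
exists o; split=> //.
- move=> n; have := Ho (inl n); apply: abs_le1_eq.
  rewrite [RHS]big_mkcondr; apply: eq_bigr => i _; rewrite subr0.
  by rewrite (inj_eq (@inl_inj _ _)); case: (_ == _); rewrite ?mulr1 ?mulr0.
- move=> n; have := Ho (inr n); rewrite (_ : \sum_(i in R) _ = - \sum_(i in R | g i == n) o i).
    by move: (\sum_(_ in _ | _) _) => z; clear; lia.
  rewrite [X in _ = - X]big_mkcondr -sumrN; apply: eq_bigr => i _; rewrite sub0r.
  by rewrite (inj_eq (@inr_inj _ _)); case: (_ == _); rewrite ?mulrN ?mulr1 ?mulr0 // oppr0.
- move=> a b aR bR ab fab gab; case/negP: npar; apply/existsP; exists a; rewrite aR.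
  by apply/existsP; exists b; rewrite bR ab fab gab !eqxx.
Qed.

Lemma sum_signs (R : {set I}) (P : pred I) (o : I -> int) : (forall i, o i = 1 \/ o i = -1) ->
  \sum_(i in R | P i) o i
  = #|[set i in R | P i & o i == 1]|%:R - #|[set i in R | P i & o i != 1]|%:R.
Proof.
move=> o1; rewrite (bigID (fun i => o i == 1)) /=; congr (_ + _).
  rewrite (eq_bigr (fun=> 1)) => [|i /andP[_ /eqP] //].
  by rewrite sumr_const; congr (_ *+ _); apply: eq_card => i; rewrite !inE unfold_in /= andbA.
rewrite (eq_bigr (fun=> -1)) => [|i /andP[_]]; last by case: (o1 i) => ->.
rewrite sumr_const mulNrn; congr (- (_ *+ _)).
by apply: eq_card => i; rewrite !inE unfold_in /= andbA.
Qed.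

End Balanced.

(** * Edges between clusters and vertices of degree delta + 1 *)

Section ClusterEdges.
Variables (T : finType) (e : rel T).
Hypotheses (e_sym : symmetric e) (e_irr : irreflexive e).
Hypothesis (G_irred : AT_irreducible e).
Hypothesis (delta_ge4 : (4 <= min_degree e)%N).
Hypothesis (omega_le : (clique_number e <= min_degree e)%N).
Implicit Types (S K Z : {set T}) (v w y : T) (s : seq T).

Notation low := (low e).
Notation degin := (degin e).
Notation delta := (min_degree e).
Notation cluster := (cluster e).
Notation outer := (outer e).

(** Gluing on a clique makes at most one outer vertex of the old part and one of the clique inner,
    so at least delta - 1 remain on either side. *)
Lemma cluster_outer Z : cluster Z ->
  clique e Z /\ #|Z| = delta \/ (2 * delta - 2 <= #|[set v in Z | outer Z v]|)%N.
Proof.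
have dp : (2 <= delta)%N by apply: leq_trans delta_ge4.
elim=> [K cK dK|{}Z K z z' clZ IH cK dK dis z'Z zK ez cross]; [by left|right].
have oZ : (delta <= #|[set v in Z | outer Z v]|)%N.
  case: IH => [[cZ dZ]|H]; last by apply: leq_trans H; move: dp; clear; lia.
  rewrite -{1}dZ; apply: subset_leq_card; apply/subsetP => v vZ; rewrite inE vZ.
  by rewrite /outer degin_clique // dZ eqxx.
have sub : ([set v in Z | outer Z v] :\ z') :|: (K :\ z) \subset
           [set v in Z :|: K | outer (Z :|: K) v].
  apply/subsetP => v /setUP[/setD1P[vz]|/setD1P[vz vK]].
    rewrite !inE => /andP[vZ ov]; rewrite vZ /outer degin_setU //.
    rewrite (_ : degin K v = 0)%N ?addn0 //; apply: degin_eq0 => u uK; apply/negP => evu.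
    by have [vz' _] := cross _ _ vZ uK evu; rewrite vz' eqxx in vz.
  rewrite !inE vK orbT /outer degin_setU // (_ : degin Z v = 0)%N.
    by rewrite add0n degin_clique // dK eqxx.
  apply: degin_eq0 => u uZ; apply/negP => evu; rewrite e_sym in evu.
  by have [_ vz'] := cross _ _ uZ vK evu; rewrite vz' eqxx in vz.
apply: leq_trans (subset_leq_card sub).
rewrite cardsU (_ : _ :&: _ = set0) ?cards0 ?subn0; last first.
  apply/setP => v; rewrite !inE; case: (boolP (v \in Z)) => vZ; rewrite ?andbF //.
  by rewrite (disjointFr dis vZ) !andbF.
have := cardsD1 z K; have := cardsD1 z' [set v in Z | outer Z v].
rewrite zK dK; move: oZ (leq_b1 (z' \in [set v in Z | outer Z v])).
move: #|[set v in Z | outer Z v]| #|_ :\ z'| #|K :\ z| (nat_of_bool _) => a b c f.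
by clear; lia.
Qed.

Lemma outer_of_nbr Z v y : cluster Z -> Z \subset low -> v \in Z -> y \notin Z ->
  e v y -> outer Z v.
Proof.
move=> clZ ZL vZ yZ evy; rewrite /outer eqn_leq (cluster_degin e_irr clZ vZ) andbT.
have := degin_le_degree e (y |: Z) v; rewrite degin_setU1 // evy.
rewrite (degree_low (subsetP ZL v vZ)); move: (degin Z v) delta_ge4 => a.
by clear; lia.
Qed.

Lemma high_notin_low Z y : Z \subset low -> degree e y = delta.+1 -> y \notin Z.
Proof.
move=> ZL dy; apply/negP => /(subsetP ZL); rewrite inE dy.
by rewrite eq_sym ltn_eqF.
Qed.

(** A vertex adjacent to all outer vertices would extend a single K_delta to a clique larger than
    [clique_number] allows. In a larger cluster it would have 2 delta - 2 neighbours, more than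
    delta + 1. *)
Lemma outer_nonnbr Z y : cluster Z -> Z \subset low -> degree e y = delta.+1 ->
  exists v, [/\ v \in Z, outer Z v & ~~ e v y].
Proof.
move=> clZ ZL dy; have yZ := high_notin_low ZL dy.
case: (boolP [exists v in Z, outer Z v && ~~ e v y]) => [|H].
  by case/existsP => v /and3P[vZ ov nv]; exists v.
have all_nbr v : v \in Z -> outer Z v -> e v y.
  move=> vZ ov; apply: contraNT H => nv; apply/existsP; exists v.
  by rewrite vZ ov nv.
case: (cluster_outer clZ) => [[cZ dZ]|o2].
  have cyZ : clique e (y |: Z).
    have ally v : v \in Z -> e v y.
      by move=> vZ; apply: all_nbr => //; rewrite /outer degin_clique // dZ.
    apply/forall_inP => a aZ; apply/forall_inP => b bZ; apply/implyP.
    move: aZ bZ; rewrite !inE => /orP[/eqP ->|aZ] /orP[/eqP ->|bZ] ab.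
    - by rewrite eqxx in ab.
    - by rewrite e_sym ally.
    - exact: ally.
    - exact: clique_edge cZ _ _ ab.
  have : (#|y |: Z| <= delta)%N.
    by apply: leq_trans omega_le; apply: (@bigop.bigmax_sup _ (y |: Z)).
  by rewrite cardsU1 yZ dZ add1n ltnn.
have : (#|[set v in Z | outer Z v]| <= degree e y)%N.
  apply: subset_leq_card; apply/subsetP => v; rewrite !inE => /andP[vZ ov].
  by rewrite e_sym all_nbr.
rewrite dy => H'; have := leq_trans o2 H'; move: delta_ge4; clear; lia.
Qed.

Lemma sum_eps_isolates Z v v' s y : cluster Z -> Z \subset low -> degree e y = delta.+1 ->
  v \in Z -> v' \in Z -> v != v' -> isolates e Z v v' s ->
  \sum_(u <- s | e u y) eps e s u
  = (e v y)%:R * eps e s v + (e v' y)%:R * eps e s v'.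
Proof.
move=> clZ ZL dy vZ v'Z vv' [srch defs _ _ e0]; have yZ := high_notin_low ZL dy.
have sZ u : (u \in s) = (u \in Z) by rewrite -defs inE.
rewrite big_mkcond (bigD1_seq v) ?sZ ?(search_uniq srch) //=.
rewrite -big_filter (bigD1_seq v') ?mem_filter ?filter_uniq ?(search_uniq srch) ?sZ //=; last first.
  by rewrite eq_sym vv'.
rewrite big_seq_cond big1 ?addr0 => [|u].
  by case: (e v y); case: (e v' y); rewrite ?mul1r ?mul0r.
rewrite mem_filter sZ => /andP[/andP[uv uZ] uv']; case: ifP => // euy.
by apply: e0 => //; apply: outer_of_nbr euy.
Qed.

(** Isolate a neighbour of [y] and an outer vertex not adjacent to [y]: the form of [Z] is nonzero
    at [y]. With three edges from [y] to [Z], this one form already satisfies [forms_contradiction]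
    for [Y = [set y]]. *)
Lemma degin_cluster_le2 Z y : cluster Z -> Z \subset low -> degree e y = delta.+1 ->
  (degin Z y <= 2)%N.
Proof.
move=> clZ ZL dy; rewrite leqNgt; apply/negP => d3.
have yZ := high_notin_low ZL dy.
have /card_gt0P[v] : (0 < degin Z y)%N by apply: leq_trans d3.
rewrite inE => /andP[vZ evy]; rewrite e_sym in evy.
have ov := outer_of_nbr clZ ZL vZ yZ evy.
have [v' [v'Z ov' nv']] := outer_nonnbr clZ ZL dy.
have vv' : v != v' by apply: contraTneq evy => ->.
have d2 : (2 <= delta)%N by apply: leq_trans delta_ge4.
have [s iso] := cluster_isolate e_sym e_irr G_irred d2 clZ ZL vZ v'Z vv' ov ov'.
have [srch defs ev _ _] := iso.
have fv : yform e [set y] (fun=> s) Z y != 0.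
  rewrite /yform set11 mul1r (sum_eps_isolates clZ ZL dy vZ v'Z vv' iso) evy (negPf nv').
  by rewrite mul1r mul0r addr0.
apply: (@forms_contradiction _ e e_sym e_irr G_irred [set y] [set Z] (fun=> s)).
- by move=> W /set1P ->.
- by move=> W /set1P ->.
- by move=> W W' /set1P -> /set1P ->; rewrite eqxx.
- by move=> x /set1P ->.
- by apply/set0Pn; exists y; rewrite inE.
- by move=> W /set1P ->; exists y.
- move=> x /set1P ->; rewrite /cover big_set1; apply: leq_trans d3.
  rewrite -[3%N]/(1 + 2)%N leq_add2r -(cards1 Z); apply: subset_leq_card.
  by apply/subsetP => W; rewrite !inE => /andP[].
Qed.

Section Selection.
Variables (FA FB : {set {set T}}).
Hypothesis F_cl : forall Z, Z \in FA :|: FB -> cluster Z /\ Z \subset low.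
Hypothesis F_sep : forall Z Z', Z \in FA :|: FB -> Z' \in FA :|: FB -> Z != Z' ->
  forall a b, a \in Z -> b \in Z' -> a != b /\ ~~ e a b.
Hypothesis F_free : forall Z, Z \in FA ->
  exists v, [/\ v \in Z, outer Z v & degin low v = delta].

(** More than 1 edge guarantees one selected edge in a balanced selection, more than 4 guarantee
    two. *)
Definition demand Z : nat := if Z \in FB then 4 else 1.

(* [3] edges per vertex and [demand Z] edges per cluster are affordable. *)
Definition dense (p : {set T} * {set {set T}}) :=
  [&& [forall y in p.1, degree e y == delta.+1], p.2 \subset FA :|: FB &
   (3 * #|p.1| + \sum_(Z in p.2) demand Z < \sum_(y in p.1) \sum_(Z in p.2) degin Z y)%N].

Lemma same_cluster Z Z' v : Z \in FA :|: FB -> Z' \in FA :|: FB -> v \in Z -> v \in Z' -> Z = Z'.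
Proof. exact: cover_disjoint_mem F_sep. Qed.

Lemma degin_cover (F : {set {set T}}) y : F \subset FA :|: FB ->
  degin (cover F) y = (\sum_(Z in F) degin Z y)%N.
Proof.
move=> FF.
have tF : trivIset F.
  apply/trivIsetP => A B AF BF AB; rewrite -setI_eq0; apply/eqP/setP => x; rewrite !inE.
  apply/andP => -[xA xB]; case/eqP: AB.
  by apply: (same_cluster _ _ xA xB); apply: (subsetP FF).
by rewrite degin_sum big_trivIset //=; apply: eq_bigr => Z _; rewrite degin_sum.
Qed.

(** In a smallest dense pair every vertex has at least four edges into the clusters and every
    cluster exceeds its demand, since otherwise it could be dropped. A balanced selection of the
    edges then yields forms for [forms_contradiction]. *)
Lemma not_dense p : ~~ dense p.
Proof.
apply/negP => dp0; have [[Y F] dp minp] := @arg_minnP _ p dense (fun q => #|q.1| + #|q.2|)%N dp0.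
move: dp minp => /and3P[/= /forall_inP dY FF big_] minp.
have {dY} dY y : y \in Y -> degree e y = delta.+1 by move=> /dY/eqP.
have ZF Z : Z \in F -> Z \in FA :|: FB by apply: (subsetP FF).
have clF Z : Z \in F -> cluster Z by move=> /ZF/F_cl[].
have lowF Z : Z \in F -> Z \subset low by move=> /ZF/F_cl[].
have ydeg y : y \in Y -> (4 <= \sum_(Z in F) degin Z y)%N.
  move=> yY; rewrite leqNgt; apply/negP => small.
  have := minp (Y :\ y, F); rewrite /dense /= FF /=.
  have -> : [forall x in Y :\ y, degree e x == delta.+1].
    by apply/forall_inP => x /setD1P[_ /dY ->].
  move: big_; rewrite (cardsD1 y Y) yY (big_setD1 y yY) /=.
  move: small; move: (\sum_(Z in F) degin Z y)%N (\sum_(Z in F) demand Z)%N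
    (\sum_(x in Y :\ y) _)%N #|Y :\ y| #|F| => a b c d' f; clear; lia.
have zdeg Z : Z \in F -> (demand Z < \sum_(y in Y) degin Z y)%N.
  move=> ZF'; rewrite ltnNge; apply/negP => small.
  have := minp (Y, F :\ Z); rewrite /dense /=.
  have -> : [forall x in Y, degree e x == delta.+1].
    by apply/forall_inP => x /dY ->.
  have -> : F :\ Z \subset FA :|: FB by apply: subset_trans FF; apply: subsetDl.
  move: big_; rewrite (cardsD1 Z F) ZF' (big_setD1 Z ZF') /= exchange_big (big_setD1 Z ZF') /=.
  rewrite [X in (_ < _ + X)%N -> _]exchange_big /=.
  move: small; move: (\sum_(y in Y) degin Z y)%N (demand Z) (\sum_(W in F :\ Z) demand W)%N
    (\sum_(y in Y) \sum_(W in F :\ Z) degin W y)%N #|Y| #|F :\ Z| => a b c d' f h.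
  by clear; lia.
have Y0 : Y != set0.
  by apply: contraTneq big_ => ->; rewrite big_set0 -leqNgt.
(* A cluster vertex has at most one neighbour outside its cluster, so the edges are represented by
   their ends in the clusters. *)
pose R := [set v in cover F | [exists y in Y, e v y]].
pose yof v := odflt v [pick y in Y | e v y].
pose zof v := odflt set0 [pick Z in F | v \in Z].
have zofP v Z : Z \in F -> v \in Z -> zof v = Z.
  move=> ZF' vZ; rewrite /zof; case: pickP => [W /andP[WF vW]|/(_ Z)] /=.
    exact: same_cluster (ZF _ WF) (ZF _ ZF') vW vZ.
  by rewrite ZF' vZ.
have yuniq v y y' : v \in cover F -> y \in Y -> y' \in Y -> e v y -> e v y' -> y = y'.
  case/bigcupP => Z ZF' vZ yY y'Y evy evy'; apply/eqP; apply: contraT => yy'.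
  have yZ := high_notin_low (lowF Z ZF') (dY y yY).
  have y'Z := high_notin_low (lowF Z ZF') (dY y' y'Y).
  have := degin_le_degree e (y |: (y' |: Z)) v.
  rewrite !degin_setU1 ?evy ?evy' // ?inE ?negb_or ?yy' //.
  rewrite (degree_low (subsetP (lowF Z ZF') v vZ)).
  have := cluster_degin e_irr (clF Z ZF') vZ; move: (degin Z v) delta_ge4 => a; clear; lia.
have yofP v y : v \in cover F -> y \in Y -> e v y -> yof v = y.
  move=> vF yY evy; rewrite /yof; case: pickP => [x /andP[xY evx]|/(_ y)] /=.
    exact: yuniq vF xY yY evx evy.
  by rewrite yY evy.
have RP v : v \in R -> exists Z y, [/\ Z \in F, v \in Z, y \in Y, e v y & yof v = y /\ zof v = Z].
  rewrite inE => /andP[vF /existsP[y /andP[yY evy]]]; have [Z ZF' vZ] := bigcupP vF.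
  by exists Z, y; split=> //; split; [apply: yofP|apply: zofP].
have [a b c aR bR cR ab ac bc fab fac gab gac|o [o1 of_ og op]] :=
  @balanced_selection _ _ _ R yof zof.
  have [Z [y [ZF' aZ yY eay [ya za]]]] := RP a aR.
  have [Zb [yb [ZFb bZb ybY eby [yb' zb]]]] := RP b bR.
  have [Zc [yc [ZFc cZc ycY ecy [yc' zc]]]] := RP c cR.
  have := degin_cluster_le2 (clF Z ZF') (lowF Z ZF') (dY y yY); rewrite leqNgt => /negP; apply.
  apply: (@card_ge3 _ _ a b c) => //; rewrite inE.
  - by rewrite aZ e_sym.
  - by rewrite -za gab zb bZb -ya fab yb' e_sym.
  - by rewrite -za gac zc cZc -ya fac yc' e_sym.
pose X := [set v in R | o v == 1].
have Ry y : y \in Y -> [set v in R | yof v == y] = [set v in cover F | e y v].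
  move=> yY; apply/setP => v; rewrite inE; apply/andP/idP => [[vR /eqP yv]|].
    have [Z [y' [ZF' vZ _ evy' [yv' _]]]] := RP v vR.
    rewrite inE -yv yv' e_sym evy' andbT; apply/bigcupP; by exists Z.
  rewrite inE => /andP[vF eyv]; rewrite e_sym in eyv; split; last by apply/eqP; apply: yofP.
  by rewrite inE vF; apply/existsP; exists y; rewrite yY.
(* Of at least four edges at [y] the selected ones outnumber the others by at most one, so at least
   two are not selected. *)
have Xy y : y \in Y -> (#|[set v in X | e y v]| + 2 <= degin (cover F) y)%N.
  move=> yY; have := of_ y; rewrite sum_signs // !natz.
  have := ydeg y yY; rewrite -degin_cover // /degin -Ry //.
  have -> : [set v in X | e y v] = [set i in R | yof i == y & o i == 1].
    apply/setP => v; rewrite !inE -!andbA; case: (boolP (v \in cover F)) => //= vF.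
    case: (boolP [exists x in Y, e v x]) => //= /existsP[x /andP[xY evx]].
    rewrite andbC; congr (_ && _); rewrite (yofP v x) //; apply/idP/eqP => [eyv|<-]; last by rewrite e_sym.
    by apply: yuniq vF xY yY evx _; rewrite e_sym.
  have -> : #|[set v in R | yof v == y]| =
     (#|[set i in R | yof i == y & o i == 1%R]| + #|[set i in R | yof i == y & o i != 1%R]|)%N.
    rewrite -(cardsID [set i | o i == 1]); congr (_ + _)%N; apply: eq_card => i; rewrite !inE.
      by rewrite -!andbA.
    by rewrite andbC -!andbA.
  by move: #|[set i in R | _]| #|[set i in R | yof i == y & o i != 1]| => p0 q; clear; lia.
have RZ Z : Z \in F -> #|[set v in R | zof v == Z]| = (\sum_(y in Y) degin Z y)%N.
  move=> ZF'.
  have -> : (\sum_(y in Y) degin Z y = \sum_(y in Y) \sum_(v in Z) e v y)%N.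
    by apply: eq_bigr => y _; rewrite degin_sum; apply: eq_bigr => v _; rewrite e_sym.
  rewrite exchange_big /= -sum1_card big_mkcond [RHS]big_mkcond /=; apply: eq_bigr => v _.
  rewrite inE; case: (boolP (v \in Z)) => vZ; last first.
    case: (boolP (v \in R)) => //= vR; have [W [y [WF vW _ _ [_ zv]]]] := RP v vR.
    by rewrite zv; case: eqP => // WZ; rewrite -WZ vW in vZ.
  have vF : v \in cover F by apply/bigcupP; exists Z.
  rewrite (zofP v Z) // eqxx andbT; case: (boolP (v \in R)) => vR.
    have [W [y [WF vW yY evy [yv zv]]]] := RP v vR.
    rewrite (bigD1 y) //= evy big1 // => y' /andP[y'Y /eqP y'y].
    by case: (boolP (e v y')) => // evy'; case: y'y; apply: yuniq vF _ _ evy' evy.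
  rewrite big1 // => y yY; case: (boolP (e v y)) => // evy; case/negP: vR.
  by rewrite inE vF; apply/existsP; exists y; rewrite yY.
have XZ Z : Z \in F -> (demand Z < 2 * #|[set v in X | v \in Z]| + 1)%N.
  move=> ZF'; have := og Z; rewrite sum_signs // !natz.
  have := zdeg Z ZF'; rewrite -RZ //.
  have zZ v : v \in R -> (zof v == Z) = (v \in Z).
    move=> vR; have [W [y [WF vW _ _ [_ ->]]]] := RP v vR.
    apply/eqP/idP => [<- //|vZ]; exact: same_cluster (ZF _ WF) (ZF _ ZF') vW vZ.
  have -> : [set v in X | v \in Z] = [set i in R | zof i == Z & o i == 1].
    apply/setP => v; rewrite inE [v \in X]inE [RHS]inE; case: (boolP (v \in R)) => //= vR.
    by rewrite zZ // andbC.
  have -> : #|[set v in R | zof v == Z]| =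
     (#|[set i in R | zof i == Z & o i == 1%R]| + #|[set i in R | zof i == Z & o i != 1%R]|)%N.
    rewrite -(cardsID [set i | o i == 1]); congr (_ + _)%N; apply: eq_card => i; rewrite !inE.
      by rewrite -!andbA.
    by rewrite andbC -!andbA.
  by move: #|[set i in R | _]| #|[set i in R | zof i == Z & o i != 1]| => p0 q; clear; lia.
have d2 : (2 <= delta)%N by apply: leq_trans delta_ge4.
have XP v : v \in X -> exists Z y, [/\ Z \in F, v \in Z, y \in Y, e v y & yof v = y /\ zof v = Z].
  by rewrite inE => /andP[/RP].
have [ord Hord] : exists ord : {set T} -> seq T, forall Z, Z \in F ->
    [/\ search e (ord Z) /\ sset (ord Z) = Z,
        exists y, yform e Y ord Z y != 0
      & forall y, y \in Y -> yform e Y ord Z y != 0 -> exists2 u, u \in X & (u \in Z) && e u y].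
  suff [ord Hord] : exists ord : {set T} -> seq T, forall Z, Z \in F ->
    [/\ search e (ord Z) /\ sset (ord Z) = Z,
        exists y, (y \in Y) && (\sum_(v <- ord Z | e v y) eps e (ord Z) v != 0)
      & forall y, y \in Y -> \sum_(v <- ord Z | e v y) eps e (ord Z) v != 0 ->
          exists2 u, u \in X & (u \in Z) && e u y].
    exists ord => Z ZF'; have [h1 [y /andP[yY h2]] h3] := Hord Z ZF'; split=> //.
      by exists y; rewrite /yform yY mul1r.
    by move=> x xY; rewrite /yform xY mul1r; apply: h3.
  apply: (@fin_all_exists _ _ (fun Z s => Z \in F -> [/\ search e s /\ sset s = Z,
        exists y, (y \in Y) && (\sum_(v <- s | e v y) eps e s v != 0)
      & forall y, y \in Y -> \sum_(v <- s | e v y) eps e s v != 0 ->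
          exists2 u, u \in X & (u \in Z) && e u y])) => Z.
  case: (boolP (Z \in F)) => [ZF'|]; last by exists [::].
  have clZ := clF Z ZF'; have ZL := lowF Z ZF'.
  (* For [Z] in [FB] two selected vertices are taken; their neighbours in [Y] differ because
     parallel edges have opposite signs. Otherwise [v'] is the free vertex, which has no neighbour
     in [Y]. In both cases nothing cancels the term of [v]. *)
  have [v [v' [vX [vZ v'Z vv'] ov' Hv']]] : exists v v', [/\ v \in X, [/\ v \in Z, v' \in Z & v != v'],
      outer Z v' & forall y, y \in Y -> e v' y -> v' \in X /\ ~~ e v y].
    have := XZ Z ZF'; rewrite /demand; case: (boolP (Z \in FB)) => ZB Hc.
      have : (1 < #|[set v in X | v \in Z]|)%N by move: Hc; clear; lia.
      case/card_gt1P => v [v' []]; rewrite inE => /andP[vX vZ]; rewrite inE => /andP[v'X v'Z] vv'.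
      have [W [y [WF v'W yY ev'y [yv' zv']]]] := XP v' v'X.
      exists v, v'; split=> //.
        by apply: outer_of_nbr ev'y => //; apply: high_notin_low ZL (dY y yY).
      move=> x xY ev'x; split=> //; apply/negP => evx.
      have vF : v \in cover F by apply/bigcupP; exists Z.
      have v'F : v' \in cover F by apply/bigcupP; exists Z.
      move: vX v'X; rewrite [v \in X]inE [v' \in X]inE => /andP[vR /eqP ov] /andP[v'R /eqP ov'].
      have := op v v' vR v'R vv'; rewrite !(zofP _ Z) // (yofP v x) // (yofP v' x) //.
      by rewrite ov ov' => /(_ erefl erefl).
    have : (0 < #|[set v in X | v \in Z]|)%N by move: Hc; clear; lia.
    case/card_gt0P => v; rewrite inE => /andP[vX vZ].
    have ZA : Z \in FA by have := ZF Z ZF'; rewrite inE (negPf ZB) orbF.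
    have [v' [v'Z ov' dv']] := F_free ZA.
    have nv' y : y \in Y -> ~~ e v' y.
      move=> yY; apply/negP => ev'y; have yL := high_notin_low (subxx low) (dY y yY).
      have := degin_le_degree e (y |: low) v'; rewrite degin_setU1 // ev'y dv'.
      by rewrite (degree_low (subsetP ZL v' v'Z)) ltnn.
    have [W [y [WF vW yY evy _]]] := XP v vX.
    exists v, v'; split=> //.
      by split=> //; apply: contraTneq evy => ->; apply: nv'.
    by move=> x xY ev'x; have := nv' x xY; rewrite ev'x.
  have [W [y [WF vW yY evy [yv zv]]]] := XP v vX.
  have yZ := high_notin_low ZL (dY y yY).
  have ov := outer_of_nbr clZ ZL vZ yZ evy.
  have [s iso] := cluster_isolate e_sym e_irr G_irred d2 clZ ZL vZ v'Z vv' ov ov'.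
  have [srch defs e1 e2 _] := iso.
  exists s => _; split=> //.
    exists y; rewrite yY (sum_eps_isolates clZ ZL (dY y yY) vZ v'Z vv' iso) evy mul1r.
    case: (boolP (e v' y)) => ev'y; last by rewrite mul0r addr0.
    by have [_] := Hv' y yY ev'y; rewrite evy.
  move=> x xY; rewrite (sum_eps_isolates clZ ZL (dY x xY) vZ v'Z vv' iso).
  case: (boolP (e v x)) => evx; first by exists v => //; rewrite vZ.
  case: (boolP (e v' x)) => ev'x; last by rewrite !mul0r addr0 eqxx.
  by have [v'X _] := Hv' x xY ev'x; exists v' => //; rewrite v'Z.
apply: (@forms_contradiction _ e e_sym e_irr G_irred Y F ord) => //.
- by move=> Z /Hord[].
- by move=> Z Z' ZF1 ZF2; apply: F_sep; apply: ZF.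
- by move=> Z /Hord[].
move=> y yY; apply: leq_trans (Xy y yY); rewrite leq_add2r.
(* A form containing [y] comes with a selected neighbour of [y] in its cluster, so such forms are at
   most as many as the selected edges at [y]. *)
apply: leq_trans (leq_imset_card zof _); apply: subset_leq_card; apply/subsetP => Z.
rewrite inE => /andP[ZF' fZ]; have [_ _ /(_ y yY fZ)[u uX /andP[uZ euy]]] := Hord Z ZF'.
apply/imsetP; exists u; last by rewrite (zofP u Z).
by rewrite inE uX e_sym.
Qed.

End Selection.

End ClusterEdges.

(** * The theorem *)

Section Final.
Variables (T : finType) (e : rel T).
Hypotheses (e_sym : symmetric e) (e_irr : irreflexive e).
Implicit Types (S A B : {set T}) (v w y : T).

Notation low := (low e).
Notation degin := (degin e).
Notation delta := (min_degree e).

Lemma min_degree_le v : (delta <= degree e v)%N.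
Proof.
rewrite /min_degree; have : v \in index_enum T by rewrite mem_index_enum.
elim: (index_enum T) => // w s IH; rewrite inE big_cons => /orP[/eqP <-|/IH H].
  exact: geq_minl.
by apply: leq_trans (geq_minr _ _) H.
Qed.

Lemma handshake_le : (\sum_v degree e v <= 2 * num_edges e)%N.
Proof.
pose P := [set p : T * T | e p.1 p.2]; pose f (p : T * T) := [set p.1; p.2].
have -> : (\sum_v degree e v = #|P|)%N.
  rewrite -sum1_card (eq_bigl (fun p : T * T => true && e p.1 p.2)) => [|p]; last by rewrite inE.
  rewrite -(pair_big_dep predT e (fun _ _ => 1%N)) /=; apply: eq_bigr => v _.
  by rewrite sum1_card /degree; apply: eq_card => u; rewrite inE.
rewrite /num_edges /edge_set -/P -sum1_card (partition_big_imset f) /= mulnC -sum_nat_const.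
apply: leq_sum => E /imsetP[q qP ->]; rewrite sum1_card.
apply: leq_trans (_ : #|[set q; (q.2, q.1)]| <= 2)%N; last by rewrite cards2; case: (_ != _).
apply: subset_leq_card; apply/subsetP => p; rewrite unfold_in /= => /andP[pP /eqP fpq].
move: pP qP fpq; rewrite !inE; case: p => a b; case: q => c d /= eab ecd.
move=> /setP H; have := H a; have := H b; have := H c; have := H d; rewrite !inE !eqxx ?orbT /=.
have ab : a != b by apply: contraTneq eab => ->; rewrite e_irr.
have cd : c != d by apply: contraTneq ecd => ->; rewrite e_irr.
rewrite -!pair_eqE /= /pair_eq /=.
move=> /orP[]/eqP Hd /orP[]/eqP Hc _ _; subst; rewrite ?eqxx ?orbT //; by rewrite eqxx in cd.
Qed.

Lemma degin_sum_sym A B : (\sum_(v in A) degin B v = \sum_(u in B) degin A u)%N.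
Proof.
under eq_bigr do rewrite degin_sum.
rewrite exchange_big; apply: eq_bigr => u _ /=.
by rewrite degin_sum; apply: eq_bigr => v _; rewrite e_sym.
Qed.

Lemma degree_split A v : degree e v = (degin A v + degin (~: A) v)%N.
Proof.
rewrite -degin_setU; last by rewrite -setI_eq0 setICr.
by rewrite setUCr /degree; apply: eq_card => u; rewrite !inE.
Qed.

End Final.

(** [X] is the excess of the high degrees over [d]. The hypothesis [main] eliminates [L], and the
    rest is linear in [X], [H] and [Hk]. The estimates [h1], [h2], [h3] are all tight when every
    high vertex has degree d + 1 and c = (d - 2) * al, which explains the shape of [g]. *)
Lemma final_arith (d al c L H Hk X : rat) : 4 <= d -> 0 <= c -> c <= (d - 2) * al ->
  al <= 1 / 2 -> 0 <= Hk -> Hk <= H -> 2 * H - Hk <= X ->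
  al * (d - 2) * Hk <= (- 1 + 2 / d) * L + d * H + X ->
  (d + (d - 2) / ((d + 1 - c) * d + d - 2)) * (L + H) <= d * (L + H) + X.
Proof.
move=> d4 c0 cle al2 Hk0 HkH HX main.
have c2 : c <= (d - 2) / 2 by nra.
have den : 0 < (d + 1 - c) * d + d - 2 by nra.
rewrite mulrDl lerD2l mulrAC ler_pdivrMr //.
have d0 : 0 < d by lra.
have main' : (d - 2) * L <= d * d * H + d * X - d * (al * (d - 2)) * Hk.
  have E : d * ((- 1 + 2 / d) * L) = - (d - 2) * L by field; lra.
  have := ler_wpM2l (ltW d0) main; rewrite !mulrDr E; lra.
have dd : 2 * c * d <= d * d - 2 * d by nra.
have W : 0 <= d * d + d - 2 - c * d by nra.
have h2 : 0 <= (d * d + d - 2 - 2 * c * d) * (H - Hk) by apply: mulr_ge0; lra.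
have h3 : 0 <= d * ((al * (d - 2) - c) * Hk) by apply: mulr_ge0; [lra|apply: mulr_ge0; lra].
have h1 : 0 <= (d * d + d - 2 - c * d) * (X - (2 * H - Hk)) by apply: mulr_ge0; lra.
lra.
Qed.

Theorem theorem4p4 (T : finType) (e : rel T)
    (e_sym : symmetric e) (e_irr : irreflexive e)
    (G_irred : AT_irreducible e)
    (delta_ge4 : (4 <= min_degree e)%N)
    (omega_le : (clique_number e <= min_degree e)%N) :
  let delta := min_degree e in
  let c : rat :=
    if (6 <= delta)%N then (delta%:R - 2) * alpha delta.+1
    else (delta%:R - 3) * alpha delta.+1 in
  g delta.+1 #|T| c <= 2 * (num_edges e)%:R.
Proof.
pose delta := min_degree e.
pose c : rat := if (6 <= delta)%N then (delta%:R - 2) * alpha delta.+1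
                else (delta%:R - 3) * alpha delta.+1.
change (is_true (g delta.+1 #|T| c <= 2 * (num_edges e)%:R)).
have d4 : (4 : rat) <= delta%:R := d_ge4 delta_ge4.
have /andP[al1 al2] := alpha_bounds delta_ge4; rewrite -/delta in al1 al2.
pose al := alpha delta.+1; rewrite -/al in al1 al2.
(* Both cases of [c] satisfy the bounds on which [final_arith] rests. *)
have c0 : 0 <= c by rewrite /c -/al; case: ifP => _; apply: mulr_ge0; lra.
have cle : c <= (delta%:R - 2) * al by rewrite /c -/al; case: ifP => _ //; nra.
pose L := low e; pose H := ~: L; pose Hk := [set v | degree e v == delta.+1].
have [FA [FB [F1 F2 F3 F4]]] := low_counted e_sym e_irr G_irred delta_ge4 omega_le (subxx (low e)).
set C := cover (FA :|: FB) in F4.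
have CL : C \subset L by apply/bigcupsP => Z /F1[].
have HkH : Hk \subset H.
  by apply/subsetP => y; rewrite !inE => /eqP ->; rewrite eqn_leq ltnn.
have nd := not_dense e_sym e_irr G_irred delta_ge4 omega_le F1 F2 F3 (Hk, FA :|: FB).
(* [not_dense] applied to all vertices of degree delta + 1 and all clusters at once. *)
have eC : (\sum_(y in Hk) degin e C y <= 3 * #|Hk| + (#|FA| + 4 * #|FB|))%N.
  move: nd; rewrite /dense subxx /=; have -> : [forall y in Hk, degree e y == delta.+1].
    by apply/forall_inP => y; rewrite inE.
  rewrite /= -leqNgt => nd.
  rewrite (eq_bigr (fun y => (\sum_(Z in FA :|: FB) degin e Z y)%N)); last first.
    by move=> y _; apply: (degin_cover F2).
  apply: leq_trans nd _; rewrite leq_add2l.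
  rewrite (big_setID FB) /= addnC; apply: leq_add.
    rewrite (eq_bigr (fun=> 1%N)) => [|Z /setDP[_ /negPf ZB]]; last by rewrite /demand ZB.
    rewrite sum1_card; apply: subset_leq_card; apply/subsetP => Z.
    by rewrite !inE => /andP[/negPf ->]; rewrite orbF.
  rewrite (eq_bigr (fun=> 4%N)) => [|Z /setIP[_ ZB]]; last by rewrite /demand ZB.
  by rewrite sum_nat_const mulnC leq_mul2l /=; apply: subset_leq_card; apply: subsetIr.
have gapE : gap e L C = (\sum_(v in L :\: C) degin e H v)%N%:R.
  rewrite /gap natr_sum; apply: eq_bigr => v /setDP[vL _].
  have -> : min_degree e = (degin e L v + degin e H v)%N by rewrite -degree_split (degree_low vL).
  by rewrite natrD addrAC subrr add0r.
have gap_ge : (\sum_(y in Hk) degin e (L :\: C) y <= \sum_(v in L :\: C) degin e H v)%N.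
  rewrite -(degin_sum_sym e_sym); apply: leq_sum => v _; exact: degin_subset.
have LE y : degin e L y = (degin e (L :\: C) y + degin e C y)%N.
  rewrite -degin_setU; last by apply: disjoint_of_notin => x; rewrite inE => /andP[].
  by rewrite setUC -{1}(setID L C) (setIidPr CL).
have degH : (\sum_(y in Hk) degin e H y <= degsum e H)%N.
  rewrite /degsum [X in (_ <= X)%N](big_setID Hk) /= (setIidPr HkH); exact: leq_addr.
have hkdeg : (\sum_(y in Hk) degin e (L :\: C) y + \sum_(y in Hk) degin e C y
              + \sum_(y in Hk) degin e H y = delta.+1 * #|Hk|)%N.
  rewrite -!big_split /= (eq_bigr (fun=> delta.+1)) ?sum_nat_const 1?mulnC // => y.
  by rewrite inE -LE -degree_split => /eqP.
have low_sum : (\sum_(v in L) degin e H v + degsum e L = delta * #|L|)%N.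
  rewrite /degsum -big_split /= (eq_bigr (fun=> delta)) ?sum_nat_const 1?mulnC // => v vL.
  by rewrite addnC -degree_split (degree_low vL).
have high_sum : (\sum_(v in H) degree e v = \sum_(v in L) degin e H v + degsum e H)%N.
  rewrite (degin_sum_sym e_sym) /degsum -big_split /=; apply: eq_bigr => v _.
  exact: degree_split.
have tot : (\sum_v degree e v = delta * #|L| + \sum_(v in H) degree e v)%N.
  rewrite (bigID (fun v => v \in L)) /= (eq_bigr (fun=> delta)) ?sum_nat_const 1?mulnC.
    by congr (_ + _)%N; apply: eq_bigl => v; rewrite [RHS]inE.
  by move=> v vL; rewrite (degree_low vL).
have highX : (delta * #|H| + 2 * #|H| <= \sum_(v in H) degree e v + #|Hk|)%N.
  rewrite (big_setID Hk) /= (setIidPr HkH) -(cardsID Hk H) (setIidPr HkH).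
  rewrite (eq_bigr (fun=> delta.+1)) ?sum_nat_const => [|v]; last by rewrite inE => /eqP.
  have : (#|H :\: Hk| * delta.+2 <= \sum_(v in H :\: Hk) degree e v)%N.
    rewrite -sum_nat_const; apply: leq_sum => v; rewrite !inE => /andP[v1 v2].
    have := min_degree_le e v; rewrite -/delta.
    by move: v1 v2; rewrite -/delta; move: (degree e v) => a; clear; lia.
  move: (\sum_(_ in _) _)%N #|Hk| #|H :\: Hk| => a b f; clear; nia.
have cT : #|T| = (#|L| + #|H|)%N by rewrite cardsC.
have hs := handshake_le e_irr.
have gE : g delta.+1 #|T| c = (delta%:R + (delta%:R - 2) / ((delta%:R + 1 - c) * delta%:R + delta%:R - 2))
    * (#|L|%:R + #|H|%:R).
  rewrite /g cT natrD -natr1; congr ((_ + _ / _) * _); ring.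
rewrite gE.
have toR (m n : nat) : (m <= n)%N -> (m%:R : rat) <= n%:R by rewrite ler_nat.
have toE (m n : nat) : m = n -> (m%:R : rat) = n%:R by move=> ->.
move: eC gap_ge degH hkdeg low_sum high_sum tot highX hs F4.
move=> /toR eC /toR gap_ge /toR degH /toE hkdeg /toE low_sum /toE high_sum /toE tot /toR highX /toR hs.
rewrite gapE /sigma /slope -/delta -/al -/L.
move: eC gap_ge degH hkdeg low_sum high_sum tot highX hs; rewrite !natrD !natrM -!natr1.
have hkle : (#|Hk|%:R : rat) <= #|H|%:R by rewrite ler_nat subset_leq_card.
have hk0 : (0 : rat) <= #|Hk|%:R by rewrite ler0n.
have sH0 : (0 : rat) <= (\sum_(y in Hk) degin e H y)%N%:R by rewrite ler0n.
move: (\sum_(y in Hk) degin e C y)%N%:R (\sum_(y in Hk) degin e (L :\: C) y)%N%:R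
  (\sum_(v in L :\: C) degin e H v)%N%:R (\sum_(y in Hk) degin e H y)%N%:R
  (degsum e H)%:R (degsum e L)%:R (\sum_(v in L) degin e H v)%N%:R
  (\sum_(v in H) degree e v)%N%:R (\sum_v degree e v)%N%:R (num_edges e)%:R
  #|FA|%:R #|FB|%:R hkle hk0 sH0.
move=> sC sLC sg sH dH dL sLH sD sT ne fa fb hkle hk0 sH0.
move=> eC gap_ge degH hkdeg low_sum high_sum tot highX hs F4.
apply: le_trans (_ : _ <= delta%:R * (#|L|%:R + #|H|%:R) + (sD - delta%:R * #|H|%:R)) _; last first.
  by move: hs; rewrite tot; lra.
apply: (@final_arith _ al c _ _ #|Hk|%:R) => //; first by lra.
(* The delta + 1 edges at a vertex of [Hk] go to low vertices outside the clusters, to clusters or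
   to high vertices. They are paid for by [gap], by the clusters except for three edges per vertex,
   and by [degsum e H] respectively; delta + 1 - 3 = delta - 2. *)
have h1 : al * (sLC + sC - 3 * #|Hk|%:R) <= al * (sg + (fa + 4 * fb)) by apply: ler_wpM2l; lra.
have h2 : al * sH <= dH by nra.
have h3 : al * (delta%:R - 2) * #|Hk|%:R = al * (sLC + sC - 3 * #|Hk|%:R) + al * sH.
  rewrite -mulrA -mulrDr; congr (_ * _); lra.
rewrite h3; lra.
Qed.
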